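(* Let $d\ge 2$, let $B=\{z\in\mathbb{R}^d : |z|<1\}$ be the open unit ball of $\mathbb{R}^d$, and let $b:B\to\mathbb{R}$ be a Bloch function. Then there is a point $x$ on the unit sphere $S=\{x\in\mathbb{R}^d : |x|=1\}$ such that $$\int_{[0,x]} |\nabla b(\zeta)|\,e^{b(\zeta)}\,d|\zeta| < \infty .$$
   Context: A real-valued function $b$ on the unit ball $B$ of $\mathbb{R}^d$ is called a Bloch function if it is harmonic on $B$ and the semi-norm $\|b\|:=\sup_{z\in B}|\nabla b(z)|(1-|z|)$ is finite. Here $|\cdot|$ is the Euclidean norm, and $\int_{[0,x]} F(\zeta)\,d|\zeta|$ denotes integration with respect to arc length along the radius from $0$ to $x$, that is, $\int_0^1 F(rx)\,dr$. *)

(* Defs.v *)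
From HB Require Import structures.
From mathcomp Require Import all_boot all_order all_algebra.
From mathcomp Require Import all_classical all_reals all_analysis.

Set Implicit Arguments.
Unset Strict Implicit.
Unset Printing Implicit Defensive.

Import Order.TTheory GRing.Theory Num.Theory.
Import numFieldNormedType.Exports.

Local Open Scope classical_set_scope.
Local Open Scope ring_scope.

(* The library norm `|x| on 'rV[R]_d is the sup norm, hence the explicit
   Euclidean norm below.  Both norms induce the same topology, so the library
   notions of limit, continuity and derivative on 'rV[R]_d are the usual ones. *)
Definition enorm (R : realType) (d : nat) (x : 'rV[R]_d) : R :=
  Num.sqrt (\sum_(i < d) x ord0 i ^+ 2).

Definition unit_ball (R : realType) (d : nat) : set 'rV[R]_d :=
  [set z | enorm z < 1].

Definition unit_sphere (R : realType) (d : nat) : set 'rV[R]_d :=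
  [set x | enorm x = 1].

Definition partial_derivable (R : realType) (d : nat) (i : 'I_d)
    (f : 'rV[R]_d -> R) (z : 'rV[R]_d) : Prop :=
  derivable f z (delta_mx ord0 i).

Definition partial_derive (R : realType) (d : nat) (i : 'I_d)
    (f : 'rV[R]_d -> R) : 'rV[R]_d -> R :=
  fun z => 'D_(delta_mx ord0 i) f z.

Definition gradient (R : realType) (d : nat) (f : 'rV[R]_d -> R)
    (z : 'rV[R]_d) : 'rV[R]_d :=
  \row_(i < d) partial_derive i f z.

Definition laplacian (R : realType) (d : nat) (f : 'rV[R]_d -> R)
    (z : 'rV[R]_d) : R :=
  \sum_(i < d) partial_derive i (partial_derive i f) z.

(* A function on an open set U is represented by a total function whose values
   outside U are irrelevant: all notions below are local at points of U. *)
Definition C2_on (R : realType) (d : nat) (U : set 'rV[R]_d)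
    (f : 'rV[R]_d -> R) : Prop :=
  forall z, U z ->
    [/\ {for z, continuous f},
        forall i, partial_derivable i f z
                  /\ {for z, continuous (partial_derive i f)}
      & forall i j, partial_derivable j (partial_derive i f) z
                  /\ {for z, continuous (partial_derive j (partial_derive i f))}].

Definition harmonic_on (R : realType) (d : nat) (U : set 'rV[R]_d)
    (f : 'rV[R]_d -> R) : Prop :=
  C2_on U f /\ forall z, U z -> laplacian f z = 0.

Definition bloch_seminorm (R : realType) (d : nat) (b : 'rV[R]_d -> R)
    : \bar R :=
  ereal_sup [set (enorm (gradient b z) * (1 - enorm z))%:E
            | z in @unit_ball R d].

Definition bloch (R : realType) (d : nat) (b : 'rV[R]_d -> R) : Prop :=
  harmonic_on (@unit_ball R d) b /\ (bloch_seminorm b < +oo)%E.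

(* The integral is taken over r in [0, 1) rather than [0, 1]: F is only
   meaningful in the open ball, and the endpoint is a null set. *)
Definition radial_integral (R : realType) (d : nat) (F : 'rV[R]_d -> R)
    (x : 'rV[R]_d) : \bar R :=
  (\int[@lebesgue_measure R]_(r in `[0%R, 1%R[%classic) (F (r *: x))%:E)%E.

(* Main.v *)
(* Put u = b/N with N large, Y z = 1 - |z|^2 and g = Y e^u |grad u|, so that |grad u| Y <= M
   with M small.  If sum_k g(p_k) is bounded for all choices of points p_k at height 2^-k on a
   radius, then e^u is bounded on the radius and |grad b| e^b <= const g/Y is integrable there.
   Only the maximum principle is used to find the radius.

   Let gs z = sup_w g(w) kap(z,w), where the kernel kap is slowly varying, equals 1 on the
   diagonal and is subharmonic unless z is close to w.  Let Gk be the inf-convolution of gs at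
   scale 2^-k over points of height at least 2^-k, and J_k = Gk psi(Y/2^-k).  Minimise
     e^u + dl sum_(k<n) J_k + E sqrt Y - B gs
   over {Y >= r0} with r0 ~ 2^-n.  At a minimum z well above height r0, e^u drops by at most e
   around z, where e is a small multiple of the last three terms; Harnack's inequality bounds
   |grad u| by e, so the Laplacian of e^u, which is e^u |grad u|^2, is at most M e.  This is too
   small to compensate the negative Laplacians of the other terms.  Hence z has height
   below 2^-n, and comparison with a fixed point bounds sum_(k<n) J_k(z) independently of n;
   J_k(z) dominates g(p) for every p of height ~ 2^-k on the radius through z.  A limit of
   these radii as n grows is the required one. *)
Require Import Defs.
From mathcomp Require Import all_boot all_order all_algebra.
From mathcomp Require Import all_classical all_reals all_analysis.
From mathcomp Require Import ring lra.
Set Implicit Arguments.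
Unset Strict Implicit.
Unset Printing Implicit Defensive.

Import Order.TTheory GRing.Theory Num.Theory.
Import numFieldNormedType.Exports.

Local Open Scope classical_set_scope.
Local Open Scope ring_scope.

(** * Continuity *)

(** Neither [gs] nor the [Gk] are smooth, and the second-order condition at a minimum only needs a
    smooth function touching the functional from above. An infimum of smooth functions admits one; a
    supremum admits one touching from below. Hence the inf-convolution enters with a plus sign and
    [gs] with a minus sign. The functional is arranged so that whatever can be gained by moving away
    from [z], which is what bounds the drop of [expR u], reappears in the negative part of its
    Laplacian. The term [- B gs] pays for the positive parts of the Laplacians of the [J k], whose
    weights sum to at most [1] over all scales. If the kernel attaining [gs z] is centred near [z],
    it need not be subharmonic, but then the gradient bound makes [gs z] itself at most a multiple
    of [e]. *)

Section Continuity.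
Context {R : realType} {T : topologicalType}.
Implicit Types (f g : T -> R) (z : T).

Lemma ctsC (W : topologicalType) (a : W) z : continuous_at z (fun _ : T => a).
Proof. exact: cvg_cst. Qed.

Lemma cts_eq (W : topologicalType) (f g : T -> W) z : (forall t, f t = g t) ->
  continuous_at z g -> continuous_at z f.
Proof. by move=> /funext ->. Qed.

Lemma cts_id z : continuous_at z (fun t : T => t).
Proof. exact: cvg_id. Qed.

Lemma ctsD (W : normedModType R) (f g : T -> W) z : continuous_at z f ->
  continuous_at z g -> continuous_at z (fun t => f t + g t).
Proof. by move=> cf cg; exact: (@cvgD _ _ _ (nbhs z) _ f g _ _ cf cg). Qed.

Lemma ctsN (W : normedModType R) (f : T -> W) z : continuous_at z f ->
  continuous_at z (fun t => - f t).
Proof. by move=> cf; exact: (@cvgN _ _ _ (nbhs z) _ f _ cf). Qed.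

Lemma ctsM f g z : continuous_at z f -> continuous_at z g ->
  continuous_at z (fun t => f t * g t).
Proof. by move=> cf cg; exact: (@cvgM _ _ (nbhs z) _ f g _ _ cf cg). Qed.

Lemma ctsZ (W : normedModType R) f (g : T -> W) z : continuous_at z f ->
  continuous_at z g -> continuous_at z (fun t => f t *: g t).
Proof. by move=> cf cg; exact: (@cvgZ _ _ _ (nbhs z) _ f g _ _ cf cg). Qed.

Lemma ctsX f n z : continuous_at z f -> continuous_at z (fun t => f t ^+ n).
Proof.
move=> cf; elim: n => [|n IH]; first by apply: (cts_eq (fun t => expr0 (f t))); exact: ctsC.
by apply: (cts_eq (fun t => exprS (f t) n)); exact: ctsM.
Qed.

Lemma ctsV f z : f z != 0 -> continuous_at z f -> continuous_at z (fun t => (f t)^-1).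
Proof. by move=> f0 cf; exact: (@cvgV _ _ (nbhs z) _ f _ f0 cf). Qed.

Lemma cts_comp (U W : topologicalType) (f : T -> U) (g : U -> W) z :
  continuous_at z f -> continuous_at (f z) g -> continuous_at z (fun t => g (f t)).
Proof. exact: continuous_comp. Qed.

Lemma cts_sqrt f z : continuous_at z f -> continuous_at z (fun t => Num.sqrt (f t)).
Proof. by move=> cf; apply: (cts_comp cf); exact: sqrt_continuous. Qed.

Lemma cts_exp f z : continuous_at z f -> continuous_at z (fun t => expR (f t)).
Proof. by move=> cf; apply: (cts_comp cf); exact: continuous_expR. Qed.

Lemma cts_sum (I : Type) (r : seq I) (f : I -> T -> R) z :
  (forall i, continuous_at z (f i)) ->
  continuous_at z (fun t => \sum_(i <- r) f i t).
Proof.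
move=> cf; apply: (@cvg_big _ _ +%R 0 xpredT add_continuous _ (nbhs z) r f (fun i => f i z)) => i _.
exact: cf.
Qed.

Lemma cts_min f g z : continuous_at z f -> continuous_at z g ->
  continuous_at z (fun t => Num.min (f t) (g t)).
Proof. by move=> cf cg; exact: continuous_min. Qed.

Lemma cts_gt f z a : continuous_at z f -> a < f z -> \forall t \near z, a < f t.
Proof. by move=> cf af; exact: (cvgr_gt _ cf). Qed.

Lemma cts_lt f z a : continuous_at z f -> f z < a -> \forall t \near z, f t < a.
Proof. by move=> cf af; exact: (cvgr_lt _ cf). Qed.

Lemma cts_near (U : topologicalType) (f : T -> U) (z : T) (P : U -> Prop) :
  continuous_at z f -> (\forall y \near f z, P y) -> \forall t \near z, P (f t).
Proof. by move=> cf HP; exact: (cf _ HP). Qed.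

Lemma cts_coord d (f : T -> 'rV[R]_d) z i : continuous_at z f ->
  continuous_at z (fun t => f t ord0 i).
Proof.
move=> cf; apply: (@continuous_comp _ _ _ f (fun M : 'rV[R]_d => M ord0 i) z) => //.
exact: coord_continuous.
Qed.

Lemma EVT_min_on f (A : set T) : A !=set0 -> compact A ->
  (forall z, A z -> continuous_at z f) -> exists2 c, A c & forall t, A t -> f c <= f t.
Proof.
move=> A0 cA cf; have [|c /set_mem Ac Hc] := compact_EVT_min A0 cA (f := f).
  by apply: continuous_in_subspaceT => z /set_mem; exact: cf.
by exists c => // t At; apply: Hc; apply: mem_set.
Qed.

Lemma EVT_max_on f (A : set T) : A !=set0 -> compact A ->
  (forall z, A z -> continuous_at z f) -> exists2 c, A c & forall t, A t -> f t <= f c.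
Proof.
move=> A0 cA cf; have [c Ac Hc] := @EVT_min_on (fun t => - f t) A A0 cA (fun z Az => ctsN (cf z Az)).
by exists c => // t At; rewrite -lerN2; exact: Hc.
Qed.

End Continuity.

Ltac cts_step := lazymatch goal with
  | |- continuous_at ?z (fun x => x) => exact: cts_id
  | |- continuous_at ?z (fun x => @?f x + @?g x) => refine (@ctsD _ _ _ f g z _ _)
  | |- continuous_at ?z (fun x => - @?f x) => refine (@ctsN _ _ _ f z _)
  | |- continuous_at ?z (fun x => (@?f x) ^+ ?n) => refine (@ctsX _ _ f n z _)
  | |- continuous_at ?z (fun x => @?f x * @?g x) => refine (@ctsM _ _ f g z _ _)
  | |- continuous_at ?z (fun x => @?f x *: @?g x) => refine (@ctsZ _ _ _ f g z _ _)
  | |- continuous_at ?z (fun x => Num.sqrt (@?f x)) => refine (@cts_sqrt _ _ f z _)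
  | |- continuous_at ?z (fun x => expR (@?f x)) => refine (@cts_exp _ _ f z _)
  | |- continuous_at ?z (fun x => Num.min (@?f x) (@?g x)) => refine (@cts_min _ _ f g z _ _)
  end.
Ltac cts_tac := repeat first [assumption | exact: ctsC | cts_step].

(** * Euclidean structure *)

Section Euclid.
Context {R : realType} {d : nat}.
Local Notation V := 'rV[R]_d.
Implicit Types x y z : V.

Definition dot x y : R := \sum_(i < d) x ord0 i * y ord0 i.
Definition sq x : R := dot x x.
Definition ei (i : 'I_d) : V := delta_mx ord0 i.

Lemma dotC x y : dot x y = dot y x.
Proof. by apply: eq_bigr => i _; rewrite mulrC. Qed.

Lemma dotDl x y z : dot (x + y) z = dot x z + dot y z.
Proof. by rewrite -big_split; apply: eq_bigr => i _; rewrite mxE mulrDl. Qed.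

Lemma dotZl a x y : dot (a *: x) y = a * dot x y.
Proof. by rewrite mulr_sumr; apply: eq_bigr => i _; rewrite mxE mulrA. Qed.

Lemma dotDr x y z : dot z (x + y) = dot z x + dot z y.
Proof. by rewrite dotC dotDl !(dotC _ z). Qed.

Lemma dotZr a x y : dot y (a *: x) = a * dot y x.
Proof. by rewrite dotC dotZl dotC. Qed.

Lemma dotNl x y : dot (- x) y = - dot x y.
Proof. by rewrite -scaleN1r dotZl mulN1r. Qed.

Lemma dotNr x y : dot y (- x) = - dot y x.
Proof. by rewrite dotC dotNl dotC. Qed.

Lemma dot0l x : dot 0 x = 0.
Proof. by rewrite -[0](scale0r 0) dotZl mul0r. Qed.

Lemma sqD x y : sq (x + y) = sq x + 2 * dot x y + sq y.
Proof. rewrite /sq dotDl !dotDr (dotC y x); ring. Qed.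

Lemma sqB x y : sq (x - y) = sq x - 2 * dot x y + sq y.
Proof. by rewrite sqD /sq dotNr dotNl dotNr; ring. Qed.

Lemma sqN x : sq (- x) = sq x.
Proof. by rewrite /sq dotNl dotNr opprK. Qed.

Lemma sqBC x y : sq (x - y) = sq (y - x).
Proof. by rewrite -sqN opprB. Qed.

Lemma sqZ a x : sq (a *: x) = a ^+ 2 * sq x.
Proof. by rewrite /sq dotZl dotZr; ring. Qed.

Lemma sq_ge0 x : 0 <= sq x.
Proof. by apply: sumr_ge0 => i _; rewrite -expr2 sqr_ge0. Qed.

Lemma sq0 : sq 0 = 0.
Proof. by rewrite /sq dot0l. Qed.

Lemma dot_ei x i : dot x (ei i) = x ord0 i.
Proof.
rewrite /dot (bigD1 i) //= big1 ?addr0 => [|j ji].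
  by rewrite mxE !eqxx mulr1.
by rewrite mxE (negbTE ji) andbF mulr0.
Qed.

Lemma sq_ei i : sq (ei i) = 1.
Proof. by rewrite /sq dot_ei mxE !eqxx. Qed.

Lemma sqr_coord_le x i : x ord0 i ^+ 2 <= sq x.
Proof.
rewrite /sq /dot (bigD1 i) //= expr2 lerDl.
by apply: sumr_ge0 => j _; rewrite -expr2 sqr_ge0.
Qed.

Lemma enormE x : enorm x = Num.sqrt (sq x).
Proof. by congr Num.sqrt; apply: eq_bigr => i _; rewrite expr2. Qed.

Lemma enorm_ge0 x : 0 <= enorm x.
Proof. by rewrite enormE sqrtr_ge0. Qed.

Lemma sqr_enorm x : enorm x ^+ 2 = sq x.
Proof. by rewrite enormE sqr_sqrtr // sq_ge0. Qed.

Lemma enorm_le x a : 0 <= a -> (enorm x <= a) = (sq x <= a ^+ 2).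
Proof. by move=> a0; rewrite -sqr_enorm ler_pXn2r ?nnegrE ?enorm_ge0. Qed.

Lemma enorm_lt x a : 0 <= a -> (enorm x < a) = (sq x < a ^+ 2).
Proof. by move=> a0; rewrite -sqr_enorm ltr_pXn2r ?nnegrE ?enorm_ge0. Qed.

Lemma coord_le x i : `|x ord0 i| <= enorm x.
Proof.
rewrite -(@ler_pXn2r _ 2) ?nnegrE ?enorm_ge0 // sqr_enorm -normrX ger0_norm ?sqr_ge0 //.
exact: sqr_coord_le.
Qed.

Lemma dot_le x y : dot x y <= enorm x * enorm y.
Proof.
have := enorm_ge0 x; have := enorm_ge0 y.
rewrite le_eqVlt => /predU1P[y0 _|y0].
  have /eqP y00 : y == 0.
    apply/eqP/rowP => i; rewrite mxE; apply/eqP.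
    by rewrite -normr_le0 y0 coord_le.
  by rewrite -y0 mulr0 y00 dotC dot0l.
rewrite le_eqVlt => /predU1P[x0|x0].
  have /eqP x00 : x == 0.
    apply/eqP/rowP => i; rewrite mxE; apply/eqP.
    by rewrite -normr_le0 x0 coord_le.
  by rewrite -x0 mul0r x00 dot0l.
(* This square expands to [2 |x| |y| (|x| |y| - dot x y)]. *)
have := sq_ge0 (enorm y *: x - enorm x *: y).
rewrite sqB !sqZ dotZl dotZr -!sqr_enorm => H.
suff : 0 <= enorm x * enorm y * (enorm x * enorm y - dot x y).
  by rewrite pmulr_rge0 ?mulr_gt0 // subr_ge0.
nra.
Qed.

Lemma norm_dot_le x y : `|dot x y| <= enorm x * enorm y.
Proof.
rewrite ler_norml dot_le andbT -(opprK (dot x y)) lerN2 -dotNl.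
by apply: le_trans (dot_le _ _) _; rewrite [enorm (- x)]enormE sqN -enormE.
Qed.

Lemma enormN x : enorm (- x) = enorm x.
Proof. by rewrite !enormE sqN. Qed.

Lemma enormBC x y : enorm (x - y) = enorm (y - x).
Proof. by rewrite -enormN opprB. Qed.

Lemma enormZ a x : enorm (a *: x) = `|a| * enorm x.
Proof. by rewrite !enormE sqZ sqrtrM ?sqr_ge0 // sqrtr_sqr. Qed.

Lemma enormD x y : enorm (x + y) <= enorm x + enorm y.
Proof.
rewrite enorm_le ?addr_ge0 ?enorm_ge0 // sqD -!sqr_enorm.
have := dot_le x y; nra.
Qed.

Lemma enorm0 : enorm (0 : V) = 0.
Proof. by rewrite enormE sq0 sqrtr0. Qed.

Lemma enorm_tri x y z : enorm (x - z) <= enorm (x - y) + enorm (y - z).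
Proof. by apply: le_trans (enormD _ _); rewrite addrA subrK. Qed.

Lemma enorm_ei i : enorm (ei i) = 1.
Proof. by rewrite enormE sq_ei sqrtr1. Qed.

Lemma sum_coord_le x : \sum_i `|x ord0 i| <= d%:R * enorm x.
Proof.
apply: le_trans (_ : \sum_(i < d) enorm x <= _).
  by apply: ler_sum => i _; apply: coord_le.
by rewrite sumr_const card_ord mulr_natl.
Qed.

Lemma enorm_le_sum x : enorm x <= \sum_i `|x ord0 i|.
Proof.
rewrite enorm_le ?sumr_ge0 // /sq /dot expr2 mulr_suml.
apply: ler_sum => i _; apply: le_trans (ler_norm _) _; rewrite normrM.
apply: ler_wpM2l => //; rewrite (bigD1 i) //= lerDl; exact: sumr_ge0.
Qed.

Lemma cts_dot (T : topologicalType) (f g : T -> V) (z : T) : continuous_at z f ->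
  continuous_at z g -> continuous_at z (fun t : T => dot (f t) (g t)).
Proof. by move=> cf cg; apply: cts_sum => i; apply: ctsM; exact: cts_coord. Qed.

Lemma cts_sq (T : topologicalType) (f : T -> V) (z : T) : continuous_at z f ->
  continuous_at z (fun t : T => sq (f t)).
Proof. by move=> cf; apply: cts_dot. Qed.

Lemma cts_enorm (T : topologicalType) (f : T -> V) (z : T) : continuous_at z f ->
  continuous_at z (fun t : T => enorm (f t)).
Proof.
move=> cf; apply: (cts_eq (fun t => enormE (f t))).
exact: (cts_sqrt (cts_sq cf)).
Qed.

Lemma sqB_cont p : continuous (fun x : V => sq (x - p)).
Proof.
move=> z.
have H : continuous_at z (fun x : V => x - p). refine (@ctsD _ _ _ (fun x => x) (fun x => - p) z _ _).   refine (cts_id (z := z)). refine (@ctsC _ _ (-p) z).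
exact: (cts_sq H).
Qed.

Lemma closed_set_le (f : V -> R) a : continuous f -> closed [set x | f x <= a].
Proof.
by move=> cf; apply: (@closed_comp _ _ f [set y | y <= a]) => [x _|]; [exact: cf|exact: closed_le].
Qed.

(** The library norm is the sup norm, which the Euclidean norm dominates coordinate by coordinate;
    so a Euclidean ball is bounded in the library sense. *)
Lemma cball_compact p r : compact [set x : V | sq (x - p) <= r].
Proof.
apply: bounded_closed_compact; last by apply: closed_set_le; exact: sqB_cont.
exists (`|p| + (r + 1)); split; first by apply: num_real.
move=> M HM x /= Hx; apply: le_trans (ltW HM).
have -> : x = p + (x - p) by rewrite addrC subrK.
apply: le_trans (ler_normD _ _) _; rewrite lerD2l.
have r0 : 0 <= r := le_trans (sq_ge0 _) Hx.
rewrite [leLHS]mx_normrE; apply/bigmax_leP; split => [|[i j] _ /=]; first lra.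
have -> : i = ord0 by apply/val_inj; case: i => -[].
apply: le_trans (coord_le _ _) _; rewrite enorm_le; nra.
Qed.

End Euclid.

(** * Second-order expansions *)

Section Line.
Context {R : realType}.

Lemma is_derive_cts (f : R -> R) (x a : R) : is_derive x 1 f a -> continuous_at x f.
Proof. by case=> D _; apply: differentiable_continuous; apply/derivable1_diffP. Qed.

Lemma mvt_line (f f' : R -> R) (a b : R) :
  (forall x, Num.min a b <= x <= Num.max a b -> is_derive x 1 f (f' x)) ->
  exists2 x, Num.min a b <= x <= Num.max a b & f b - f a = f' x * (b - a).
Proof.
wlog ab : a b / a <= b.
  move=> H D; have /orP[ab|ba] := le_total a b; first exact: (H a b).
  have [|x xab E] := H b a ba; first by rewrite minC maxC.
  by exists x; rewrite 1?minC 1?maxC // -opprB E -mulrN opprB.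
rewrite min_l // max_r // => D.
have [||x xab E] := @MVT_segment _ f f' a b ab.
- by move=> x; rewrite in_itv /= => /andP[/ltW ax /ltW xb]; apply: D; rewrite ax.
- apply: continuous_in_subspaceT => x /set_mem /=; rewrite in_itv /= => xab.
  by have := D x xab; exact: is_derive_cts.
- by exists x => //; move: xab; rewrite in_itv.
Qed.

Lemma between0 (s t : R) : Num.min 0 s <= t <= Num.max 0 s -> `|t| <= `|s|.
Proof.
by case: (leP 0 s) => hs; [rewrite (ger0_norm hs)|rewrite (ltr0_norm hs)]; rewrite ler_norml; lra.
Qed.

End Line.

Section Jets.
Context {R : realType}.
Implicit Types (f g w : R -> R) (a b c s : R).

(* Second-order expansion of [f] at [0] in Caratheodory form; [c] is half the
   second derivative. *)
Definition jet f a b c := exists w, [/\ continuous_at 0 w, w 0 = c &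
  \forall s \near 0, f s = a + b * s + s ^+ 2 * w s].

Lemma jet_val f a b c : jet f a b c -> f 0 = a.
Proof.
by case=> w [_ _ /nbhs_singleton ->]; rewrite mulr0 expr0n mul0r !addr0.
Qed.

Lemma jet_cst a : jet (fun=> a) a 0 0.
Proof.
exists (fun=> 0); split => //; first exact: ctsC.
by near=> s; rewrite mul0r mulr0 !addr0.
Unshelve. all: by end_near. Qed.

Lemma jet_quad a b c f : (forall s, f s = a + b * s + c * s ^+ 2) -> jet f a b c.
Proof.
move=> H; exists (fun=> c); split => //; first exact: ctsC.
by near=> s; rewrite H [c * _]mulrC.
Unshelve. all: by end_near. Qed.

Lemma jet_eq f g a b c : (forall s, f s = g s) -> jet g a b c -> jet f a b c.
Proof. by move=> /funext ->. Qed.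

Lemma jetD f g a b c a' b' c' : jet f a b c -> jet g a' b' c' ->
  jet (fun s => f s + g s) (a + a') (b + b') (c + c').
Proof.
move=> [w [cw w0 Hw]] [w' [cw' w0' Hw']]; exists (fun s => w s + w' s); split.
- cts_tac.
- by rewrite w0 w0'.
- by near=> s; rewrite (near Hw s) // (near Hw' s) //; ring.
Unshelve. all: by end_near. Qed.

Lemma jetM f g a b c a' b' c' : jet f a b c -> jet g a' b' c' ->
  jet (fun s => f s * g s) (a * a') (a * b' + b * a') (a * c' + b * b' + c * a').
Proof.
move=> [w [cw w0 Hw]] [w' [cw' w0' Hw']].
exists (fun s => a * w' s + b * b' + w s * a' + s * (b * w' s + w s * b') + s ^+ 2 * (w s * w' s)).
split.
- by cts_tac.
- by rewrite w0 w0' /=; ring.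
- by near=> s; rewrite (near Hw s) // (near Hw' s) //; ring.
Unshelve. all: by end_near. Qed.

Lemma jetZ k f a b c : jet f a b c -> jet (fun s => k * f s) (k * a) (k * b) (k * c).
Proof.
by move=> H; have := jetM (jet_cst k) H; rewrite !mul0r !addr0.
Qed.

Lemma jetN f a b c : jet f a b c -> jet (fun s => - f s) (- a) (- b) (- c).
Proof.
move=> /(jetZ (-1)); rewrite !mulN1r; apply: jet_eq => s; by rewrite mulN1r.
Qed.

Lemma jetB f g a b c a' b' c' : jet f a b c -> jet g a' b' c' ->
  jet (fun s => f s - g s) (a - a') (b - b') (c - c').
Proof. by move=> H1 /jetN H2; exact: jetD. Qed.

Lemma jet_refl f a b c : jet f a b c -> jet (fun s => f (- s)) a (- b) c.
Proof.
move=> [w [cw w0 Hw]]; exists (fun s => w (- s)).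
have cN : continuous_at (0:R) (fun s : R => - s) by cts_tac.
split; [|by rewrite oppr0|].
  by apply: (cts_comp cN); rewrite oppr0.
have : \forall s \near (0:R), f (- s) = a + b * (- s) + (- s) ^+ 2 * w (- s).
  by apply: (cts_near (P := fun t => f t = a + b * t + t ^+ 2 * w t) cN); rewrite oppr0.
by apply: filterS => s ->; rewrite sqrrN mulrN mulNr.
Qed.

Lemma jet_comp F f a b c F1 F2 : jet (fun x => F (a + x)) (F a) F1 F2 ->
  jet f a b c -> jet (fun s => F (f s)) (F a) (F1 * b) (F1 * c + F2 * b ^+ 2).
Proof.
move=> [W [cW W0 HW]] [w [cw w0 Hw]].
pose q s := b * s + s ^+ 2 * w s.
have cq : continuous_at (0:R) q by rewrite /q; cts_tac.
have q0 : q 0 = 0 by rewrite /q mulr0 expr0n mul0r addr0.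
exists (fun s => F1 * w s + (b + s * w s) ^+ 2 * W (q s)); split.
- have cW' : continuous_at (0:R) (fun s => W (q s)) by apply: (cts_comp cq); rewrite q0.
  by cts_tac.
- by rewrite q0 w0 W0 mul0r addr0; ring.
- have HW' : \forall s \near (0:R), F (a + q s) = F a + F1 * q s + q s ^+ 2 * W (q s).
    by apply: (cts_near (P := fun t => F (a + t) = F a + F1 * t + t ^+ 2 * W t) cq); rewrite q0.
  near=> s.
  rewrite (near Hw s) // -addrA -/(q s) (near HW' s) // /q; ring.
Unshelve. all: by end_near. Qed.

Lemma jet_inv a : a != 0 -> jet (fun x => (a + x)^-1) a^-1 (- a ^- 2) (a ^- 3).
Proof.
move=> a0; exists (fun x => a ^- 2 * (a + x)^-1).
have cs : continuous_at (0:R) (fun x : R => a + x) by cts_tac.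
split.
- cts_tac; apply: ctsV => //=; by rewrite addr0.
- by rewrite addr0 -invfM -exprSr.
- have : \forall x \near (0:R), a + x != 0.
    have cn : continuous_at (0:R) (fun x : R => `|a + x|).
      by apply: (cts_comp cs); exact: norm_continuous.
    have : 0 < `|a + 0| by rewrite addr0 normr_gt0.
    by move=> /(cts_gt cn); apply: filterS => x; rewrite normr_gt0.
  apply: filterS => x x0; field; by rewrite x0 a0.
Qed.

Lemma jet_sqrt a : 0 < a -> jet (fun x => Num.sqrt (a + x)) (Num.sqrt a)
  (2 * Num.sqrt a)^-1 (- (8 * Num.sqrt a ^+ 3)^-1).
Proof.
move=> a0; have sa : 0 < Num.sqrt a by rewrite sqrtr_gt0.
(* The remainder [sqrt (a + x) - sqrt a - x / (2 sqrt a)] equals [- (sqrt (a + x) - sqrt a) ^ 2 / (2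
   sqrt a)]; rationalising the difference gives this quotient by [x ^ 2]. *)
exists (fun x => - (2 * Num.sqrt a * (Num.sqrt a + Num.sqrt (a + x)) ^+ 2)^-1).
have cs : continuous_at (0:R) (fun x : R => a + x) by cts_tac.
split.
- apply: ctsN; apply: ctsV => /=; first by rewrite addr0 lt0r_neq0 // !(mulr_gt0, exprn_gt0, addr_gt0).
  by cts_tac.
- by rewrite addr0; congr (- _^-1); ring.
- have : 0 < a + 0 by rewrite addr0.
  move=> /(cts_gt cs); apply: filterS => x ax.
  have sb : 0 < Num.sqrt (a + x) by rewrite sqrtr_gt0.
  have -> : x = Num.sqrt (a + x) ^+ 2 - Num.sqrt a ^+ 2 by rewrite !sqr_sqrtr ?ltW //; ring.
  set B := Num.sqrt (a + x); set A := Num.sqrt a.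
  have -> : Num.sqrt (a + (B ^+ 2 - A ^+ 2)) = B.
    by rewrite /A /B !sqr_sqrtr ?ltW // addrC subrK.
  field; rewrite -/A -/B; apply/andP; split; apply: lt0r_neq0; rewrite ?addr_gt0 //.
Qed.

Lemma jet_eqc f a b c a' b' c' : jet f a' b' c' -> a = a' -> b = b' -> c = c' -> jet f a b c.
Proof. by move=> H -> -> ->. Qed.

Lemma jetX f a b c n : jet f a b c -> jet (fun s => f s ^+ n) (a ^+ n)
  (n%:R * a ^+ n.-1 * b) (n%:R * a ^+ n.-1 * c + 'C(n, 2)%:R * a ^+ n.-2 * b ^+ 2).
Proof.
move=> H; elim: n => [|n IH].
  rewrite !mul0r !addr0; exact: jet_eq (jet_cst 1).
apply: (jet_eqc (jet_eq (fun s => exprS (f s) n) (jetM H IH))).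
- by rewrite exprS.
- case: n {IH} => [|n] /=; first by rewrite !expr0; ring.
  by rewrite exprS -!natr1; ring.
- rewrite binS bin1 natrD; case: n {IH} => [|[|n]] /=.
  + by rewrite bin_small // expr0; ring.
  + by rewrite bin_small // expr0; ring.
  + by rewrite !exprS -!natr1; ring.
Qed.

(** Differentiability of [f'] at the single point [0] suffices: the mean value theorem for the
    remainder [g] reduces the second-order error of [f] to the first-order error of [f'] at some [t]
    with [|t| <= |s|]. *)
Lemma jet_Peano f (f' : R -> R) b c :
  (\forall s \near (0 : R), is_derive (s : R) 1 f (f' s)) -> f' 0 = b -> is_derive (0 : R) 1 f' c ->
  jet f (f 0) b (c / 2).
Proof.
move=> df f'0 df'.
pose w s := if s == 0 then c / 2 else (f s - f 0 - b * s) / s ^+ 2.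
have w0 : w 0 = c / 2 by rewrite /w eqxx.
exists w; split => //; last first.
  near=> s; rewrite /w; case: eqVneq => [->|s0]; first by ring.
  by field.
rewrite /continuous_at w0; apply/cvgrPdist_le => e e0.
have [r r0 Hr] : exists2 r, 0 < r & forall s, `|s| < r -> is_derive s 1 f (f' s).
  by move: df => /nbhs_ballP[r /= r0 Hr]; exists r => // s sr; apply: Hr; rewrite /ball /= sub0r normrN.
have : \forall h \near 0^', `|c - h^-1 *: (f' (h *: 1 + 0) - f' 0)| <= e.
  have [D E] := df'; rewrite -E.
  by have /cvgrPdist_le/(_ _ e0) := D.
rewrite f'0 => /nbhs_ballP[r' /= r'0 Hr'].
near=> s.
rewrite /w; case: eqVneq => [|s0]; first by rewrite subrr normr0 ltW.
have sr : `|s| < r by near: s; apply: cvgr0_norm_lt => //; exact: cvg_id.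
have sr' : `|s| < r' by near: s; apply: cvgr0_norm_lt => //; exact: cvg_id.
pose g t := f t - b * t - c / 2 * t ^+ 2.
have [t|t + +] := @mvt_line _ g (fun t => f' t - b - c * t) 0 s.
  move=> /between0 ts; have /Hr fd := le_lt_trans ts sr; apply: is_derive_eq.
by rewrite /GRing.scale /=; field.
move=> /between0 ts; rewrite /g subr0 => E.
have -> : c / 2 - (f s - f 0 - b * s) / s ^+ 2 = (c * t - (f' t - b)) / s.
  have -> : f s = f 0 + b * s + c / 2 * s ^+ 2 + (f' t - b - c * t) * s by rewrite -E; field.
  by field.
rewrite normrM normfV ler_pdivrMr ?normr_gt0 //.
have [->|t0] := eqVneq t 0; first by rewrite mulr0 f'0 !subrr normr0 mulr_ge0 // ltW.
apply: le_trans (_ : e * `|t| <= _); last by rewrite ler_pM2l.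
have -> : c * t - (f' t - b) = (c - t^-1 *: (f' (t *: 1 + 0) - b)) * t.
  by rewrite /GRing.scale /= mulr1 addr0; field.
rewrite normrM ler_pM2r ?normr_gt0 //; apply: Hr' => //.
by rewrite /ball /= sub0r normrN (le_lt_trans ts).
Unshelve. all: by end_near. Qed.

End Jets.

Section Jets2.
Context {R : realType} {d : nat}.
Local Notation V := 'rV[R]_d.
Implicit Types (f g : V -> R) (x z p : V) (b : V).

Lemma jet_exp (a : R) : jet (fun x : R => expR (a + x)) (expR a) (expR a) (expR a / 2).
Proof.
apply: (jet_eqc (@jet_Peano R (fun x : R => expR (a + x)) (fun x : R => expR (a + x)) (expR a) (expR a) _ _ _));
  rewrite ?addr0 //.
- by near=> s; apply: is_derive_eq; rewrite /GRing.scale /=; ring.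
- by apply: is_derive_eq; rewrite /GRing.scale /= ?addr0; ring.
Unshelve. all: by end_near. Qed.

Lemma jet_min (f : R -> R) (a b c : R) : jet f a b c -> (\forall s \near 0, f 0 <= f s) -> 0 <= c.
Proof.
move=> H; have := jet_val H; case: H => w [cw w0 Hw] f0 Hm; rewrite f0 in Hm.
rewrite leNgt; apply/negP => c0; rewrite -w0 in c0.
have := cts_lt cw c0 => Hn.
have : \forall s \near (0:R), [/\ f s = a + b * s + s ^+ 2 * w s, a <= f s & w s < 0].
  by near=> s; split; near: s.
move=> /nbhs_ballP[r /= r0 Hr].
have r2 : 0 < r / 2 by rewrite divr_gt0.
(* Adding the values at [r / 2] and [- (r / 2)] cancels the linear term and leaves a sum of two
   negative values of [w]. *)
have [|E1 I1 L1] := Hr (r / 2); first by rewrite /ball /= sub0r normrN gtr0_norm //; lra.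
have [|E2 I2 L2] := Hr (- (r / 2)); first by rewrite /ball /= sub0r opprK gtr0_norm //; lra.
rewrite {}E1 in I1; rewrite {}E2 in I2.
have : 0 <= (r / 2) ^+ 2 * (w (r / 2) + w (- (r / 2))) by nra.
by rewrite pmulr_rge0 ?exprn_gt0 //; lra.
Unshelve. all: by end_near. Qed.

(* [jet2 f z b L]: axis-parallel second-order expansions of [f] at [z], with
   gradient [b] and [L] half the Laplacian. *)
Definition jet2 f z b (L : R) := exists2 H : 'I_d -> R,
  (forall i, jet (fun s => f (z + s *: ei i)) (f z) (b ord0 i) (H i)) & \sum_i H i = L.

Lemma jet2_eqc f z b b' L L' : jet2 f z b' L' -> b = b' -> L = L' -> jet2 f z b L.
Proof. by move=> H -> ->. Qed.

Lemma jet2_eq f g z b L : (forall x, f x = g x) -> jet2 g z b L -> jet2 f z b L.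
Proof. by move=> /funext ->. Qed.

Lemma jet2_cst a z : jet2 (fun=> a) z 0 0.
Proof. by exists (fun=> 0) => [i|]; [rewrite mxE; exact: jet_cst|rewrite big1]. Qed.

Lemma jet2D f g z b L b' L' : jet2 f z b L -> jet2 g z b' L' ->
  jet2 (fun x => f x + g x) z (b + b') (L + L').
Proof.
move=> [H Hj <-] [H' Hj' <-]; exists (fun i => H i + H' i); last by rewrite big_split.
by move=> i; rewrite mxE; exact: jetD.
Qed.

Lemma jet2M f g z b L b' L' : jet2 f z b L -> jet2 g z b' L' ->
  jet2 (fun x => f x * g x) z (f z *: b' + g z *: b) (f z * L' + dot b b' + g z * L).
Proof.
move=> [H Hj <-] [H' Hj' <-].
exists (fun i => f z * H' i + b ord0 i * b' ord0 i + H i * g z).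
  move=> i; apply: (jet_eqc (jetM (Hj i) (Hj' i))) => //.
  by rewrite !mxE [g z * _]mulrC.
by rewrite !big_split /= -mulr_sumr -mulr_suml [g z * _]mulrC.
Qed.

Lemma jet2Z a f z b L : jet2 f z b L -> jet2 (fun x => a * f x) z (a *: b) (a * L).
Proof.
move=> H; apply: (jet2_eqc (jet2M (jet2_cst a z) H)); first by rewrite scaler0 addr0.
by rewrite dot0l mulr0 !addr0.
Qed.

Lemma jet2N f z b L : jet2 f z b L -> jet2 (fun x => - f x) z (- b) (- L).
Proof.
move=> /(jet2Z (-1)) H; apply: jet2_eq (jet2_eqc H _ _) => [x||]; by rewrite ?mulN1r ?scaleN1r.
Qed.

Lemma jet2B f g z b L b' L' : jet2 f z b L -> jet2 g z b' L' ->
  jet2 (fun x => f x - g x) z (b - b') (L - L').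
Proof. by move=> H1 /jet2N H2; exact: jet2D. Qed.

Lemma jet2_sum (I : Type) (r : seq I) (f : I -> V -> R) z (b : I -> V) (L : I -> R) :
  (forall k, jet2 (f k) z (b k) (L k)) ->
  jet2 (fun x => \sum_(k <- r) f k x) z (\sum_(k <- r) b k) (\sum_(k <- r) L k).
Proof.
move=> H; elim: r => [|k r IH].
  apply: jet2_eq (jet2_eqc (jet2_cst 0 z) _ _) => [x||]; by rewrite big_nil.
rewrite !big_cons; apply: jet2_eq (jet2D (H k) IH) => x; by rewrite big_cons.
Qed.

Lemma jet2_comp (F : R -> R) f z b L F1 F2 : jet (fun x : R => F (f z + x)) (F (f z)) F1 F2 ->
  jet2 f z b L -> jet2 (fun x => F (f x)) z (F1 *: b) (F1 * L + F2 * sq b).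
Proof.
move=> HF [H Hj <-]; exists (fun i => F1 * H i + F2 * b ord0 i ^+ 2).
  by move=> i; rewrite mxE; exact: jet_comp HF (Hj i).
rewrite big_split /= -!mulr_sumr; congr (_ + _ * _).
Qed.

Lemma jet2X n f z b L : jet2 f z b L -> jet2 (fun x => f x ^+ n) z ((n%:R * f z ^+ n.-1) *: b)
  (n%:R * f z ^+ n.-1 * L + 'C(n, 2)%:R * f z ^+ n.-2 * sq b).
Proof.
apply: (@jet2_comp (fun y => y ^+ n)).
have H : jet (fun x : R => f z + x) (f z) 1 0 by apply: jet_quad => s; ring.
by apply: (jet_eqc (jetX n H)); rewrite // ?mulr1 // ?mulr0 ?add0r ?expr1n ?mulr1.
Qed.

Lemma jet2_sqrt f z b L : 0 < f z -> jet2 f z b L ->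
  jet2 (fun x => Num.sqrt (f x)) z ((2 * Num.sqrt (f z))^-1 *: b)
    ((2 * Num.sqrt (f z))^-1 * L + - (8 * Num.sqrt (f z) ^+ 3)^-1 * sq b).
Proof. by move=> f0; apply: jet2_comp; exact: jet_sqrt. Qed.

Lemma jet2_exp f z b L : jet2 f z b L ->
  jet2 (fun x => expR (f x)) z (expR (f z) *: b) (expR (f z) * L + expR (f z) / 2 * sq b).
Proof. by apply: jet2_comp; exact: jet_exp. Qed.

Lemma jet2_sqB p z : jet2 (fun x => sq (x - p)) z (2 *: (z - p)) d%:R.
Proof.
exists (fun=> 1); last by rewrite sumr_const card_ord.
move=> i; apply: jet_quad => s.
have -> : z + s *: ei i - p = (z - p) + s *: ei i by rewrite addrAC.
by rewrite sqD sqZ dotZr dot_ei sq_ei !mxE; ring.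
Qed.

Lemma jet2_coord i (p : R) z : jet2 (fun x => x ord0 i - p) z (ei i) 0.
Proof.
exists (fun=> 0); last by rewrite big1.
move=> j; apply: jet_quad => s.
rewrite !mxE !eqxx /=; rewrite (eq_sym j i); ring.
Qed.

Lemma axis_cts z (e : V) : continuous_at (0:R) (fun s : R => z + s *: e).
Proof. by cts_tac. Qed.

Lemma near_axis z (e : V) (P : V -> Prop) : (\forall x \near z, P x) ->
  \forall s \near (0:R), P (z + s *: e).
Proof.
by move=> HP; apply: (cts_near (P := P) (@axis_cts z e)); rewrite scale0r addr0.
Qed.

Lemma jet2_min f z b L : jet2 f z b L -> (\forall x \near z, f z <= f x) -> 0 <= L.
Proof.
move=> [H Hj <-] Hm; apply: sumr_ge0 => i _; apply: (jet_min (Hj i)).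
by rewrite scale0r addr0; exact: (@near_axis z (ei i) _ Hm).
Qed.

End Jets2.

(** * Harmonic functions and Harnack's inequality *)

Section HarmonicFields.
Context {R : realType} {d : nat}.
Local Notation V := 'rV[R]_d.

Lemma is_derive_shift0 (f : R -> R) (s a : R) :
  is_derive (0 : R) 1 (fun t => f (s + t)) a -> is_derive s 1 f a.
Proof.
move=> [D E].
have H : (fun h : R => h^-1 *: (f (s + (h *: 1 + 0)) - f (s + 0))) =
         (fun h : R => h^-1 *: (f (h *: 1 + s) - f s)).
  by apply/funext => h; rewrite !addr0 [s + _]addrC.
split; first by move: D; rewrite /derivable /= H.
by rewrite -E /derive /= H.
Qed.

(* [U] is harmonic on [D], with gradient field [G]. *)
Definition hfun (D : set V) (U : V -> R) (G : V -> V) := forall x, D x ->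
  [/\ continuous_at x U, jet2 U x (G x) 0 &
      forall e : V, is_derive (0 : R) 1 (fun s => U (x + s *: e)) (dot (G x) e)].

Lemma hfunDc (D : set V) U G k : hfun D U G -> hfun D (fun x => U x + k) G.
Proof.
move=> H x Dx; have [cU jU dU] := H x Dx; split.
- by cts_tac.
- by apply: (jet2_eqc (jet2D jU (jet2_cst k x))); rewrite ?addr0.
- move=> e; have De := dU e; apply: is_derive_eq.
  by rewrite addr0.
Qed.

Lemma hfun_line (D : set V) U G x e s : hfun D U G -> D (x + s *: e) ->
  is_derive s 1 (fun t => U (x + t *: e)) (dot (G (x + s *: e)) e).
Proof.
move=> H Dx; apply: is_derive_shift0; have [_ _ /(_ e)] := H _ Dx.
by congr (is_derive _ _ _ _); apply/funext => t; rewrite scalerDl addrA.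
Qed.

Lemma hfun_mvt (D : set V) U G x y : hfun D U G ->
  (forall t : R, 0 <= t <= 1 -> D (x + t *: (y - x))) ->
  exists2 t : R, 0 <= t <= 1 & U y - U x = dot (G (x + t *: (y - x))) (y - x).
Proof.
move=> H Dxy.
have [|t] := @mvt_line R (fun t => U (x + t *: (y - x)))
  (fun t => dot (G (x + t *: (y - x))) (y - x)) 0 1.
  by move=> t; rewrite min_l // max_r // => /Dxy; exact: hfun_line.
rewrite min_l // max_r // scale1r scale0r addr0 subr0 mulr1 => t01 E.
by exists t => //; rewrite -E [x + _]addrC subrK.
Qed.

Lemma jet_slope_ge0 (f : R -> R) (b c r : R) : jet f 0 b c -> 0 < r ->
  (forall s, 0 <= s <= r -> 0 <= f s) -> 0 <= b.
Proof.
move=> [w [cw w0 Hw]] r0 Hf; rewrite leNgt; apply/negP => b0.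
have cq : continuous_at (0:R) (fun s => b + s * w s) by cts_tac.
have : b + 0 * w 0 < 0 by rewrite mul0r addr0.
move=> /(cts_lt cq) Hn.
have : \forall s \near (0:R), f s = 0 + b * s + s ^+ 2 * w s /\ b + s * w s < 0.
  by near=> s; split; near: s.
move=> /nbhs_ballP[r' /= r'0 Hr'].
pose s := Num.min (r' / 2) r.
have s0 : 0 < s by rewrite /s lt_min r0 divr_gt0.
have [|E1 I1] := Hr' s.
  rewrite /ball /= sub0r normrN gtr0_norm // /s gt_min; apply/orP; left; lra.
have : 0 <= f s by apply: Hf; rewrite ltW //= /s ge_min lexx orbT.
have -> : f s = s * (b + s * w s) by rewrite E1; ring.
by rewrite pmulr_rge0 // leNgt I1.
Unshelve. all: by end_near. Qed.

Lemma compact_le (A : set V) (f : V -> R) a : compact A -> continuous f ->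
  compact (A `&` [set x | f x <= a]).
Proof. by move=> cA cf; apply: compact_closedI => //; exact: closed_set_le. Qed.

(** * Interior gradient bound for bounded harmonic functions *)

Section GradBound.
Variables (D : set V) (U : V -> R) (G : V -> V) (x0 : V) (s S : R) (i : 'I_d).
Hypotheses (s0 : 0 < s) (S0 : 0 < S) (hU : hfun D U G).
Hypothesis (DB : forall x, sq (x - x0) <= s ^+ 2 -> D x /\ 0 <= U x <= S).

Let refl (x : V) : V := x - (2 * (x ord0 i - x0 ord0 i)) *: ei i.
Let xi (x : V) : R := x ord0 i - x0 ord0 i.

Let refl_axis x t j : refl (x + t *: ei j) = refl x + (if j == i then - t else t) *: ei j.
Proof.
rewrite /refl; apply/rowP => k; rewrite !mxE !eqxx /= [i == j]eq_sym.
case: (eqVneq j i) => [->|ji] /=; case: (k == i); rewrite /= ?mulr1 ?mulr0 ?addr0; ring.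
Qed.

Let refl_sq x : sq (refl x - x0) = sq (x - x0).
Proof.
have -> : refl x - x0 = (x - x0) - (2 * xi x) *: ei i by rewrite /refl /xi addrAC.
by rewrite [LHS]sqB sqZ dotZr dot_ei sq_ei !mxE -/(xi x); ring.
Qed.

Let refl_fix x : xi x = 0 -> refl x = x.
Proof. by rewrite /refl -/(xi x) => ->; rewrite mulr0 scale0r subr0. Qed.

Let jet2_refl x b L : jet2 U (refl x) b L -> exists b', jet2 (fun y => U (refl y)) x b' L.
Proof.
move=> [H Hj <-]; exists (\row_j (if j == i then - b ord0 j else b ord0 j)); exists H => // j.
rewrite mxE; case: (eqVneq j i) (refl_axis x ^~ j) => [ji|ji] E.
  by apply: jet_eq (jet_refl (Hj j)) => t; rewrite E.
by apply: jet_eq (Hj j) => t; rewrite E.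
Qed.

Let cts_refl x : continuous_at x refl.
Proof.
have H : continuous_at x (fun y : V => y ord0 i) by apply: cts_coord; exact: cts_id.
by rewrite /refl; cts_tac.
Qed.

(** The difference [U x - U (refl x)], with [refl] the reflection in the hyperplane through [x0]
    orthogonal to [ei i], is harmonic and vanishes on that hyperplane. On the half ball [0 <= xi]
    the right side dominates it on both parts of the boundary, and has half-Laplacian
    [d S / s ^ 2 - (d + 1) S / s ^ 2 < 0], which excludes an interior minimum of the difference. The
    sign [e] yields both one-sided bounds. *)
Lemma grad_bound_barrier e x : e \in [:: 1; -1] -> sq (x - x0) <= s ^+ 2 -> 0 <= xi x ->
  e * (U x - U (refl x)) <=
  S / s ^+ 2 * sq (x - x0) + (d%:R + 1) * S / s * xi x - (d%:R + 1) * S / s ^+ 2 * xi x ^+ 2.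
Proof.
move=> e1 xs x0i.
pose F y := S / s ^+ 2 * sq (y - x0) + (d%:R + 1) * S / s * xi y
  - (d%:R + 1) * S / s ^+ 2 * xi y ^+ 2 - e * (U y - U (refl y)).
suff : 0 <= F x by rewrite /F; lra.
pose K := [set y : V | sq (y - x0) <= s ^+ 2] `&` [set y | - xi y <= 0].
have cxi y : continuous_at y xi.
  have H : continuous_at y (fun y : V => y ord0 i) by apply: cts_coord; exact: cts_id.
  by rewrite /xi; cts_tac.
have cK : compact K.
  apply: compact_le; first exact: cball_compact.
  by move=> y; have := cxi y => H; apply: ctsN.
have cF y : K y -> continuous_at y F.
  move=> [/= yK _]; have [Dy _] := DB yK; have [cU _ _] := hU Dy.
  have yK' : sq (refl y - x0) <= s ^+ 2 by rewrite refl_sq.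
  have [Dy' _] := DB yK'; have [cU' _ _] := hU Dy'.
  have c1 : continuous_at y (fun y => U (refl y)) := cts_comp (@cts_refl y) cU'.
  have c2 := @sqB_cont _ _ x0 y; have c3 := cxi y.
  by rewrite /F; cts_tac.
have [|z [/= zs zi] Hz] := EVT_min_on _ cK cF; first by exists x; split => //=; rewrite oppr_le0.
apply: le_trans (Hz x _); last by split => //=; rewrite oppr_le0.
rewrite {}oppr_le0 in zi.
have [Dz Uz] := DB zs; have [cU jU _] := hU Dz.
have zs' : sq (refl z - x0) <= s ^+ 2 by rewrite refl_sq.
have [Dz' Uz'] := DB zs'; have [cU' jU' _] := hU Dz'.
have d0 : 0 <= d%:R :> R by [].
have We : e * (U z - U (refl z)) <= S.
  by move: e1; rewrite !inE => /orP[]/eqP ->; lra.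
have [zi0|zi0] := eqVneq (xi z) 0.
  rewrite /F zi0 refl_fix // subrr !mulr0 expr0n /= mulr0 addr0 !subr0.
  by apply: mulr_ge0; [apply: divr_ge0; rewrite ?ltW ?exprn_gt0|exact: sq_ge0].
have {zi0}zi : 0 < xi z by rewrite lt_neqAle eq_sym zi0.
have zis : xi z <= s.
  have := sqr_coord_le (z - x0) i; rewrite !mxE -/(xi z) => h.
  by rewrite -(@ler_pXn2r _ 2) ?nnegrE ?(ltW zi) ?(ltW s0) //; exact: le_trans h zs.
have [zb|zb] := eqVneq (sq (z - x0)) (s ^+ 2).
  rewrite /F zb divfK ?expf_neq0 ?gt_eqF //.
  have : 0 <= (d%:R + 1) * S / s ^+ 2 * (xi z * (s - xi z)).
    apply: mulr_ge0; last by apply: mulr_ge0; lra.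
    by apply: divr_ge0; [apply: mulr_ge0; lra|rewrite exprn_ge0 // ltW].
  have -> : (d%:R + 1) * S / s ^+ 2 * (xi z * (s - xi z)) =
     (d%:R + 1) * S / s * xi z - (d%:R + 1) * S / s ^+ 2 * xi z ^+ 2.
    by field; rewrite gt_eqF.
  by lra.
have {zb}zlt : sq (z - x0) < s ^+ 2 by rewrite lt_neqAle zb.
exfalso.
have [b' jR] := jet2_refl jU'.
have jxi : jet2 xi z (ei i) 0 by exact: jet2_coord.
have jF := jet2B (jet2B (jet2D (jet2Z (S / s ^+ 2) (jet2_sqB x0 z)) (jet2Z ((d%:R + 1) * S / s) jxi))
  (jet2Z ((d%:R + 1) * S / s ^+ 2) (jet2X 2 jxi))) (jet2Z e (jet2B jU jR)).
have := jet2_min jF _; rewrite sq_ei bin2 /= => H.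
suff : S / s ^+ 2 <= 0 by apply/negP; rewrite -ltNge divr_gt0 // exprn_gt0.
have {}H := H _.
have -> : S / s ^+ 2 = - (S / s ^+ 2 * d%:R + (d%:R + 1) * S / s * 0 -
  (d%:R + 1) * S / s ^+ 2 * (2%:R * xi z ^+ 1 * 0 + 1%:R * xi z ^+ 0 * 1) - e * (0 - 0)).
  by rewrite expr0; ring.
rewrite oppr_le0; apply: H.
near=> y; apply: Hz; split => /=.
  apply/ltW; near: y; exact: (cts_lt (@sqB_cont _ _ x0 z) zlt).
rewrite oppr_le0; apply/ltW; near: y; exact: (cts_gt (cxi z) zi).
Unshelve. all: by end_near. Qed.

(** Along [x0 + t *: ei i] the barrier and the reflected difference both vanish at [t = 0], so their
    slopes there compare: [2 |G x0 i| <= (d + 1) S / s]. *)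
Lemma grad_bound : `|G x0 ord0 i| <= (d%:R + 1) * S / (2 * s).
Proof.
have H0 : sq (x0 - x0) <= s ^+ 2 by rewrite subrr sq0 exprn_ge0 // ltW.
have [D0 _] := DB H0; have [_ [H /(_ i) jU _] _] := hU D0.
have key e : e \in [:: 1; -1] -> 0 <= (d%:R + 1) * S / s - e * (2 * G x0 ord0 i).
  move=> e1.
  pose f t := (d%:R + 1) * S / s * t + (S / s ^+ 2 - (d%:R + 1) * S / s ^+ 2) * t ^+ 2
    - e * (U (x0 + t *: ei i) - U (x0 + (- t) *: ei i)).
  have jf : jet f 0 ((d%:R + 1) * S / s - e * (2 * G x0 ord0 i)) (S / s ^+ 2 - (d%:R + 1) * S / s ^+ 2).
    have j1 : jet (fun t => (d%:R + 1) * S / s * t + (S / s ^+ 2 - (d%:R + 1) * S / s ^+ 2) * t ^+ 2)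
      0 ((d%:R + 1) * S / s) (S / s ^+ 2 - (d%:R + 1) * S / s ^+ 2).
      by apply: jet_quad => t; rewrite add0r.
    apply: (jet_eqc (jetB j1 (jetZ e (jetB jU (jet_refl jU))))); ring.
  apply: (jet_slope_ge0 jf s0) => t /andP[t0 ts].
  have xt : xi (x0 + t *: ei i) = t by rewrite /xi !mxE !eqxx /=; ring.
  have st : sq (x0 + t *: ei i - x0) = t ^+ 2 by rewrite addrAC subrr add0r sqZ sq_ei mulr1.
  have := @grad_bound_barrier e (x0 + t *: ei i) e1.
  rewrite xt st => /(_ _ t0).
  have -> : refl (x0 + t *: ei i) = x0 + (- t) *: ei i.
    by rewrite refl_axis eqxx refl_fix // /xi subrr.
  rewrite ler_pXn2r ?nnegrE ?t0 ?(ltW s0) // => /(_ ts); rewrite /f; lra.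
have := key 1; have := key (-1); rewrite !inE !eqxx /= orbT => /(_ isT) h1 /(_ isT) h2.
have -> : (d%:R + 1) * S / (2 * s) = (d%:R + 1) * S / s / 2 by field; rewrite gt_eqF.
by rewrite ler_norml; apply/andP; split; lra.
Qed.

End GradBound.
End HarmonicFields.

(** * A rational kernel and its half-Laplacian *)

Section Kernel.
Context {R : realType} {d : nat}.
Local Notation V := 'rV[R]_d.

Lemma jet_invX (a : R) n : a != 0 -> jet (fun x => (a + x) ^- n) (a ^- n)
  (- n%:R * a ^- n.+1) (n%:R * (n%:R + 1) / 2 * a ^- n.+2).
Proof.
move=> a0; elim: n => [|n IH].
  have E s : (a + s) ^- 0 = 1 by rewrite expr0 invr1.
  by apply: (jet_eqc (jet_eq E (jet_cst 1))); rewrite ?expr0 ?invr1 ?oppr0 ?mul0r // mul0r.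
have E s : (a + s) ^- n.+1 = (a + s)^-1 * (a + s) ^- n by rewrite exprS invfM.
have an : a ^+ n != 0 by rewrite expf_neq0.
apply: (jet_eqc (jet_eq E (jetM (jet_inv a0) IH))); rewrite !exprS -?natr1; field; by rewrite a0 an.
Qed.

(* With [k = 0] this is the barrier of Harnack's inequality (positive in the ball of centre
   [p], singular at [w]); with [p = 0], [r2 = 1] and [k = Y w ^+ 2] it is the kernel [kap]. *)
Definition ker (r2 k : R) (p w : V) n (z : V) : R :=
  (r2 - sq (z - p)) ^+ 2 * (sq (z - w) + k) ^- n.

(** The gradient stays existential because the minimum principle [jet2_min] looks only at the
    half-Laplacian. *)
Lemma jet2_ker r2 k p w n z : 0 < sq (z - w) + k ->
  exists b, jet2 (ker r2 k p w n) z b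
    ((sq (z - w) + k) ^- n * (4 * sq (z - p) - 2 * d%:R * (r2 - sq (z - p))
      + 8 * n%:R * (r2 - sq (z - p)) * dot (z - p) (z - w) / (sq (z - w) + k)
      + (r2 - sq (z - p)) ^+ 2 / (sq (z - w) + k) ^+ 2
        * (2 * n%:R * (n%:R + 1) * sq (z - w) - n%:R * d%:R * (sq (z - w) + k)))).
Proof.
move=> T0; have T0' := lt0r_neq0 T0.
have jY := jet2B (jet2_cst r2 z) (jet2_sqB p z).
have jT := jet2D (jet2_sqB w z) (jet2_cst k z).
have jTn := @jet2_comp _ _ (fun y => y ^- n) _ _ _ _ _ _ (jet_invX n T0') jT.
eexists; apply: (jet2_eqc (jet2M (jet2X 2 jY) jTn)); first by [].
rewrite bin2 /= !expr1 expr0 !addr0 !sub0r !(sqZ, sqN, dotNl, dotZl, dotZr).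
have Tn0 : (sq (z - w) + k) ^+ n != 0 by rewrite expf_neq0.
by rewrite !exprS; field; rewrite T0' Tn0.
Qed.

Lemma cts_ker r2 k p w n z : 0 < sq (z - w) + k -> continuous_at z (ker r2 k p w n).
Proof.
move=> T0; have c1 := @sqB_cont _ _ p z; have c2 := @sqB_cont _ _ w z.
have c3 : continuous_at z (fun x => (sq (x - w) + k) ^- n).
  by apply: ctsV; [rewrite expf_neq0 // lt0r_neq0|cts_tac].
by rewrite /ker; cts_tac.
Qed.

End Kernel.

Section Harnack.
Context {R : realType} {d : nat}.
Local Notation V := 'rV[R]_d.
Local Notation m := d.+1.
Let d1 : R := d%:R + 1.
(** So small that a displacement of length [c * s], under the bound [d1 * (4 ^+ m * U q) / s] for
    each partial derivative, changes [U] by at most [U q / 2]; see [Uhalf] in [harnack]. *)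
Let c : R := (2 * d1 ^+ 2 * 4 ^+ m)^-1.

Let d1_ge1 : 1 <= d1. Proof. by rewrite /d1 lerDr. Qed.

Let c_gt0 : 0 < c.
Proof. by rewrite invr_gt0 !mulr_gt0 ?exprn_gt0 // (lt_le_trans ltr01). Qed.

Let c_le : c <= 1 / 2.
Proof.
have h1 : 1 <= d1 ^+ 2 by rewrite exprn_ege1.
have h2 : 1 <= 4 ^+ m :> R by rewrite exprn_ege1 // ler1n.
have h : 2 <= 2 * d1 ^+ 2 * 4 ^+ m by nra.
have h0 : 0 < 2 * d1 ^+ 2 * 4 ^+ m by lra.
by rewrite /c mul1r lef_pV2 ?posrE.
Qed.

(** Minimum principle for [U - l * P] on the ball centred at [p] whose boundary passes through [q],
    minus the ball of radius [e] about [q]. The kernel [P] vanishes on the outer sphere and is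
    subharmonic inside; on the inner sphere [r ^+ 2 - sq (z - p) <= 2 * r * e], and [l] is the
    factor for which this gives [l * P <= u / 2]. Evaluation at [p] is the claim. *)
Lemma barrier (D : set V) U G (p q : V) (u e : R) : hfun D U G -> 0 < u -> 0 < e ->
  e < enorm (q - p) ->
  (forall x, sq (x - p) <= sq (q - p) -> D x /\ 0 <= U x) ->
  (forall x, sq (x - q) = e ^+ 2 -> sq (x - p) <= sq (q - p) -> u / 2 <= U x) ->
  u * (e ^+ 2) ^+ m <= 8 * U p * (sq (q - p)) ^+ m.
Proof.
move=> hU u0 e0 er DB Ue.
set r := enorm (q - p) in er.
have r0 : 0 < r by rewrite (lt_trans e0).
have r2 : sq (q - p) = r ^+ 2 by rewrite sqr_enorm.
have r20 : 0 < r ^+ 2 by rewrite exprn_gt0.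
have e20 : 0 < e ^+ 2 by rewrite exprn_gt0.
pose l := u * (e ^+ 2) ^+ m / (8 * r ^+ 2).
have l0 : 0 < l by rewrite divr_gt0 // mulr_gt0 // exprn_gt0.
pose P := ker (r ^+ 2) 0 p q m.+1.
pose K := [set x : V | sq (x - p) <= r ^+ 2] `&` [set x : V | - sq (x - q) <= - e ^+ 2].
have cK : compact K.
  apply: compact_le; first exact: cball_compact.
  by move=> x; have H := @sqB_cont _ _ q x; apply: ctsN.
have T0 x : K x -> 0 < sq (x - q) + 0.
  by move=> [_ /=]; rewrite lerN2 addr0; exact: lt_le_trans.
pose F x := U x - l * P x.
have cF x : K x -> continuous_at x F.
  move=> Kx; have c1 : continuous_at x P by apply: cts_ker; exact: T0.
  case: (Kx) => /= xp _; rewrite -r2 in xp; have [Dx _] := DB _ xp; have [c2 _ _] := hU _ Dx.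
  by rewrite /F; cts_tac.
have Kp : K p.
  split => /=; first by rewrite subrr sq0 ltW.
  by rewrite lerN2 sqBC r2 ler_pXn2r ?nnegrE ?(ltW e0) ?(ltW r0) ?(ltW er).
have Pp : P p = r ^+ 2 / (r ^+ 2) ^+ m.
  rewrite /P /ker subrr sq0 subr0 addr0 sqBC r2 [(r ^+ 2) ^+ m.+1]exprSr.
  by field; rewrite expf_neq0 lt0r_neq0 // exprn_gt0.
suff : 0 <= F p.
  rewrite /F Pp r2 subr_ge0 /l.
  have rm : 0 < (r ^+ 2) ^+ m by rewrite exprn_gt0.
  have -> : u * (e ^+ 2) ^+ m / (8 * r ^+ 2) * (r ^+ 2 / (r ^+ 2) ^+ m) =
     (u * (e ^+ 2) ^+ m) / (8 * (r ^+ 2) ^+ m) by field; rewrite !lt0r_neq0.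
  by rewrite ler_pdivrMr ?mulr_gt0 // => h; rewrite (le_trans h) // mulrC mulrAC.
have [|z Kz Hz] := EVT_min_on _ cK cF; first by exists p.
apply: le_trans (Hz p Kp).
have := Kz; case => /= zp; rewrite lerN2 => zq.
have zp' := zp; rewrite -r2 in zp'; have [Dz Uz] := DB _ zp'; have [_ jU _] := hU _ Dz.
have [zb|zb] := eqVneq (sq (z - p)) (r ^+ 2).
  by rewrite /F /P /ker zb subrr expr0n /= mul0r mulr0 subr0.
have [zb'|zb'] := eqVneq (sq (z - q)) (e ^+ 2).
  rewrite /F subr_ge0; apply: le_trans (Ue z zb' zp').
  rewrite /P /ker zb' addr0.
  have zpr : enorm (z - p) <= r by rewrite enorm_le // ltW.
  have ez : enorm (z - q) = e by rewrite enormE zb' sqrtr_sqr gtr0_norm.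
  have rz : r <= enorm (z - p) + e.
    by rewrite -ez addrC (enormBC z q); exact: enorm_tri.
  have Y : r ^+ 2 - sq (z - p) <= 2 * r * e.
    by rewrite -sqr_enorm; have := enorm_ge0 (z - p); nra.
  have Y0 : 0 <= r ^+ 2 - sq (z - p) by rewrite subr_ge0.
  have Y2 : (r ^+ 2 - sq (z - p)) ^+ 2 <= (2 * r * e) ^+ 2.
    by rewrite ler_pXn2r ?nnegrE // !mulr_ge0 // ltW.
  have em : 0 < (e ^+ 2) ^+ m by rewrite exprn_gt0.
  have -> : u / 2 = l * ((2 * r * e) ^+ 2 / (e ^+ 2) ^+ m.+1).
    by rewrite /l [(e ^+ 2) ^+ m.+1]exprSr; field; rewrite !lt0r_neq0.
  by rewrite ler_pM2l // ler_pM2r // invr_gt0 exprn_gt0.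
exfalso.
have zlt : sq (z - p) < r ^+ 2 by rewrite lt_neqAle zb.
have zgt : e ^+ 2 < sq (z - q) by rewrite lt_neqAle eq_sym zb'.
have [b jP] := @jet2_ker R d (r ^+ 2) 0 p q m.+1 z (T0 z Kz).
have := jet2_min (jet2B jU (jet2Z l jP)) _.
have Hn : \forall x \near z, F z <= F x.
  near=> x; apply: Hz; split => /=.
    by apply/ltW; near: x; exact: (cts_lt (@sqB_cont _ _ p z) zlt).
  by rewrite lerN2; apply/ltW; near: x; exact: (cts_gt (@sqB_cont _ _ q z) zgt).
move=> /(_ Hn); apply/negP; rewrite -ltNge sub0r oppr_lt0 pmulr_rgt0 //.
rewrite addr0; set T := sq (z - q); set Y := r ^+ 2 - sq (z - p).
have TT : 0 < T by rewrite (lt_trans e20).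
have YY : 0 < Y by rewrite subr_gt0.
(* Since [q] lies on the outer sphere, the cross term is explicit in [T] and [Y]; with the exponent
   [m.+1] the coefficients of [Y] and of [Y ^+ 2 / T] then come out positive. *)
have -> : dot (z - p) (z - q) = (T - Y) / 2.
  have -> : Y = sq (q - p) - sq (z - p) by rewrite r2.
  have -> : sq (q - p) = T - 2 * dot (z - q) (z - p) + sq (z - p).
    by rewrite /T -sqB -[q - p]opprB sqN; congr sq; apply/rowP => i; rewrite !mxE; ring.
  by rewrite [dot (z - q) _]dotC; field.
apply: mulr_gt0; first by rewrite invr_gt0 exprn_gt0.
have -> : 4 * sq (z - p) - 2 * d%:R * Y + 8 * m.+1%:R * Y * ((T - Y) / 2) / T +
  Y ^+ 2 / T ^+ 2 * (2 * m.+1%:R * (m.+1%:R + 1) * T - m.+1%:R * d%:R * T) =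
  4 * sq (z - p) + (2 * d%:R + 8) * Y + Y ^+ 2 / T * ((d%:R + 2) * (d%:R + 2)).
  by rewrite -!natr1; field; rewrite lt0r_neq0.
have dd : 0 <= d%:R :> R by [].
apply: ltr_wpDr; first by rewrite mulr_ge0 ?divr_ge0 ?mulr_ge0 ?sqr_ge0 ?(ltW TT) //; lra.
by apply: ltr_wpDl; [rewrite mulr_ge0 // sq_ge0|apply: mulr_gt0 => //; lra].
Unshelve. all: by end_near. Qed.

Lemma dot_le_sum (a : R) (g e : V) : (forall i, `|g ord0 i| <= a) -> 0 <= a ->
  `|dot g e| <= a * (d%:R * enorm e).
Proof.
move=> ga a0; apply: le_trans (ler_norm_sum _ _ _) _.
apply: le_trans (_ : a * \sum_i `|e ord0 i| <= _); last by rewrite ler_wpM2l // sum_coord_le.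
by rewrite mulr_sumr; apply: ler_sum => i _; rewrite normrM ler_wpM2r.
Qed.

Lemma segment_ball (p x y : V) (r t : R) : 0 <= t <= 1 -> enorm (x - p) <= r ->
  enorm (y - p) <= r -> enorm (x + t *: (y - x) - p) <= r.
Proof.
move=> /andP[t0 t1] xp yp.
have -> : x + t *: (y - x) - p = (1 - t) *: (x - p) + t *: (y - p).
  by apply/rowP => i; rewrite !mxE; ring.
apply: le_trans (enormD _ _) _; rewrite !enormZ !ger0_norm ?subr_ge0 //.
have := enorm_ge0 (x - p); nra.
Qed.

(* [U] is compared with the barrier around a point where [U * (rho - |y - p|) ^ (2 m)] is
   maximal: there [U] is at least half its value on a ball of radius comparable to [mu]. *)
Lemma harnack : exists2 C : R, 0 < C & forall (D : set V) U G p rho, 0 < rho -> hfun D U G ->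
  (forall x, enorm (x - p) <= rho -> D x /\ 0 <= U x) ->
  forall x, enorm (x - p) <= rho / 2 -> U x <= C * U p.
Proof.
exists (8 * ((4 / c) ^+ 2) ^+ m); first by rewrite mulr_gt0 // !exprn_gt0 // divr_gt0.
move=> D U G p rho rho0 hU DB x xp.
pose mu y := rho - enorm (y - p).
pose F y := U y * (mu y ^+ 2) ^+ m.
pose K := [set y : V | sq (y - p) <= rho ^+ 2].
have KE y : K y -> enorm (y - p) <= rho by rewrite enorm_le // ltW.
have cF y : K y -> continuous_at y F.
  move=> /KE yK; have [Dy _] := DB y yK; have [c1 _ _] := hU y Dy.
  have c2 : continuous_at y (fun y : V => y - p) by cts_tac.
  have c3 := cts_enorm c2.
  by rewrite /F /mu; cts_tac.
have [|q Kq Hq] := EVT_max_on _ (@cball_compact _ _ p (rho ^+ 2)) cF.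
  by exists p => /=; rewrite subrr sq0 sqr_ge0.
have Kx : K x by rewrite /K /= -enorm_le ?(le_trans xp) //; lra.
have {Kq}qr := KE q Kq; have [Dq Uq] := DB q qr.
have [Dp Up] : D p /\ 0 <= U p by apply: DB; rewrite subrr enorm0 ltW.
have [Dx Ux] := DB x (KE x Kx).
have mux : rho / 2 <= mu x by rewrite /mu; lra.
have xF : U x * ((rho / 2) ^+ 2) ^+ m <= F q.
  apply: le_trans (Hq x Kx); rewrite /F ler_wpM2l //.
  have h : 0 <= rho / 2 by lra.
  by rewrite !ler_pXn2r ?nnegrE ?sqr_ge0 //; lra.
have rm : 0 < ((rho / 2) ^+ 2) ^+ m by rewrite !exprn_gt0 // divr_gt0.
have CU : 0 <= 8 * ((4 / c) ^+ 2) ^+ m * U p.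
  by rewrite !mulr_ge0 // !exprn_ge0 // divr_ge0 // ltW.
have [Fq|Fq] := leP (F q) 0.
  apply: le_trans CU; have := le_trans xF Fq.
  by rewrite pmulr_lle0.
have mq0 : 0 <= mu q by rewrite /mu; lra.
have {mq0}mq : 0 < mu q.
  rewrite lt_neqAle mq0 andbT eq_sym; apply/eqP => h.
  by move: Fq; rewrite /F h expr0n /= expr0n /= mulr0 ltxx.
have {Uq}Uq : 0 < U q.
  by move: Fq; rewrite /F pmulr_lgt0 // !exprn_gt0.
pose s := mu q / 2.
have s0 : 0 < s by rewrite /s; lra.
(* On this ball [mu] is at least half of [mu q], so maximality of [F] at [q] lets [U] grow by at
   most the factor [4 ^+ m]. *)
have U4 y : enorm (y - q) <= s -> D y /\ 0 <= U y <= 4 ^+ m * U q.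
  move=> yq.
  have yp : enorm (y - p) <= rho - s.
    have := enorm_tri y q p; move: yq; rewrite /s /mu; lra.
  have yr : enorm (y - p) <= rho by lra.
  have [Dy Uy] := DB y yr; split => //; rewrite Uy /=.
  have Ky : K y by rewrite /K /= -enorm_le // ltW.
  have := Hq y Ky; rewrite /F.
  have -> : mu q ^+ 2 = 4 * s ^+ 2 by rewrite /s; field.
  rewrite [(4 * s ^+ 2) ^+ m]exprMn mulrA [U q * 4 ^+ m]mulrC => h.
  have sm : 0 < (s ^+ 2) ^+ m by rewrite !exprn_gt0.
  rewrite -(ler_pM2r sm); apply: le_trans h; rewrite ler_wpM2l //.
  by rewrite !ler_pXn2r ?nnegrE ?sqr_ge0 ?(ltW s0) //; rewrite /mu; lra.
have S0 : 0 < 4 ^+ m * U q by rewrite mulr_gt0 // exprn_gt0.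
have grad y i : enorm (y - q) <= s / 2 -> `|G y ord0 i| <= d1 * (4 ^+ m * U q) / s.
  move=> yq.
  have -> : d1 * (4 ^+ m * U q) / s = d1 * (4 ^+ m * U q) / (2 * (s / 2)).
    by field; rewrite lt0r_neq0.
  have s2 : 0 < s / 2 by rewrite divr_gt0.
  apply: (grad_bound i s2 S0 hU) => z zy; apply: U4.
  rewrite -enorm_le ?(ltW s2) // in zy.
  by have := enorm_tri z y q; lra.
have Uhalf y : enorm (y - q) <= c * s -> U q / 2 <= U y.
  move=> yq.
  have cs2 : c * s <= s / 2 by have := c_le; nra.
  have yq2 : enorm (y - q) <= s / 2 by lra.
  have qs : enorm (q - q) <= s / 2 by rewrite subrr enorm0; lra.
  have [|t t01 E] := @hfun_mvt _ _ D U G q y hU.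
    move=> t t01.
    have h : enorm (q + t *: (y - q) - q) <= s by have := segment_ball t01 qs yq2; lra.
    by have [] := U4 _ h.
  have A0 : 0 <= d1 * (4 ^+ m * U q) / s.
    apply: divr_ge0; last exact: ltW.
    by apply: mulr_ge0; [apply: le_trans d1_ge1|exact: ltW].
  have := dot_le_sum (y - q) (fun i => grad _ i (segment_ball t01 qs yq2)) A0.
  rewrite -E ler_norml => /andP[h _].
  suff : d1 * (4 ^+ m * U q) / s * (d%:R * enorm (y - q)) <= U q / 2 by lra.
  apply: le_trans (_ : d1 * (4 ^+ m * U q) / s * (d1 * (c * s)) <= _).
    apply: ler_wpM2l => //; apply: ler_pM => //; first exact: enorm_ge0.
    by rewrite /d1; lra.
  have d10 : 0 < d1 by rewrite (lt_le_trans ltr01).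
  rewrite /c le_eqVlt; apply/orP; left; apply/eqP; field.
  by rewrite !lt0r_neq0 // exprn_gt0.
have cs0 : 0 < c * s by rewrite mulr_gt0.
have main : U q * ((c * s) ^+ 2) ^+ m <= 8 * U p * (rho ^+ 2) ^+ m.
  (* If [p] is within [c * s] of [q], the half-value estimate already compares [U p] with [U q];
     otherwise [barrier] applies with removed radius [c * s]. *)
  have [qp|qp] := leP (enorm (q - p)) (c * s).
    have h : U q / 2 <= U p by apply: Uhalf; rewrite enormBC.
    have csr : ((c * s) ^+ 2) ^+ m <= (rho ^+ 2) ^+ m.
      have h1 : c * s <= rho.
        by have := enorm_ge0 (q - p); have := c_le; have := s0; rewrite /s /mu; nra.
      by rewrite !ler_pXn2r ?nnegrE ?sqr_ge0 ?(ltW rho0) ?(ltW cs0).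
    have h2 : U q <= 8 * U p by lra.
    by apply: ler_pM => //; [exact: ltW|rewrite exprn_ge0 // sqr_ge0].
  apply: le_trans (_ : 8 * U p * sq (q - p) ^+ m <= _).
    apply: (barrier hU Uq cs0 qp) => y yp.
      by apply: DB; rewrite (le_trans _ qr) // enorm_le ?enorm_ge0 // sqr_enorm.
    by move=> _; apply: Uhalf; rewrite enorm_le ?(ltW cs0) // yp.
  rewrite ler_wpM2l ?mulr_ge0 // -sqr_enorm !ler_pXn2r ?nnegrE ?sqr_ge0 ?enorm_ge0 //.
  exact: ltW.
rewrite -(ler_pM2r rm); apply: le_trans xF _; rewrite /F.
have -> : mu q = c * s * (2 / c) by rewrite /s; field; rewrite lt0r_neq0.
have pM (a b : R) : ((a * b) ^+ 2) ^+ m = (a ^+ 2) ^+ m * (b ^+ 2) ^+ m.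
  by rewrite [(a * b) ^+ 2]exprMn [LHS]exprMn.
have k0 : 0 <= ((2 / c) ^+ 2) ^+ m by rewrite exprn_ge0 // sqr_ge0.
rewrite pM mulrA; apply: le_trans (ler_wpM2r k0 main) _.
have -> : 8 * U p * (rho ^+ 2) ^+ m * ((2 / c) ^+ 2) ^+ m = 8 * U p * ((4 / c * (rho / 2)) ^+ 2) ^+ m.
  have -> : 4 / c * (rho / 2) = rho * (2 / c) by field; rewrite lt0r_neq0.
  by rewrite (pM rho (2 / c)) mulrA.
by rewrite (pM (4 / c)) le_eqVlt; apply/orP; left; apply/eqP; ring.
Qed.

End Harnack.

(** * Geometry of the ball *)

Section PositiveHarmonic.
Context {R : realType} {d : nat}.
Local Notation V := 'rV[R]_d.

Lemma grad_pos : exists2 C : R, 0 < C & forall (D : set V) U G p rho, 0 < rho -> hfun D U G ->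
  (forall x, enorm (x - p) <= rho -> D x /\ 0 <= U x) -> enorm (G p) <= C / rho * U p.
Proof.
have [C C0 HC] := @harnack R d.
exists (d%:R * (d%:R + 1) * C + 1) => [|D U G p rho rho0 hU DB].
  by rewrite ltr_wpDl // !mulr_ge0 // ?addr_ge0 // ltW.
have r2 : 0 < rho / 2 by rewrite divr_gt0.
have Up : 0 <= U p by have [] := DB p; rewrite // subrr enorm0 ltW.
have Gi i : `|G p ord0 i| <= (d%:R + 1) * (C * U p) / rho.
  (* [grad_bound] asks for a positive upper bound, whereas [U p] may be zero. *)
  apply/ler_addgt0Pr => e e0.
  have e1 : 0 < e * rho / (d%:R + 1) by rewrite divr_gt0 ?mulr_gt0 // ltr_wpDl.
  have S0 : 0 < C * U p + e * rho / (d%:R + 1) by rewrite ltr_wpDl // mulr_ge0 // ltW.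
  have := grad_bound i r2 S0 hU _; have -> : (d%:R + 1) * (C * U p + e * rho / (d%:R + 1)) / (2 * (rho / 2)) =
    (d%:R + 1) * (C * U p) / rho + e by field; rewrite !lt0r_neq0 // ltr_wpDl.
  apply=> x; rewrite -enorm_le ?(ltW r2) // => xp.
  have [Dx Ux] : D x /\ 0 <= U x by apply: DB; lra.
  by split => //; rewrite Ux /= (le_trans (HC D U G p rho rho0 hU DB x xp)) // lerDl ltW.
apply: le_trans (enorm_le_sum _) _.
apply: le_trans (_ : \sum_(i < d) (d%:R + 1) * (C * U p) / rho <= _); first exact: ler_sum.
rewrite sumr_const card_ord -[leLHS]mulr_natl.
have -> : (d%:R * (d%:R + 1) * C + 1) / rho * U p =
  d%:R * ((d%:R + 1) * (C * U p) / rho) + U p / rho by field; rewrite lt0r_neq0.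
by rewrite lerDl divr_ge0 // ltW.
Qed.

(** By [grad_pos] the logarithmic derivative of [U] along the segment is at most [C |w - z| / rho].
    It is integrated in the form that [U * expR (- k * t)] does not increase, since [U] may
    vanish. *)
Lemma harnack_segment : exists2 C : R, 0 < C & forall (D : set V) U G z w rho, 0 < rho -> hfun D U G ->
  (forall (t : R) x, 0 <= t <= 1 -> enorm (x - (z + t *: (w - z))) <= rho -> D x /\ 0 <= U x) ->
  enorm (G w) <= C / rho * expR (C * enorm (w - z) / rho) * U z.
Proof.
have [C C0 HC] := @grad_pos.
exists C => // D U G z w rho rho0 hU DB.
pose p t := z + t *: (w - z).
have self t : 0 <= t <= 1 -> D (p t) /\ 0 <= U (p t).
  by move=> t01; apply: (DB t) => //; rewrite subrr enorm0 ltW.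
have GC t : 0 <= t <= 1 -> enorm (G (p t)) <= C / rho * U (p t).
  by move=> t01; apply: (HC D) => // x; exact: DB.
have p1 : p 1 = w by rewrite /p scale1r addrC subrK.
have p0 : p 0 = z by rewrite /p scale0r addr0.
pose k := C * enorm (w - z) / rho.
have [|t] := @mvt_line R (fun t => U (p t) * expR (- k * t))
  (fun t => (dot (G (p t)) (w - z) - k * U (p t)) * expR (- k * t)) 0 1.
  move=> t; rewrite min_l // max_r // => /self[Dt _].
  have Ht := hfun_line hU Dt; apply: is_derive_eq.
  by rewrite /GRing.scale /=; ring.
rewrite min_l // max_r // p1 p0 subr0 !mulr1 mulr0 expR0 mulr1 => t01 E.
have Uw : U w <= expR k * U z.
  suff h : U w * expR (- k) <= U z.
    by rewrite mulrC -ler_pdivrMr ?expR_gt0 // -expRN.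
  rewrite -subr_le0 E mulr_le0_ge0 ?expR_ge0 // subr_le0.
  apply: le_trans (dot_le _ _) _; apply: le_trans (ler_wpM2r (enorm_ge0 _) (GC t t01)) _.
  by rewrite /k le_eqVlt; apply/orP; left; apply/eqP; ring.
have h1 : (0 <= 1 :> R) && (1 <= 1 :> R) by rewrite ler01 lexx.
have := GC 1 h1; rewrite p1 => /le_trans; apply.
by rewrite -[leRHS]mulrA ler_wpM2l // divr_ge0 // ltW.
Qed.

End PositiveHarmonic.

Section BallGeometry.
Context {R : realType} {d : nat}.
Local Notation V := 'rV[R]_d.
Implicit Types z w p : V.

(** A smooth stand-in for the distance [1 - |z|] to the sphere, comparable to it within a factor [2]
    in the ball. *)
Definition Y z : R := 1 - sq z.

Lemma Y_le1 z : Y z <= 1.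
Proof. by rewrite /Y gerBl sq_ge0. Qed.

Lemma Y_gt0 z : (0 < Y z) = (enorm z < 1).
Proof. by rewrite enorm_lt // expr1n /Y subr_gt0. Qed.

Lemma Y_le2h z : 0 < Y z -> Y z <= 2 * (1 - enorm z).
Proof.
by rewrite Y_gt0 /Y -sqr_enorm => h; have := enorm_ge0 z; nra.
Qed.

Lemma h_leY z : 0 < Y z -> 1 - enorm z <= Y z.
Proof. by rewrite Y_gt0 /Y -sqr_enorm => h; have := enorm_ge0 z; nra. Qed.

Lemma Y_lip z w : 0 < Y z -> 0 < Y w -> Y z <= Y w + 2 * enorm (z - w).
Proof.
rewrite !Y_gt0 /Y -!sqr_enorm => hz hw.
have : enorm w <= enorm z + enorm (z - w).
  have := enorm_tri w z 0; rewrite !subr0 (enormBC w z); lra.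
have := enorm_ge0 z; have := enorm_ge0 w; have := enorm_ge0 (z - w); nra.
Qed.

Lemma Y_near p x r : 0 < Y p -> 0 <= r <= 1 -> enorm (x - p) <= r -> Y p - 3 * r <= Y x.
Proof.
rewrite Y_gt0 /Y -!sqr_enorm => hp /andP[r0 r1] xp.
have : enorm x <= enorm p + r.
  have := enorm_tri x p 0; rewrite !subr0; lra.
have := enorm_ge0 p; have := enorm_ge0 x; nra.
Qed.

(** [Y] is concave: along the segment it exceeds the linear interpolation by exactly
    [t (1 - t) |z - w| ^ 2]. *)
Lemma Y_segment z w (t : R) : 0 <= t <= 1 -> Num.min (Y z) (Y w) <= Y (z + t *: (w - z)).
Proof.
move=> /andP[t0 t1].
have -> : Y (z + t *: (w - z)) = (1 - t) * Y z + t * Y w + t * (1 - t) * sq (z - w).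
  rewrite /Y -(sqBC w z) sqD sqZ dotZr.
  have -> : sq w = sq z + 2 * dot z (w - z) + sq (w - z) by rewrite -sqD addrC subrK.
  ring.
have := sq_ge0 (z - w); have := mulr_ge0 t0 (_ : 0 <= 1 - t).
rewrite subr_ge0 => /(_ t1) h1 h2.
have h3 : Num.min (Y z) (Y w) <= Y z by rewrite ge_min lexx.
have h4 : Num.min (Y z) (Y w) <= Y w by rewrite ge_min lexx orbT.
nra.
Qed.

Lemma cts_Y z : continuous_at z Y.
Proof.
have H : continuous_at z (fun x : V => sq x) by apply: cts_sq; exact: cts_id.
by rewrite /Y; cts_tac.
Qed.

Lemma jet2_Y z : jet2 Y z (- (2 *: z)) (- d%:R).
Proof.
have H : jet2 sq z (2 *: z) d%:R.
  by apply: jet2_eq (jet2_eqc (jet2_sqB 0 z) _ _) => [x||]; rewrite ?subr0.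
by apply: (jet2_eqc (jet2B (jet2_cst 1 z) H)); rewrite sub0r.
Qed.

(* [T z w] is comparable to the squared Euclidean distance from [z] to the reflection
   of [w] in the sphere. *)
Definition T z w : R := sq (z - w) + Y w ^+ 2.

Lemma T_ge_sq z w : sq (z - w) <= T z w.
Proof. by rewrite lerDl sqr_ge0. Qed.

Lemma T_geYw z w : Y w ^+ 2 <= T z w.
Proof. by rewrite lerDr sq_ge0. Qed.

Lemma T_geYz z w : 0 < Y z -> 0 < Y w -> Y z ^+ 2 <= 5 * T z w.
Proof.
move=> z0 w0; have := Y_lip z0 w0; rewrite /T -sqr_enorm.
have := enorm_ge0 (z - w).
set e := enorm _; set a := Y z; set b := Y w => e0 h.
have h1 : a ^+ 2 <= (b + 2 * e) ^+ 2 by rewrite ler_pXn2r ?nnegrE //; rewrite /a /b; lra.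
(* The constant [5] is Cauchy-Schwarz: [5 (b ^ 2 + e ^ 2) - (b + 2 e) ^ 2 = (2 b - e) ^ 2]. *)
have := sqr_ge0 (2 * b - e); nra.
Qed.

Lemma T_gt0 z w : 0 < Y w -> 0 < T z w.
Proof. by move=> w0; apply: lt_le_trans (T_geYw z w); rewrite exprn_gt0. Qed.

End BallGeometry.

(** * The slowly varying kernel [kap] *)

Section SmoothKernel.
Context {R : realType} {d : nat}.
Local Notation V := 'rV[R]_d.
Local Notation m := d.+1.
Implicit Types z w p : V.

Lemma le_of_sq (a b : R) : 0 <= b -> a ^+ 2 <= b ^+ 2 -> a <= b.
Proof. by move=> b0 h; rewrite leNgt; apply/negP => ba; nra. Qed.

(** The prefactor normalises the kernel to [1] on the diagonal and makes it homogeneous of degree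
    zero in the quantities [Y z], [Y w] and [|z - w|]. *)
Definition kap z w : R := (Y w ^+ 2) ^+ m * ker 1 (Y w ^+ 2) 0 w m.+1 z.

Lemma kapE z w : kap z w = Y z ^+ 2 * (Y w ^+ 2) ^+ m / T z w ^+ m.+1.
Proof. by rewrite /kap /ker subr0 -/(Y z) -/(T z w) mulrCA mulrA. Qed.

Lemma kap_gt0 z w : 0 < Y z -> 0 < Y w -> 0 < kap z w.
Proof.
move=> z0 w0; rewrite kapE divr_gt0 ?exprn_gt0 ?T_gt0 //.
by rewrite mulr_gt0 ?exprn_gt0.
Qed.

Lemma kap_diag w : 0 < Y w -> kap w w = 1.
Proof.
move=> w0; rewrite kapE /T subrr sq0 add0r [(Y w ^+ 2) ^+ m.+1]exprS divff //.
by rewrite lt0r_neq0 // mulr_gt0 // !exprn_gt0.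
Qed.

(** [T z w] is the squared length of the pair [(z - w, Y w)], so its root obeys the triangle
    inequality; the displacement is measured against [Y z'], which is at most [3] times the root of
    [T z' w] because [5 <= 9] in [T_geYz]. *)
Lemma T_slow z z' w : 0 < Y z' -> 0 < Y w ->
  T z w <= T z' w * (1 + 3 * enorm (z - z') / Y z') ^+ 2.
Proof.
move=> z0 w0.
have e0 := enorm_ge0 (z - z'); have a0 := enorm_ge0 (z' - w).
have tri : enorm (z - w) <= enorm (z - z') + enorm (z' - w) := enorm_tri _ _ _.
have h5 := T_geYz z0 w0; have T0 := T_gt0 z' w0.
set s := 3 * enorm (z - z') / Y z'.
have s0 : 0 <= s by rewrite divr_ge0 ?mulr_ge0 // ltW.
have es : enorm (z - z') ^+ 2 <= s ^+ 2 * T z' w.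
  have -> : enorm (z - z') ^+ 2 = (s ^+ 2 / 9) * Y z' ^+ 2 by rewrite /s; field; rewrite lt0r_neq0.
  have := sqr_ge0 s; nra.
have cross : enorm (z - z') * enorm (z' - w) <= s * T z' w.
  apply: le_of_sq; first by rewrite mulr_ge0 // ltW.
  rewrite [leLHS]exprMn [leRHS]exprMn; apply: le_trans (ler_wpM2r (sqr_ge0 _) es) _.
  rewrite -[leLHS]mulrA ler_wpM2l ?sqr_ge0 // [T z' w ^+ 2]expr2 ler_wpM2l ?(ltW T0) //.
  by rewrite sqr_enorm T_ge_sq.
have : T z w <= (enorm (z - z') + enorm (z' - w)) ^+ 2 + Y w ^+ 2.
  rewrite /T lerD2r -sqr_enorm ler_pXn2r ?nnegrE ?enorm_ge0 //; lra.
have -> : (enorm (z - z') + enorm (z' - w)) ^+ 2 + Y w ^+ 2 =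
  enorm (z - z') ^+ 2 + 2 * (enorm (z - z') * enorm (z' - w)) + T z' w.
  by rewrite /T -(sqr_enorm (z' - w)); ring.
move=> /le_trans; apply.
have -> : T z' w * (1 + s) ^+ 2 = T z' w + 2 * (s * T z' w) + s ^+ 2 * T z' w by ring.
lra.
Qed.

(* The factor by which [kap ^~ w] may change from [z] to [z'], uniformly in [w]. *)
Definition slow z z' : R := (Y z' / Y z) ^+ 2 * ((1 + 3 * enorm (z - z') / Y z') ^+ 2) ^+ m.+1.

Lemma slow_ge0 z z' : 0 <= slow z z'.
Proof. by rewrite mulr_ge0 ?sqr_ge0 // exprn_ge0 // sqr_ge0. Qed.

Lemma kap_slow z z' w : 0 < Y z -> 0 < Y z' -> 0 < Y w -> kap z' w <= kap z w * slow z z'.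
Proof.
move=> z0 z'0 w0; rewrite !kapE /slow.
have T0 := T_gt0 z w0; have T0' := T_gt0 z' w0.
have ST := T_slow z z'0 w0; set q := (1 + _) ^+ 2 in ST *.
have STn : T z w ^+ m.+1 <= T z' w ^+ m.+1 * q ^+ m.+1.
  rewrite -exprMn ler_pXn2r ?nnegrE ?(ltW T0) // mulr_ge0 ?(ltW T0') //; exact: sqr_ge0.
have -> : Y z ^+ 2 * (Y w ^+ 2) ^+ m / T z w ^+ m.+1 * ((Y z' / Y z) ^+ 2 * q ^+ m.+1) =
  Y z' ^+ 2 * (Y w ^+ 2) ^+ m * (q ^+ m.+1 / T z w ^+ m.+1).
  by field; rewrite !lt0r_neq0 // exprn_gt0.
have A0 : 0 <= Y z' ^+ 2 * (Y w ^+ 2) ^+ m by apply: mulr_ge0; [exact: sqr_ge0|apply: exprn_ge0; exact: sqr_ge0].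
apply: (ler_wpM2l A0).
rewrite ler_pdivlMr ?exprn_gt0 // [leLHS]mulrC ler_pdivrMr ?exprn_gt0 //.
by rewrite [leRHS]mulrC.
Qed.

Lemma YY_le z w : 0 < Y z -> 0 < Y w -> Y z * Y w <= 3 * T z w.
Proof.
move=> z0 w0; have T0 := T_gt0 z w0; have h5 := T_geYz z0 w0; have h1 := T_geYw z w.
apply: le_of_sq; first by rewrite mulr_ge0 // ltW.
rewrite !exprMn.
have h : Y z ^+ 2 * Y w ^+ 2 <= (5 * T z w) * T z w by apply: ler_pM => //; exact: sqr_ge0.
have := sqr_ge0 (T z w); lra.
Qed.

(** The decay of [kap] beats the factor by which [v_cmp] allows [expR u] to grow from [z] to [w];
    this is what makes [gg_kap] work. *)
Lemma kap_T z w : 0 < Y z -> 0 < Y w -> kap z w * (T z w / (Y z * Y w)) <= 3.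
Proof.
move=> z0 w0; have T0 := T_gt0 z w0.
have -> : kap z w * (T z w / (Y z * Y w)) = (Y z * Y w / T z w) * ((Y w ^+ 2) ^+ d / T z w ^+ d).
  rewrite kapE [(Y w ^+ 2) ^+ m]exprS [T z w ^+ m.+1]exprS [T z w ^+ m]exprS; field.
  by rewrite !lt0r_neq0 // exprn_gt0.
rewrite -[3]mulr1; apply: ler_pM.
- by rewrite divr_ge0 ?mulr_ge0 // ltW.
- by rewrite divr_ge0 ?exprn_ge0 ?sqr_ge0 // ltW.
- by rewrite ler_pdivrMr // YY_le.
- rewrite ler_pdivrMr ?exprn_gt0 // mul1r lerXn2r ?nnegrE ?sqr_ge0 ?(ltW T0) //.
  exact: T_geYw.
Qed.

(** Chosen so that [2 (d + 3) ^ 2 * sepc ^ 2 = 1 / 2]: the negative term in [kap_lap] then costs at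
    most half a unit out of [3]. *)
Definition sepc : R := (2 * (d%:R + 3))^-1.

Lemma sepc_gt0 : 0 < sepc.
Proof. by rewrite invr_gt0 mulr_gt0 // ltr_wpDl. Qed.

(* [kap ^~ w] is strictly subharmonic at hyperbolic distance from [w] large enough. *)
Lemma kap_lap z w : 0 < Y z -> (4 + 2 * d%:R) * Y z <= 1 -> 0 < Y w ->
  exists b L, [/\ jet2 (fun x => kap x w) z b L,
    - (10 * (d%:R + 3) ^+ 2) * kap z w <= Y z ^+ 2 * L &
    Y z * Y w <= sepc * T z w -> 2 * kap z w <= Y z ^+ 2 * L].
Proof.
move=> z0 zs w0; have T0 := T_gt0 z w0.
have [b jk] := @jet2_ker R d 1 (Y w ^+ 2) 0 w m.+1 z T0.
have jK := jet2Z ((Y w ^+ 2) ^+ m) jk.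
have k0 := kap_gt0 z0 w0.
rewrite !subr0 -/(Y z) -/(T z w) in jK.
move: jK; set X := (X in T z w ^- _ * X) => jK.
have YL : Y z ^+ 2 * ((Y w ^+ 2) ^+ m * (T z w ^- m.+1 * X)) = kap z w * X by rewrite kapE; ring.
(* The leading [4 |z| ^ 2] provides the constant [3], by the smallness assumption on [Y z]; after
   collecting terms only the square of [Y z * Y w / T z w] keeps a negative coefficient. *)
have X3 : 3 - 2 * (d%:R + 3) ^+ 2 * (Y z * Y w / T z w) ^+ 2 <= X.
  have E : dot z (z - w) = (Y w - Y z + sq (z - w)) / 2.
    rewrite /Y; have -> : sq w = sq z - 2 * dot z (z - w) + sq (z - w).
      by rewrite -sqB; congr sq; rewrite opprB addrC subrK.
    by field.
  rewrite /X E.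
  have -> : sq z = 1 - Y z by rewrite /Y; ring.
  have -> : sq (z - w) = T z w - Y w ^+ 2 by rewrite /T; ring.
  rewrite -[m.+1]addn2 natrD; set D := d%:R in zs *; set y := Y z in z0 zs *; set yw := Y w in w0 *.
  set t := T z w in T0 *.
  have D0 : 0 <= D by rewrite /D.
  have -> : 4 * (1 - y) - 2 * D * y + 8 * (D + 2) * y * ((yw - y + (t - yw ^+ 2)) / 2) / t +
    y ^+ 2 / t ^+ 2 * (2 * (D + 2) * (D + 2 + 1) * (t - yw ^+ 2) - (D + 2) * D * t) =
    4 - (4 + 2 * D) * y + 4 * (D + 2) * (y / t * (yw + (t - yw ^+ 2))) +
    (D + 2) ^+ 2 * (y ^+ 2 / t) - 2 * (D + 2) * (D + 3) * (y * yw / t) ^+ 2.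
    by field; rewrite lt0r_neq0.
  have tt : 0 <= t - yw ^+ 2 by rewrite subr_ge0 T_geYw.
  have a1 : 0 <= y / t * (yw + (t - yw ^+ 2)).
    apply: mulr_ge0; first by apply: divr_ge0; exact: ltW.
    by apply: addr_ge0 => //; exact: ltW.
  have a2 : 0 <= y ^+ 2 / t by rewrite divr_ge0 ?sqr_ge0 // ltW.
  have := sqr_ge0 (y * yw / t); set q := (y * yw / t) ^+ 2 => q0.
  have a3 : 0 <= 4 * (D + 2) * (y / t * (yw + (t - yw ^+ 2))) by rewrite mulr_ge0 //; lra.
  have a4 : 0 <= (D + 2) ^+ 2 * (y ^+ 2 / t) by rewrite mulr_ge0 // sqr_ge0.
  have a5 : 2 * (D + 2) * (D + 3) * q <= 2 * (D + 3) ^+ 2 * q by nra.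
  lra.
exists (((Y w ^+ 2) ^+ m) *: b), ((Y w ^+ 2) ^+ m * (T z w ^- m.+1 * X)); rewrite YL; split => //.
  rewrite [leLHS]mulrC ler_pM2l //.
  apply: le_trans X3.
  have q5 : (Y z * Y w / T z w) ^+ 2 <= 5.
    rewrite expr_div_n ler_pdivrMr ?exprn_gt0 // exprMn.
    have : Y z ^+ 2 * Y w ^+ 2 <= (5 * T z w) * T z w.
      by apply: ler_pM; rewrite ?sqr_ge0 // ?T_geYw // T_geYz.
    by lra.
  have := sqr_ge0 (d%:R + 3 : R); nra.
move=> far; rewrite [leLHS]mulrC ler_pM2l //; apply: le_trans X3.
have q1 : Y z * Y w / T z w <= sepc by rewrite ler_pdivrMr.
have q0 : 0 <= Y z * Y w / T z w by rewrite divr_ge0 ?mulr_ge0 // ltW.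
have q2 : (Y z * Y w / T z w) ^+ 2 <= sepc ^+ 2.
  by rewrite ler_pXn2r ?nnegrE // ltW // sepc_gt0.
have e2 : (d%:R + 3) ^+ 2 * sepc ^+ 2 = 1 / 4.
  by rewrite /sepc; field; rewrite lt0r_neq0 // ltr_wpDl.
have := sqr_ge0 (d%:R + 3 : R); nra.
Qed.

Lemma cts_kap z w : 0 < Y w -> continuous_at w (kap z).
Proof.
move=> w0; apply: (@cts_eq _ _ _ (fun w => Y z ^+ 2 * (Y w ^+ 2) ^+ m * (T z w ^+ m.+1)^-1)).
  by move=> x; rewrite kapE.
have c1 := @cts_Y R d w.
have c2 : continuous_at w (fun x => z - x) by cts_tac.
have c3 := cts_sq c2.
have c4 : continuous_at w (fun x => (T z x ^+ m.+1)^-1).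
  by apply: ctsV; [rewrite lt0r_neq0 // exprn_gt0 // T_gt0|rewrite /T; cts_tac].
by cts_tac.
Qed.

End SmoothKernel.

(** * Growth of Bloch functions *)

Section BlochGrowth.
Context {R : realType} {d : nat}.
Local Notation V := 'rV[R]_d.
Implicit Types z w p : V.
Variables (u : V -> R) (G : V -> V) (M : R).
Hypothesis hu : hfun [set z | 0 < Y z] u G.
Hypothesis hM : forall z, 0 < Y z -> enorm (G z) * Y z <= M.
Hypothesis M1 : M <= 1.

Let v z := expR (u z).

Lemma ball_scale z (t : R) : 0 < Y z -> 0 <= t <= 1 -> 0 < Y (t *: z).
Proof.
rewrite !Y_gt0 enormZ => z0 /andP[t0 t1]; rewrite ger0_norm //.
have := enorm_ge0 z; nra.
Qed.

(** Since [|grad u| (1 - |z|) <= M <= 1], both [v] and its inverse, multiplied by the distance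
    [1 - t |z|] to the sphere, do not increase along the radius; [e] in [key] is the sign of [u]. *)
Lemma v_radial z (l : R) : 0 < Y z -> 0 <= l <= 1 ->
  v z * (1 - enorm z) <= v (l *: z) * (1 - l * enorm z) /\
  v (l *: z) * (1 - enorm z) <= v z * (1 - l * enorm z).
Proof.
move=> z0 l01; have /andP[l0 l1] := l01; have ez := enorm_ge0 z.
have z1 : enorm z < 1 by rewrite -Y_gt0.
have key (e : R) : `|e| = 1 -> expR (e * u z) * (1 - enorm z) <=
    expR (e * u (l *: z)) * (1 - l * enorm z).
  move=> e1.
  have [|t] := @mvt_line R (fun t => expR (e * u (0 + t *: z)) * (1 - t * enorm z))
    (fun t => expR (e * u (0 + t *: z)) *
      (e * dot (G (0 + t *: z)) z * (1 - t * enorm z) - enorm z)) l 1.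
    move=> t; rewrite min_l // max_r // => /andP[lt t1].
    have Dt : [set z | 0 < Y z] (0 + t *: z) by rewrite /= add0r ball_scale // t1 (le_trans l0).
    have Ht := hfun_line hu Dt; apply: is_derive_eq.
    by rewrite /GRing.scale /=; ring.
  rewrite min_l // max_r // !add0r scale1r mul1r => /andP[lt t1] E.
  rewrite -subr_le0 E; apply: mulr_le0_ge0; last by rewrite subr_ge0.
  rewrite pmulr_rle0 ?expR_gt0 // subr_le0.
  have t0 : 0 <= t := le_trans l0 lt.
  have Yt : 0 < Y (t *: z) by rewrite ball_scale // t0.
  have h0 : 0 <= 1 - t * enorm z by nra.
  have h : 1 - t * enorm z <= Y (t *: z).
    by have := h_leY Yt; rewrite enormZ ger0_norm.
  have g0 := enorm_ge0 (G (t *: z)).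
  have dg : e * dot (G (t *: z)) z <= enorm (G (t *: z)) * enorm z.
    apply: le_trans (ler_norm _) _; rewrite normrM e1 mul1r; exact: norm_dot_le.
  have gM : enorm (G (t *: z)) * (1 - t * enorm z) <= 1.
    by apply: le_trans M1; apply: le_trans (hM Yt); rewrite ler_wpM2l.
  apply: le_trans (ler_wpM2r h0 dg) _; nra.
split; first by have := key 1; rewrite !mul1r normr1; exact.
have := key (-1); rewrite normrN normr1 !mulN1r !expRN -/(v z) -/(v (l *: z)) => /(_ erefl) h.
have v1 : 0 < v z := expR_gt0 _; have v2 : 0 < v (l *: z) := expR_gt0 _.
rewrite mulrC [leRHS]mulrC -ler_pdivlMr // mulrAC -ler_pdivrMr //.
by rewrite mulrC [leRHS]mulrC.
Qed.

(** Move from [z] inward to [la *: z], across to [la *: w], then outward to [w], where the depth [L]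
    is about [|z - w|] plus both heights. The radial parts cost [2 l / (1 - |z|)] and
    [2 l / (1 - |w|)], the crossing costs [expR 1]. With [l ^ 2 <= 18 T] and [Y <= 2 (1 - |.|)] the
    constant is [4 * 18 * 4 = 288]. *)
Lemma v_cmp z w : 0 < Y z -> 0 < Y w ->
  v w <= 288 * expR 1 * (T z w / (Y z * Y w)) * v z.
Proof.
move=> z0 w0; have T0 := T_gt0 z w0.
have ez := enorm_ge0 z; have ew := enorm_ge0 w; have e0 := enorm_ge0 (z - w).
have z1 : enorm z < 1 by rewrite -Y_gt0.
have w1 : enorm w < 1 by rewrite -Y_gt0.
have YT := T_geYz z0 w0; have hz := h_leY z0; have hw := h_leY w0.
have hz2 := Y_le2h z0; have hw2 := Y_le2h w0.
pose l := enorm (z - w) + (1 - enorm z) + (1 - enorm w).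
pose L := Num.min 1 l; pose la := 1 - L.
have l0 : 0 < l by rewrite /l; lra.
have L0 : 0 < L by rewrite lt_min ltr01.
have L1 : L <= 1 by rewrite ge_min lexx.
have Ll : L <= l by rewrite ge_min lexx orbT.
have la01 : 0 <= la <= 1 by rewrite /la; apply/andP; split; lra.
have [_ rz] := v_radial z0 la01; have [rw _] := v_radial w0 la01.
have bz : 1 - la * enorm z <= 2 * l by rewrite /la; have : L <= l := Ll; rewrite /l; nra.
have bw : 1 - la * enorm w <= 2 * l by rewrite /la; have : L <= l := Ll; rewrite /l; nra.
have mid : v (la *: w) <= expR 1 * v (la *: z).
  rewrite /v -expRD ler_expR -lerBlDr.
  have Dt (t : R) : 0 <= t <= 1 -> [set z | 0 < Y z] (la *: z + t *: (la *: w - la *: z)).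
    move=> t01 /=; have := Y_segment (la *: z) (la *: w) t01; apply: lt_le_trans.
    by rewrite lt_min !ball_scale.
  have [t t01 ->] := hfun_mvt hu Dt.
  have Yt := Dt t t01; rewrite /= in Yt; set p := la *: z + _ in Yt *.
  have pl : enorm p <= la.
    have -> : p = la *: (z + t *: (w - z)).
      by rewrite /p; apply/rowP => i; rewrite !mxE; ring.
    have /andP[la0 _] := la01.
    rewrite enormZ ger0_norm // ler_piMr //.
    rewrite -[z + _]subr0; apply: (segment_ball t01); rewrite subr0; exact: ltW.
  have Lp : L <= Y p by have := h_leY Yt; rewrite /la in pl; lra.
  have gp : enorm (G p) * L <= 1.
    by apply: le_trans M1; apply: le_trans (hM Yt); rewrite ler_wpM2l // enorm_ge0.
  apply: le_trans (dot_le _ _) _; rewrite -scalerBr enormZ ger0_norm; last by case/andP: la01.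
  have g0 := enorm_ge0 (G p).
  (* If [L = 1], both points have collapsed to the origin. *)
  have : la * enorm (w - z) <= L.
    rewrite enormBC /la /L; case: (leP 1 l) => h; first by rewrite subrr mul0r.
    by move: h; rewrite /l; nra.
  by move=> h; apply: le_trans gp; rewrite ler_wpM2l.
have v1 : 0 < v (la *: z) := expR_gt0 _; have v2 : 0 < v (la *: w) := expR_gt0 _.
have v3 : 0 < v z := expR_gt0 _; have v4 : 0 < v w := expR_gt0 _.
have hz0 : 0 < 1 - enorm z by lra.
have hw0 : 0 < 1 - enorm w by lra.
have ee : 0 < expR 1 :> R := expR_gt0 _.
have k1 : v w * (1 - enorm w) <= v (la *: w) * (2 * l).
  by apply: le_trans rw _; rewrite ler_pM2l.
have k2 : v (la *: z) * (1 - enorm z) <= v z * (2 * l).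
  by apply: le_trans rz _; rewrite ler_pM2l.
have k3 : v w * (1 - enorm w) * (1 - enorm z) <= 4 * expR 1 * l ^+ 2 * v z.
  apply: le_trans (_ : v (la *: w) * (2 * l) * (1 - enorm z) <= _).
    by rewrite ler_pM2r.
  apply: le_trans (_ : expR 1 * v (la *: z) * (2 * l) * (1 - enorm z) <= _).
    by rewrite ler_pM2r // ler_pM2r // mulr_gt0.
  have -> : expR 1 * v (la *: z) * (2 * l) * (1 - enorm z) =
    expR 1 * (2 * l) * (v (la *: z) * (1 - enorm z)) by ring.
  have -> : 4 * expR 1 * l ^+ 2 * v z = expR 1 * (2 * l) * (v z * (2 * l)) by ring.
  by rewrite ler_pM2l // !mulr_gt0.
have lT : l ^+ 2 <= 18 * T z w.
  have : l <= enorm (z - w) + Y z + Y w by rewrite /l; lra.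
  have sT : enorm (z - w) ^+ 2 + Y w ^+ 2 = T z w by rewrite sqr_enorm.
  move: e0 sT; set e := enorm (z - w) => e0 sT h.
  have h2 : l ^+ 2 <= (e + Y z + Y w) ^+ 2 by apply: lerXn2r => //; rewrite nnegrE; lra.
  have : (e + Y z + Y w) ^+ 2 = 3 * (e ^+ 2 + Y z ^+ 2 + Y w ^+ 2)
    - (e - Y z) ^+ 2 - (e - Y w) ^+ 2 - (Y w - Y z) ^+ 2 by ring.
  have := sqr_ge0 (e - Y z); have := sqr_ge0 (e - Y w); have := sqr_ge0 (Y w - Y z).
  move: h2 YT sT => /=; lra.
have -> : 288 * expR 1 * (T z w / (Y z * Y w)) * v z =
  (288 * expR 1 * T z w * v z) / (Y z * Y w) by field; rewrite !lt0r_neq0.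
rewrite ler_pdivlMr ?mulr_gt0 //.
have k4 : Y z * Y w <= 4 * ((1 - enorm w) * (1 - enorm z)) by nra.
apply: le_trans (ler_wpM2l (ltW v4) k4) _.
have -> : v w * (4 * ((1 - enorm w) * (1 - enorm z))) = 4 * (v w * (1 - enorm w) * (1 - enorm z)) by ring.
apply: le_trans (ler_wpM2l _ k3) _ => //.
have -> : 4 * (4 * expR 1 * l ^+ 2 * v z) = (16 * expR 1 * v z) * l ^+ 2 by ring.
have -> : 288 * expR 1 * T z w * v z = (16 * expR 1 * v z) * (18 * T z w) by ring.
by rewrite ler_wpM2l // !mulr_ge0 // ltW.
Qed.

Definition gg w : R := Y w * v w * enorm (G w).

Lemma gg_ge0 w : 0 < Y w -> 0 <= gg w.
Proof. by move=> w0; rewrite !mulr_ge0 ?enorm_ge0 ?expR_ge0 // ltW. Qed.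

Lemma gg_le w : 0 < Y w -> gg w <= M * v w.
Proof.
move=> w0; rewrite /gg; have -> : Y w * v w * enorm (G w) = (enorm (G w) * Y w) * v w by ring.
by rewrite ler_wpM2r ?expR_ge0 // hM.
Qed.

(** Taking the supremum over [w], this bounds [gs] by a multiple of [M * expR u]. For small [M] the
    term [- B gs] therefore cannot outweigh [expR u]. The constant is [288 * 3]. *)
Lemma gg_kap z w : 0 < Y z -> 0 < Y w -> gg w * kap z w <= 864 * expR 1 * M * v z.
Proof.
move=> z0 w0.
have M0 : 0 <= M by apply: le_trans (hM z0); rewrite mulr_ge0 ?enorm_ge0 // ltW.
have k0 := kap_gt0 z0 w0; have vz : 0 < v z := expR_gt0 _.
apply: le_trans (ler_wpM2r (ltW k0) (gg_le w0)) _.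
have h : v w * kap z w <= 288 * expR 1 * v z * (kap z w * (T z w / (Y z * Y w))).
  by apply: le_trans (ler_wpM2r (ltW k0) (v_cmp z0 w0)) _; rewrite le_eqVlt; apply/orP; left; apply/eqP; ring.
have h2 : 288 * expR 1 * v z * (kap z w * (T z w / (Y z * Y w))) <= 288 * expR 1 * v z * 3.
  have e1 : 0 < expR 1 * v z by rewrite mulr_gt0 ?expR_gt0.
  by apply: ler_wpM2l; [lra|exact: kap_T].
rewrite -[leLHS]mulrA; have -> : 864 * expR 1 * M * v z = M * (288 * expR 1 * v z * 3) by ring.
by rewrite ler_wpM2l // (le_trans h).
Qed.

End BlochGrowth.

(** * Majorant and inf-convolutions *)

Section Majorants.
Context {R : realType} {d : nat}.
Local Notation V := 'rV[R]_d.
Local Notation m := d.+1.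
Implicit Types z w p q : V.

(** Continuity of the envelopes [gs] and [Gk k] is obtained from multiplicative slow variation
    alone, by squeezing between [f z / w2] and [f z * w1]. *)
Lemma cts_slow_varying (f w1 w2 : V -> R) z : (forall x, 0 <= f x) ->
  continuous_at z w1 -> continuous_at z w2 -> w1 z = 1 -> w2 z = 1 ->
  (\forall x \near z, f x <= f z * w1 x) -> (\forall x \near z, f z <= f x * w2 x) ->
  continuous_at z f.
Proof.
move=> f0 c1 c2 e1 e2 h1 h2.
have w20 : w2 z != 0 by rewrite e2 oner_neq0.
have c3 : continuous_at z (fun x => (w2 x)^-1) by apply: ctsV.
have l1 : f z * w1 x @[x --> z] --> f z.
  have h : continuous_at z (fun x => f z * w1 x) by cts_tac.
  by move: h; rewrite /continuous_at e1 mulr1.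
have l2 : f z * (w2 x)^-1 @[x --> z] --> f z.
  have h : continuous_at z (fun x => f z * (w2 x)^-1) by cts_tac.
  by move: h; rewrite /continuous_at e2 invr1 mulr1.
apply: (squeeze_cvgr _ l2 l1).
have w2p : \forall x \near z, 0 < w2 x by apply: (cts_gt c2); rewrite e2.
near=> x; apply/andP; split; last by near: x.
by rewrite ler_pdivrMr; near: x.
Unshelve. all: by end_near. Qed.

Definition hh (k : nat) : R := 2^-1 ^+ k.

Lemma hh_gt0 k : 0 < hh k.
Proof. by rewrite exprn_gt0 // invr_gt0. Qed.

Lemma hh_le1 k : hh k <= 1.
Proof. by rewrite exprn_ile1 // ?invr_ge0 // invf_le1 // ler1n. Qed.

(* Weights with [mw t ~ min(t, 1/t)] whose sum over dyadic scales telescopes. *)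
Definition mw (t : R) : R := t / ((1 + t) * (1 + 2 * t)).

Lemma mw_ge0 t : 0 <= t -> 0 <= mw t.
Proof. by move=> t0; rewrite divr_ge0 // mulr_ge0; lra. Qed.

Lemma mw_small t : 0 <= t <= 1 -> t <= 6 * mw t.
Proof.
move=> /andP[t0 t1]; rewrite /mw mulrA ler_pdivlMr; last by rewrite mulr_gt0; lra.
by rewrite mulrC; apply: ler_wpM2r => //; nra.
Qed.

Lemma mw_large t : 1 <= t -> t^-1 <= 6 * mw t.
Proof.
move=> t1; rewrite /mw mulrA ler_pdivlMr; last by rewrite mulr_gt0; lra.
by rewrite mulrC ler_pdivrMr; nra.
Qed.

(** With [th t = t / (1 + t)] one has [mw t = th (2 t) - th t], and passing from [hh k] to [hh k.+1]
    doubles the argument. *)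
Lemma sum_mw n (y : R) : 0 < y -> \sum_(k < n) mw (y / hh k) <= 1.
Proof.
move=> y0; pose th (t : R) := t / (1 + t).
have -> : \sum_(k < n) mw (y / hh k) = th (y / hh n) - th (y / hh 0).
  elim: n => [|n IH]; first by rewrite big_ord0 subrr.
  rewrite big_ord_recr /= IH; set t := y / hh n.
  have t0 : 0 < t by rewrite divr_gt0 // hh_gt0.
  have -> : y / hh n.+1 = 2 * t.
    by rewrite /t /hh exprS; field; rewrite expf_neq0 //= invr_neq0.
  have a1 : 1 + t != 0 by apply: lt0r_neq0; lra.
  have a2 : 1 + 2 * t != 0 by apply: lt0r_neq0; lra.
  have -> : th (2 * t) = th t + mw t by rewrite /mw /th; field; rewrite a1 a2.
  by move: (th t) (th (y / hh 0)) (mw t) => x1 x2 x3; ring.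
have t0 k : 0 < y / hh k by rewrite divr_gt0 // hh_gt0.
have h1 : 0 <= th (y / hh 0) by rewrite /th divr_ge0 //; have := t0 0%N; lra.
have h2 : th (y / hh n) <= 1 by rewrite /th ler_pdivrMr; have := t0 n; lra.
lra.
Qed.

(** The penalty grows with the same power as [slow], so that a distant [q] cannot make the
    inf-convolution much smaller than the nearby values of [gs]; see [Gk_low]. *)
Definition Psi k z q : R := (1 + hh k ^- 2 * sq (z - q)) ^+ m.+1.

Lemma Psi_arg_ge1 k z q : 1 <= 1 + hh k ^- 2 * sq (z - q).
Proof. by rewrite lerDl mulr_ge0 ?sq_ge0 // invr_ge0 exprn_ge0 // ltW // hh_gt0. Qed.

Lemma Psi_gt0 k z q : 0 < Psi k z q.
Proof. by rewrite exprn_gt0 // (lt_le_trans _ (Psi_arg_ge1 k z q)). Qed.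

Lemma Psi_slow k z z' q : Psi k z' q <= Psi k z q * ((1 + enorm (z' - z) / hh k) ^+ 2) ^+ m.+1.
Proof.
rewrite /Psi -exprMn; have h0 := hh_gt0 k.
have l1 := Psi_arg_ge1 k z q; have l2 := Psi_arg_ge1 k z' q.
have b0 : 0 <= enorm (z' - z) / hh k by rewrite divr_ge0 ?enorm_ge0 // ltW.
apply: lerXn2r; rewrite ?nnegrE.
- by rewrite (le_trans ler01).
- by rewrite mulr_ge0 ?sqr_ge0 // (le_trans ler01).
pose a := enorm (z - q) / hh k; set b := enorm (z' - z) / hh k in b0 *.
have a0 : 0 <= a by rewrite divr_ge0 ?enorm_ge0 // ltW.
have -> : hh k ^- 2 * sq (z - q) = a ^+ 2 by rewrite -sqr_enorm /a expr_div_n mulrC.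
have ab : hh k ^- 2 * sq (z' - q) <= (a + b) ^+ 2.
  have -> : hh k ^- 2 * sq (z' - q) = (enorm (z' - q) / hh k) ^+ 2 by rewrite expr_div_n sqr_enorm mulrC.
  apply: lerXn2r; rewrite ?nnegrE ?divr_ge0 ?enorm_ge0 ?addr_ge0 // ?(ltW h0) //.
  rewrite /a /b -mulrDl ler_pM2r ?invr_gt0 //; have := enorm_tri z' z q; lra.
have : 0 <= b * (1 + a ^+ 2 - a) by apply: mulr_ge0 => //; nra.
have : 0 <= a ^+ 2 * b ^+ 2 by rewrite mulr_ge0 ?sqr_ge0.
nra.
Qed.

Lemma slow_diag z : 0 < Y z -> slow z z = 1 :> R.
Proof.
by move=> z0; rewrite /slow divff ?lt0r_neq0 // subrr enorm0 mulr0 mul0r addr0 !expr1n mulr1.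
Qed.

Lemma cts_slow1 z : 0 < Y z -> continuous_at z (slow z : V -> R).
Proof.
move=> z0; have c1 := @cts_Y R d z.
have c2 : continuous_at z (fun x => z - x) by cts_tac.
have c3 := cts_enorm c2.
have c4 : continuous_at z (fun x => (Y x)^-1) by apply: ctsV => //; exact: lt0r_neq0.
by rewrite /slow; cts_tac.
Qed.

Lemma cts_slow2 z : 0 < Y z -> continuous_at z (fun x => slow x z : R).
Proof.
move=> z0; have c1 := @cts_Y R d z.
have c2 : continuous_at z (fun x => x - z) by cts_tac.
have c3 := cts_enorm c2.
have c4 : continuous_at z (fun x => (Y x)^-1) by apply: ctsV => //; exact: lt0r_neq0.
by rewrite /slow; cts_tac.
Qed.

Lemma Y_compact (r : R) : compact [set z : V | r <= Y z].
Proof.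
have -> : [set z : V | r <= Y z] = [set z | sq (z - 0) <= 1 - r].
  by apply/seteqP; split => z /=; rewrite subr0 /Y; lra.
exact: cball_compact.
Qed.

Lemma Y0 : Y (0 : V) = 1.
Proof. by rewrite /Y sq0 subr0. Qed.

Section SupKernel.
Variables (g : V -> R) (r0 : R).
Hypotheses (r00 : 0 < r0) (r01 : r0 <= 1).
Hypothesis g0 : forall w, 0 < Y w -> 0 <= g w.
Hypothesis cg : forall w, 0 < Y w -> continuous_at w g.

(* [gs] is the regularised majorant [sup_w g w * kap z w] and [Gk k] its
   inf-convolution at height [hh k]. *)
Definition is_majorant (gs : V -> R) := forall z, 0 < Y z ->
  (exists2 w, r0 <= Y w & gs z = g w * kap z w) /\
  (forall w, r0 <= Y w -> g w * kap z w <= gs z).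

Definition is_infconv (gs : V -> R) (Gk : nat -> V -> R) := forall k z,
  (exists2 q, hh k <= Y q & Gk k z = gs q * Psi k z q) /\
  (forall q, hh k <= Y q -> Gk k z <= gs q * Psi k z q).

Lemma majorant_exists : exists2 gs, is_majorant gs & forall z, 0 <= gs z.
Proof.
have H z : exists a, 0 <= a /\ (0 < Y z ->
    (exists2 w, r0 <= Y w & a = g w * kap z w) /\
    (forall w, r0 <= Y w -> g w * kap z w <= a)).
  (* Outside the ball the value [0] is a convention that keeps [gs] nonnegative everywhere. *)
  have [z0|z0] := ltP 0 (Y z); last by exists 0; split => // z0'; lra.
  have [|w|w Kw Hw] := EVT_max_on (f := fun w => g w * kap z w) _ (@Y_compact r0).
  - by exists 0; rewrite /= Y0.
  - move=> /= /(lt_le_trans r00) w0; have c1 := cg w0; have c2 := @cts_kap R d z w w0.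
    by cts_tac.
  have w0 := lt_le_trans r00 Kw.
  exists (g w * kap z w); split; first by rewrite mulr_ge0 ?g0 // ltW // kap_gt0.
  by move=> _; split => //; exists w.
have [gs Hgs] := choice H; exists gs; last by move=> z; have [] := Hgs z.
by move=> z z0; have [_] := Hgs z; apply.
Qed.

Variable gs : V -> R.
Hypothesis Hgs : is_majorant gs.
Hypothesis gs0 : forall z, 0 <= gs z.

Lemma gs_ge z : r0 <= Y z -> g z <= gs z.
Proof.
move=> zr; have z0 := lt_le_trans r00 zr; have [_ /(_ z zr)] := Hgs z0.
by rewrite kap_diag // mulr1.
Qed.

Lemma gs_slow z z' : 0 < Y z -> 0 < Y z' -> gs z' <= gs z * slow z z'.
Proof.
move=> z0 z0'; have [[w wr ->] _] := Hgs z0'; have [_ /(_ w wr) h] := Hgs z0.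
have w0 := lt_le_trans r00 wr.
apply: le_trans (_ : g w * kap z w * slow z z' <= _).
  by rewrite -mulrA ler_wpM2l ?g0 // kap_slow.
by rewrite ler_wpM2r // slow_ge0.
Qed.

Lemma cts_gs z : 0 < Y z -> continuous_at z gs.
Proof.
move=> z0; have Yn := cts_gt (@cts_Y R d z) z0.
apply: (@cts_slow_varying gs (slow z) (slow ^~ z) z gs0 (cts_slow1 z0) (cts_slow2 z0)).
- exact: slow_diag.
- exact: slow_diag.
- by near=> x; apply: gs_slow => //; near: x.
- by near=> x; apply: gs_slow => //; near: x.
Unshelve. all: by end_near. Qed.

Lemma infconv_exists : exists Gk, is_infconv gs Gk.
Proof.
have H (kz : nat * V) : exists a,
    (exists2 q, hh kz.1 <= Y q & a = gs q * Psi kz.1 kz.2 q) /\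
    (forall q, hh kz.1 <= Y q -> a <= gs q * Psi kz.1 kz.2 q).
  case: kz => k z /=.
  have [|q|q Kq Hq] := EVT_min_on (f := fun q => gs q * Psi k z q) _ (@Y_compact (hh k)).
  - by exists 0; rewrite /= Y0 hh_le1.
  - move=> /= /(lt_le_trans (hh_gt0 k)) q0; have c1 := cts_gs q0.
    have c2 : continuous_at q (fun x => z - x) by cts_tac.
    have c3 := cts_sq c2.
    by rewrite /Psi; cts_tac.
  by exists (gs q * Psi k z q); split => //; exists q.
have [f Hf] := choice H; exists (fun k z => f (k, z)) => k z; exact: Hf (k, z).
Qed.

Variable Gk : nat -> V -> R.
Hypothesis HG : is_infconv gs Gk.

Lemma Gk_ge0 k z : 0 <= Gk k z.
Proof. by have [[q _ ->] _] := HG k z; rewrite mulr_ge0 // ltW // Psi_gt0. Qed.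

Lemma Gk_slow k z z' : Gk k z' <= Gk k z * ((1 + enorm (z' - z) / hh k) ^+ 2) ^+ m.+1.
Proof.
have [[q qk ->] _] := HG k z; have [_ /(_ q qk) h] := HG k z'.
by apply: le_trans h _; rewrite -mulrA ler_wpM2l // Psi_slow.
Qed.

Lemma cts_Gk k z : continuous_at z (Gk k).
Proof.
have h0 := hh_gt0 k.
have c1 : continuous_at z (fun x => x - z) by cts_tac.
have c2 := cts_enorm c1.
have c3 : continuous_at z (fun x => ((1 + enorm (x - z) / hh k) ^+ 2) ^+ m.+1) by cts_tac.
have e : ((1 + enorm (z - z) / hh k) ^+ 2) ^+ m.+1 = 1.
  by rewrite subrr enorm0 mul0r addr0 !expr1n.
apply: (@cts_slow_varying (Gk k) _ _ z (Gk_ge0 k) c3 c3 e e).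
- by near=> x; exact: Gk_slow.
- by near=> x; rewrite enormBC; exact: Gk_slow.
Unshelve. all: by end_near. Qed.

(** The competitor in the infimum is [z] pushed inward by the factor [1 - hh k]: its height is at
    least [hh k] and its distance from [z] at most [hh k]. There [Psi] costs [2 ^+ m.+1] and [slow]
    at most [4 (1 + hh k / Y z) ^ 2 * 16 ^+ m.+1]. *)
Lemma Gk_up k z : 0 < Y z -> Gk k z <= 4 * 32 ^+ m.+1 * (1 + hh k / Y z) ^+ 2 * gs z.
Proof.
move=> z0; have h0 := hh_gt0 k; have h1 := hh_le1 k.
pose q := (1 - hh k) *: z.
have ez := enorm_ge0 z; have z1 : enorm z < 1 by rewrite -Y_gt0.
have Yq : Y q = 1 - (1 - hh k) ^+ 2 * sq z by rewrite /Y sqZ.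
have sz : sq z = 1 - Y z by rewrite /Y; ring.
have sz0 := sq_ge0 z.
have sz1 : sq z <= 1 by lra.
have hs : (1 - hh k) ^+ 2 * sq z <= 1 - hh k.
  apply: le_trans (_ : (1 - hh k) ^+ 2 <= _); last by nra.
  by rewrite ler_piMr // sqr_ge0.
have qk : hh k <= Y q by rewrite Yq; lra.
have q0 := lt_le_trans h0 qk.
have Yq2 : Y q <= Y z + 2 * hh k.
  have := mulr_ge0 (ltW h0) sz0; have := mulr_ge0 (sqr_ge0 (hh k)) sz0.
  have := ler_wpM2l (ltW h0) sz1; rewrite Yq /Y; lra.
have zq : enorm (z - q) <= hh k.
  have -> : z - q = hh k *: z by rewrite /q; apply/rowP => i; rewrite !mxE; ring.
  by rewrite enormZ gtr0_norm //; nra.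
have [_ /(_ q qk) h] := HG k z; apply: le_trans h _.
have P2 : Psi k z q <= 2 ^+ m.+1.
  apply: lerXn2r; rewrite ?nnegrE //; first by rewrite (le_trans ler01) // Psi_arg_ge1.
  suff : hh k ^- 2 * sq (z - q) <= 1 by lra.
  by rewrite mulrC ler_pdivrMr ?exprn_gt0 // mul1r -enorm_le // ltW.
have S : slow z q <= 4 * (1 + hh k / Y z) ^+ 2 * 16 ^+ m.+1.
  rewrite /slow; apply: ler_pM; [exact: sqr_ge0|by apply: exprn_ge0; exact: sqr_ge0|..].
    have -> : 4 * (1 + hh k / Y z) ^+ 2 = (2 * (1 + hh k / Y z)) ^+ 2 by ring.
    have a0 : 0 <= hh k / Y z by rewrite divr_ge0 // ltW.
    apply: lerXn2r; rewrite ?nnegrE ?divr_ge0 ?(ltW q0) ?(ltW z0) //; first lra.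
    rewrite ler_pdivrMr //; have -> : 2 * (1 + hh k / Y z) * Y z = 2 * Y z + 2 * hh k.
      by field; exact: lt0r_neq0.
    lra.
  have s0 : 0 <= 3 * enorm (z - q) / Y q by rewrite divr_ge0 ?mulr_ge0 ?enorm_ge0 // ltW.
  have s3 : 3 * enorm (z - q) / Y q <= 3 by rewrite ler_pdivrMr //; lra.
  by apply: lerXn2r; rewrite ?nnegrE ?sqr_ge0 //; nra.
have Gq := gs_slow z0 q0.
apply: le_trans (_ : gs z * slow z q * Psi k z q <= _).
  by rewrite ler_wpM2r // ltW // Psi_gt0.
apply: le_trans (_ : gs z * (4 * (1 + hh k / Y z) ^+ 2 * 16 ^+ m.+1) * 2 ^+ m.+1 <= _).
  apply: ler_pM => //; [by rewrite mulr_ge0 ?slow_ge0|exact/ltW/Psi_gt0|by rewrite ler_wpM2l].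
have -> : 32 ^+ m.+1 = 16 ^+ m.+1 * 2 ^+ m.+1 :> R by rewrite -exprMn; congr (_ ^+ _); ring.
by rewrite le_eqVlt; apply/orP; left; apply/eqP; ring.
Qed.

(** Compare [gs p] with [gs] at the minimising [q]: moving from [q] to [p] costs [slow q p], which
    [Psi k z q] already pays for up to a constant. *)
Lemma Gk_low k z p : hh k <= Y p <= 4 * hh k -> enorm (z - p) <= 4 * hh k ->
  gs p <= 16 * 208 ^+ m.+1 * Gk k z.
Proof.
move=> /andP[kp pk] zp; have h0 := hh_gt0 k; have p0 := lt_le_trans h0 kp.
have [[q qk ->] _] := HG k z; have q0 := lt_le_trans h0 qk.
apply: le_trans (gs_slow q0 p0) _.
rewrite [leRHS]mulrCA ler_wpM2l // /slow /Psi.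
have r4 : (Y p / Y q) ^+ 2 <= 16.
  have -> : 16 = 4 ^+ 2 :> R by ring.
  apply: lerXn2r; rewrite ?nnegrE ?divr_ge0 ?(ltW p0) ?(ltW q0) //.
  by rewrite ler_pdivrMr //; lra.
rewrite -[leRHS]mulrA -exprMn; apply: ler_pM => //; [exact: sqr_ge0|by apply: exprn_ge0; exact: sqr_ge0|].
have l1 := Psi_arg_ge1 k z q.
apply: lerXn2r; rewrite ?nnegrE ?sqr_ge0 ?mulr_ge0 //; first by rewrite (le_trans ler01).
pose a := enorm (z - q) / hh k.
have a0 : 0 <= a by rewrite divr_ge0 ?enorm_ge0 // ltW.
have -> : hh k ^- 2 * sq (z - q) = a ^+ 2 by rewrite -sqr_enorm /a expr_div_n mulrC.
have e0 := enorm_ge0 (q - p).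
have s0 : 0 <= 3 * enorm (q - p) / Y p by rewrite divr_ge0 ?mulr_ge0 // ltW.
have s1 : 3 * enorm (q - p) / Y p <= 3 * (a + 4).
  rewrite ler_pdivrMr //.
  have t : enorm (q - p) <= (a + 4) * hh k.
    have -> : (a + 4) * hh k = enorm (z - q) + 4 * hh k by rewrite /a; field; exact: lt0r_neq0.
    by have := enorm_tri q z p; rewrite (enormBC q z); lra.
  have : (a + 4) * hh k <= (a + 4) * Y p by rewrite ler_wpM2l //; lra.
  lra.
have h : (1 + 3 * enorm (q - p) / Y p) ^+ 2 <= (1 + 3 * (a + 4)) ^+ 2.
  by apply: lerXn2r; rewrite ?nnegrE; lra.
(* Here [(13 + 3 a) ^ 2 <= 208 (1 + a ^ 2)], from [2 a <= 1 + a ^ 2]. *)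
have := sqr_ge0 (a - 1); nra.
Qed.

End SupKernel.
End Majorants.

Ltac nng := repeat first [assumption | (apply: ltW; assumption) | exact: ler0n | exact: ler01 | exact: sqr_ge0
  | exact: enorm_ge0 | exact: sqrtr_ge0 | exact: expR_ge0
  | (rewrite invr_ge0) | apply: exprn_ge0 | apply: mulr_ge0 | apply: addr_ge0].

(** * Laplacian and variation of the terms [J k] *)

Section Variation.
Context {R : realType} {d : nat}.
Local Notation V := 'rV[R]_d.
Local Notation m := d.+1.
Implicit Types z w p q : V.
Local Notation S := (m.+1%:R : R).
Local Notation CU := (4 * 32 ^+ m.+1 : R).

(** Each derivative costs a factor [(hh k)^-1] but no power of [|z - q|], since with
    [a = |z - q| / hh k] the factor [2 a] is absorbed by [1 + a ^ 2]. *)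
Lemma Psi_jet k z q : exists b L, [/\ jet2 (fun x => Psi k x q) z b L,
  enorm b <= Psi k z q * S / hh k & L <= Psi k z q * (S * d%:R + 4 * S ^+ 2) / hh k ^+ 2].
Proof.
have h0 := hh_gt0 (R := R) k; have X1 := Psi_arg_ge1 k z q.
have jX := jet2D (jet2_cst 1 z) (jet2Z (hh k ^- 2) (jet2_sqB q z)).
have jP := jet2X m.+1 jX.
do 2 eexists; split; first exact: jP.
all: rewrite /Psi /= !add0r.
all: set X := 1 + hh k ^- 2 * sq (z - q) in X1 *.
all: have X0 : 0 < X by rewrite (lt_le_trans ltr01).
all: have Xn n : 0 < X ^+ n by rewrite exprn_gt0.
all: have S0 : 0 <= S by [].
  rewrite !enormZ !ger0_norm ?mulr_ge0 ?invr_ge0 ?exprn_ge0 ?(ltW X0) ?(ltW h0) //.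
  pose a := enorm (z - q) / hh k.
  have Xa : X = 1 + a ^+ 2 by rewrite /X /a -sqr_enorm; field; exact: lt0r_neq0.
  have -> : S * X ^+ m * (hh k ^- 2 * (2 * enorm (z - q))) = S * X ^+ m / hh k * (2 * a).
    by rewrite /a; field; exact: lt0r_neq0.
  have -> : X ^+ m.+1 * S / hh k = S * X ^+ m / hh k * X by rewrite exprS; ring.
  apply: ler_wpM2l; first by have Xm := Xn m; nng.
  by rewrite Xa; have := sqr_ge0 (a - 1); nra.
have -> : sq (hh k ^- 2 *: (2 *: (z - q))) = 4 * hh k ^- 2 * (X - 1).
  by rewrite !sqZ /X; field; exact: lt0r_neq0.
have b2 : 'C(m.+1, 2)%:R <= S ^+ 2.
  have h : ('C(m.+1, 2) <= m.+1 ^ 2)%N.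
    rewrite bin2 expnS expn1; apply: leq_trans (_ : (m.+1 * m.+1.-1)%N <= _)%N.
      by rewrite -{2}[(m.+1 * _)%N]odd_double_half -addnn addnA leq_addl.
    by rewrite leq_mul2l leqnSn orbT.
  by rewrite -natrX ler_nat.
have -> : X ^+ m.+1 * (S * d%:R + 4 * S ^+ 2) / hh k ^+ 2 =
  hh k ^- 2 * (S * X ^+ m * d%:R * X + S ^+ 2 * X ^+ d * 4 * X ^+ 2).
  by rewrite !exprS; ring.
have -> : S * X ^+ m * (hh k ^- 2 * d%:R) + 'C(m.+1, 2)%:R * X ^+ d * (4 * hh k ^- 2 * (X - 1)) =
  hh k ^- 2 * (S * X ^+ m * d%:R * 1 + 'C(m.+1, 2)%:R * X ^+ d * 4 * (X - 1)) by ring.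
apply: ler_wpM2l; first by nng.
apply: lerD.
  by apply: ler_wpM2l => //; have Xm := Xn m; nng.
apply: ler_pM; first by have Xd := Xn d; nng.
- by lra.
- by rewrite ler_wpM2r // ler_wpM2r // ltW.
- by nra.
Qed.

(* The term [sqrt t] makes [J k] strictly superharmonic where [Y z <= hh k]; the decay at
   infinity makes its Laplacian summable over the scales [hh k <= Y z]. *)
Definition psi (t : R) : R := Num.min (1 + Num.sqrt t) (2 / t ^+ 3).
(** The weight of the strictly superharmonic part of [J k], present only on scales at or above the
    height of [z]. *)
Definition wt (t : R) : R := if t <= 1 then Num.sqrt t else 0.

Lemma psi_le1 t : psi t <= 1 + Num.sqrt t.
Proof. by rewrite ge_min lexx. Qed.

Lemma psi_le2 t : psi t <= 2 / t ^+ 3.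
Proof. by rewrite ge_min lexx orbT. Qed.

(** The two branches of the minimum cross at [t = 1], where both equal [2]. *)
Lemma psi_small t : 0 < t <= 1 -> psi t = 1 + Num.sqrt t.
Proof.
move=> /andP[t0 t1]; rewrite /psi min_l //.
have s1 : Num.sqrt t <= 1 by rewrite -[leRHS]sqrtr1 ler_sqrt.
rewrite ler_pdivlMr ?exprn_gt0 //.
have : t ^+ 3 <= 1 by rewrite exprn_ile1 // ltW.
have : 0 < t ^+ 3 by rewrite exprn_gt0.
have := sqrtr_ge0 t; nra.
Qed.

Lemma psi_large t : 1 <= t -> psi t = 2 / t ^+ 3.
Proof.
move=> t1; rewrite /psi min_r //.
have t0 : 0 < t by lra.
have s1 : 1 <= Num.sqrt t by rewrite -[leLHS]sqrtr1 ler_wsqrtr.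
rewrite ler_pdivrMr ?exprn_gt0 //.
have : 1 <= t ^+ 3 by rewrite exprn_ege1.
nra.
Qed.

Lemma psi_ge0 t : 0 < t -> 0 <= psi t.
Proof.
by move=> t0; rewrite le_min; apply/andP; split; nng.
Qed.

Lemma wt_ge0 t : 0 <= wt t.
Proof. by rewrite /wt; case: ifP => // _; exact: sqrtr_ge0. Qed.

Variables (gs : V -> R) (Gk : nat -> V -> R).
Hypothesis gs0 : forall z, 0 <= gs z.
Hypothesis gsl : forall z z', 0 < Y z -> 0 < Y z' -> gs z' <= gs z * slow z z'.
Hypothesis HG : is_infconv gs Gk.
Hypothesis Gup : forall k z, 0 < Y z -> Gk k z <= CU * (1 + hh k / Y z) ^+ 2 * gs z.

Definition J k z : R := Gk k z * psi (Y z / hh k).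

Let Gk0 k z : 0 <= Gk k z := Gk_ge0 gs0 HG k z.

Lemma J_ge0 k z : 0 < Y z -> 0 <= J k z.
Proof. by move=> z0; rewrite mulr_ge0 // psi_ge0 // divr_gt0 // hh_gt0. Qed.

Lemma cts_J k z : 0 < Y z -> continuous_at z (J k).
Proof.
move=> z0; have c1 := @cts_Gk _ _ gs gs0 Gk HG k z; have c2 := @cts_Y R d z; have h0 := hh_gt0 (R := R) k.
have c3 : continuous_at z (fun x => ((Y x / hh k) ^+ 3)^-1).
  by apply: ctsV; [rewrite lt0r_neq0 // exprn_gt0 // divr_gt0|cts_tac].
by rewrite /J /psi; cts_tac.
Qed.

Let D : R := S * d%:R + 4 * S ^+ 2.
Let C1 : R := S + 2 * D.
(** In [J_lap] the first summand serves the scales [Y z <= hh k] and the second the scales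
    [hh k < Y z]; [D] comes from the Laplacian bound of [Psi_jet]. *)
Definition CJ : R := 6 * C1 * CU * (1 + 8 * C1) ^+ 2 + 24 * CU * (6 * d%:R + 48 + 12 * S + 2 * D).

Let D0 : 0 <= D. Proof. by rewrite /D; nng. Qed.
Let C10 : 1 <= C1.
Proof. have : 1 <= S by rewrite ler1n. by rewrite /C1; have := D0; lra. Qed.
Let CU0 : 0 < CU. Proof. by rewrite mulr_gt0 // exprn_gt0. Qed.

Lemma CJ_gt0 : 0 < CJ.
Proof.
have c := C10; have D1 := D0; have d0 : 0 <= d%:R :> R by []; have S0 : 0 <= S by [].
have a0 : 0 < 6 * C1 * CU * (1 + 8 * C1) ^+ 2.
  by apply: mulr_gt0; [apply: mulr_gt0; [lra|exact: CU0]|apply: exprn_gt0; lra].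
have b0 : 0 <= 24 * CU * (6 * d%:R + 48 + 12 * S + 2 * D).
  by apply: mulr_ge0; [have := CU0; lra|lra].
by rewrite /CJ ltr_pwDl.
Qed.

(* [J k] is an infimum of smooth functions, hence touched from above by the one attaining
   it at [z]. *)
Lemma J_lap k z : 0 < Y z -> Y z <= 1 / 4 -> exists F b L,
  [/\ jet2 F z b L, F z = J k z, (forall x, 0 < Y x -> J k x <= F x) &
   Y z ^+ 2 * L <= CJ * mw (Y z / hh k) * gs z - 1 / 4 * wt (Y z / hh k) * Gk k z].
Proof.
move=> z0 z4; have h0 := hh_gt0 (R := R) k; have h1 := hh_le1 (R := R) k.
have [[q qk Eq] Hq] := HG k z.
have [b [L [jP bP LP]]] := Psi_jet k z q.
have q0 := gs0 q.
set t := Y z / hh k; have t0 : 0 < t by rewrite divr_gt0.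
have Yt : Y z = t * hh k by rewrite /t; field; exact: lt0r_neq0.
have jA := jet2Z (gs q) jP.
have A0 := Gk0 k z.
have jt := jet2Z (hh k)^-1 (jet2_Y z).
have bA : enorm (gs q *: b) <= Gk k z * S / hh k.
  rewrite enormZ ger0_norm // Eq -!mulrA ler_wpM2l // !mulrA; exact: bP.
have LA : gs q * L <= Gk k z * D / hh k ^+ 2.
  rewrite Eq -!mulrA ler_wpM2l // !mulrA; exact: LP.
have c := C10; have dpos : 0 <= d%:R :> R by []. have D1 := D0; have S0 : 0 <= S by [].
have ez := enorm_ge0 z; have z1 : enorm z < 1 by rewrite -Y_gt0.
have sz : sq z = 1 - Y z by rewrite /Y; ring.
have G1 : Gk k z <= CU * (1 + t^-1) ^+ 2 * gs z.
  by rewrite /t invf_div; exact: Gup.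
have UB x : 0 < Y x -> forall a, psi (Y x / hh k) <= a -> J k x <= gs q * Psi k x q * a.
  move=> x0 a ha; have [_ /(_ q qk) h] := HG k x.
  by apply: ler_pM; [exact: Gk0|apply: psi_ge0; rewrite divr_gt0|exact: h|exact: ha].
have cu := CU0; have g0 := gs0 z.
case: (leP t 1) => t1.
  have ts : 0 < Num.sqrt t by rewrite sqrtr_gt0.
  have tt : Num.sqrt t ^+ 2 = t by rewrite sqr_sqrtr // ltW.
  have tE : (hh k)^-1 * Y z = t by rewrite mulrC.
  have tpos : 0 < (hh k)^-1 * Y z by rewrite tE.
  have jB := jet2D (jet2_cst 1 z) (jet2_sqrt tpos jt).
  exists (fun x => gs q * Psi k x q * (1 + Num.sqrt ((hh k)^-1 * Y x))).
  do 2 eexists; split; first exact: (jet2M jA jB).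
  - by rewrite /J -/t psi_small ?t0 //= Eq mulrC tE; ring.
  - by move=> x x0; apply: UB => //; rewrite [_ * Y x]mulrC; exact: psi_le1.
  cbv beta; rewrite tE -Eq !add0r /wt t1.
  set A := Gk k z in A0 bA LA G1 *; set s := Num.sqrt t in ts tt *.
  set bA' := gs q *: b in bA *; set LA' := gs q * L in LA *.
  set bB := (2 * s)^-1 *: _.
  have E1 : bB = (- (s * hh k)^-1) *: z.
    by rewrite /bB !scalerA scalerN !scalerA -scaleNr; congr (_ *: z); field; rewrite !lt0r_neq0.
  have hd : Y z ^+ 2 * dot bA' bB <= A * S * (t * s).
    have : dot bA' bB <= (A * S / hh k) * (s * hh k)^-1.
      apply: le_trans (dot_le _ _) _; rewrite E1 [enorm (_ *: z)]enormZ normrN gtr0_norm ?invr_gt0 ?mulr_gt0 //.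
      apply: ler_pM; rewrite ?enorm_ge0 ?mulr_ge0 ?invr_ge0 ?mulr_ge0 ?(ltW ts) ?(ltW h0) //.
      by rewrite ler_piMr ?invr_ge0 ?mulr_ge0 ?(ltW ts) ?(ltW h0) // ltW.
    move=> /(ler_wpM2l (sqr_ge0 (Y z))) /le_trans; apply.
    rewrite le_eqVlt; apply/orP; left; apply/eqP.
    by rewrite Yt -tt; field; rewrite !lt0r_neq0.
  set X := (2 * s)^-1 * _ + _.
  (* Concavity of the square root contributes [- (1 / 2) s |z| ^ 2], and [|z| ^ 2 >= 3 / 4] as
     [Y z <= 1 / 4]. *)
  have hX : Y z ^+ 2 * X <= - (3 / 8) * s.
    have -> : Y z ^+ 2 * X = - (1 / 2) * (s * sq z) - (1 / 2) * (d%:R * (Y z * (t * s ^-1))).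
      rewrite /X !sqZ sqN sqZ; have -> : t * s^-1 = s by rewrite -tt; field; exact: lt0r_neq0.
      by rewrite Yt -tt; field; rewrite !lt0r_neq0.
    have : 0 <= d%:R * (Y z * (t / s)).
      by rewrite mulr_ge0 // mulr_ge0 ?divr_ge0 // ltW.
    have : s * (3 / 4) <= s * sq z by rewrite ler_pM2l // sz; lra.
    lra.
  have hL : Y z ^+ 2 * ((1 + s) * LA') <= A * (2 * D) * (t * s).
    have s1 : s <= 1 by clear -gs0 gsl HG Gup Gk0 D0 C10 CU0 t1 ts tt; nra.
    have LL : (1 + s) * LA' <= 2 * (A * D / hh k ^+ 2).
      have nn : 0 <= A * D / hh k ^+ 2 by rewrite divr_ge0 ?mulr_ge0 // exprn_ge0 // ltW.
      apply: le_trans (_ : (1 + s) * (A * D / hh k ^+ 2) <= _); first by rewrite ler_wpM2l //; lra.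
      by rewrite ler_wpM2r //; lra.
    apply: le_trans (ler_wpM2l (sqr_ge0 (Y z)) LL) _.
    have -> : Y z ^+ 2 * (2 * (A * D / hh k ^+ 2)) = A * (2 * D) * (t * t).
      by rewrite Yt; field; exact: lt0r_neq0.
    by rewrite ler_wpM2l ?mulr_ge0 // ler_pM2l //; clear -gs0 gsl HG Gup Gk0 D0 C10 CU0 s1 ts tt; nra.
  have tot : Y z ^+ 2 * (A * X + dot bA' bB + (1 + s) * LA') <= A * (C1 * (t * s) - 3 / 8 * s).
    have : A * (Y z ^+ 2 * X) <= A * (- (3 / 8) * s) by rewrite ler_wpM2l.
    by rewrite /C1; clear -gs0 gsl HG Gup Gk0 D0 C10 CU0 hd hL; lra.
  apply: le_trans tot _; rewrite -/A.
  have mw0 := mw_small (t := t); rewrite (ltW t0) t1 in mw0; have {}mw0 := mw0 isT.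
  have mwp := mw_ge0 (ltW t0).
  have CJ1 : 6 * C1 * CU * (1 + 8 * C1) ^+ 2 <= CJ.
    by rewrite /CJ lerDl; clear -gs0 gsl HG Gup Gk0 D0 C10 CU0 cu dpos S0 D1; apply: mulr_ge0; lra.
  (* For small [t] the gain [3 / 8] absorbs the error and leaves [1 / 4]. Otherwise [t] is bounded
     below, so [Gk k z] is at most a multiple of [gs z] and the error goes into the [mw] term. *)
  have [small|big] := leP (C1 * t) (1 / 8).
    have : A * (s * (C1 * t)) <= A * (s * (1 / 8)) by rewrite ler_wpM2l // ler_pM2l.
    have cj : 0 < CJ := CJ_gt0.
    have : 0 <= CJ * mw t * gs z by nng.
    lra.
  have ti : 1 + t^-1 <= 1 + 8 * C1.
    by rewrite lerD2l -[t^-1]mul1r ler_pdivrMr //; clear -gs0 gsl HG Gup Gk0 D0 C10 CU0 big; lra.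
  have AG : A <= CU * (1 + 8 * C1) ^+ 2 * gs z.
    apply: le_trans G1 _; rewrite ler_wpM2r // ler_wpM2l ?(ltW cu) //.
    have ti0 : 0 < t^-1 by rewrite invr_gt0.
    by clear -gs0 gsl HG Gup Gk0 D0 C10 CU0 ti ti0 c; apply: lerXn2r; rewrite ?nnegrE; lra.
  have s1 : s <= 1 by clear -gs0 gsl HG Gup Gk0 D0 C10 CU0 t1 ts tt; nra.
  have k1 : A * (C1 * (t * s)) <= CJ * mw t * gs z.
    apply: le_trans (_ : A * (C1 * t) <= _).
      apply: (ler_wpM2l A0); apply: ler_wpM2l; first exact: le_trans ler01 c.
    by rewrite ler_piMr // ltW.
    apply: le_trans (_ : CU * (1 + 8 * C1) ^+ 2 * gs z * (C1 * (6 * mw t)) <= _).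
      have C1p : 0 <= C1 by exact: le_trans ler01 c.
      apply: ler_pM => //; first by nng.
      exact: ler_wpM2l.
    have -> : CU * (1 + 8 * C1) ^+ 2 * gs z * (C1 * (6 * mw t)) =
      6 * C1 * CU * (1 + 8 * C1) ^+ 2 * (mw t * gs z) by ring.
    by rewrite -[leRHS]mulrA ler_wpM2r // mulr_ge0.
  have : 0 <= A * s by rewrite mulr_ge0 // ltW.
  lra.
(* On these scales two derivatives of [Psi] cost [t ^ 2] against [Y z ^ 2]; the cubic decay of [psi]
   leaves a factor [t^-1], summable over scales. *)
have tge1 : 1 <= t by rewrite ltW.
have tE : (hh k)^-1 * Y z = t by rewrite mulrC.
have tpos : (hh k)^-1 * Y z != 0 by rewrite tE lt0r_neq0.
have jB := jet2Z 2 (jet2_comp (F := fun y => y ^- 3) (jet_invX 3 tpos) jt).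
exists (fun x => gs q * Psi k x q * (2 * ((hh k)^-1 * Y x) ^- 3)).
do 2 eexists; split; first exact: (jet2M jA jB).
- by rewrite /J -/t psi_large // Eq tE.
- by move=> x x0; apply: UB => //; rewrite [_ * Y x]mulrC; exact: psi_le2.
have tn : (t <= 1) = false by rewrite leNgt t1.
cbv beta; rewrite tE -Eq /wt tn mulr0 mul0r subr0.
set A := Gk k z in A0 bA LA G1 *.
set bA' := gs q *: b in bA *; set LA' := gs q * L in LA *.
set bB := 2 *: (_ *: (_ *: _)); set X := 2 * (_ + _).
have t30 : 0 < t ^- 4 by rewrite invr_gt0 exprn_gt0.
have E1 : bB = (12 * t ^- 4 / hh k) *: z.
  rewrite /bB !scalerA scalerN !scalerA -scaleNr; congr (_ *: z).
  by field; rewrite !lt0r_neq0.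
have tp n : 0 < t ^- n by rewrite invr_gt0 exprn_gt0.
have tn1 n : t ^- n.+1 <= t^-1.
  rewrite exprS invfM ler_piMr ?invr_ge0 ?(ltW t0) // invf_le1 ?exprn_gt0 // exprn_ege1 //.
have hd : Y z ^+ 2 * dot bA' bB <= A * (12 * S) * t^-1.
  have : dot bA' bB <= (A * S / hh k) * (12 * t ^- 4 / hh k).
    apply: le_trans (dot_le _ _) _.
    have nn : 0 <= 12 * t ^- 4 / hh k.
      by apply: divr_ge0; [have := tp 4%N; lra|exact: ltW].
    rewrite E1 [enorm (_ *: z)]enormZ ger0_norm //.
    apply: ler_pM; [exact: enorm_ge0|exact: mulr_ge0 nn ez|exact: bA|].
    by rewrite ler_piMr // ltW.
  move=> /(ler_wpM2l (sqr_ge0 (Y z))) /le_trans; apply.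
  have -> : Y z ^+ 2 * (A * S / hh k * (12 * t ^- 4 / hh k)) = A * (12 * S) * t ^- 2.
    by rewrite Yt; field; rewrite !lt0r_neq0.
  by rewrite ler_wpM2l // mulr_ge0 // mulr_ge0.
have hX : Y z ^+ 2 * X <= (6 * d%:R + 48) * t^-1.
  have -> : Y z ^+ 2 * X = 6 * d%:R * (hh k * t ^- 2) + 48 * (sq z * t ^- 3).
    rewrite /X !sqZ sqN sqZ.
    by rewrite Yt; field; rewrite !lt0r_neq0.
  have k1 : hh k * t ^- 2 <= t^-1.
    by apply: le_trans (tn1 1%N); rewrite ler_piMl // ltW.
  have k2 : sq z * t ^- 3 <= t^-1.
    apply: le_trans (tn1 2%N); rewrite ler_piMl ?(ltW (tp _)) //; rewrite sz; lra.
  have := ler_wpM2l dpos k1; lra.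
have hL : Y z ^+ 2 * (2 * t ^- 3 * LA') <= A * (2 * D) * t^-1.
  have nn : 0 <= 2 * t ^- 3 by have := tp 3%N; lra.
  apply: le_trans (ler_wpM2l (sqr_ge0 (Y z)) (ler_wpM2l nn LA)) _.
  rewrite le_eqVlt; apply/orP; left; apply/eqP.
  by rewrite Yt; field; rewrite !lt0r_neq0.
have tot : Y z ^+ 2 * (A * X + dot bA' bB + 2 * t ^- 3 * LA') <=
    A * ((6 * d%:R + 48 + 12 * S + 2 * D) * t^-1).
  have := ler_wpM2l A0 hX; clear -gs0 gsl HG Gup Gk0 D0 C10 CU0 hd hL; lra.
apply: le_trans tot _.
have ti : t^-1 <= 1 by rewrite invf_le1.
have ti0 : 0 < t^-1 by rewrite invr_gt0.
have AG : A <= CU * 4 * gs z.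
  apply: le_trans G1 _; rewrite ler_wpM2r // ler_wpM2l ?(ltW cu) //.
  have -> : 4 = 2 ^+ 2 :> R by ring.
  by clear -gs0 gsl HG Gup Gk0 D0 C10 CU0 ti ti0; apply: lerXn2r; rewrite ?nnegrE; lra.
have mw1 := mw_large tge1; have mwp := mw_ge0 (ltW t0).
set Q := 6 * d%:R + 48 + 12 * S + 2 * D.
have Q0 : 0 <= Q by rewrite /Q; clear -gs0 gsl HG Gup Gk0 D0 C10 CU0 dpos S0 D1; lra.
apply: le_trans (_ : CU * 4 * gs z * (Q * (6 * mw t)) <= _).
  by apply: ler_pM => //; [rewrite mulr_ge0 // ltW|rewrite ler_wpM2l].
have -> : CU * 4 * gs z * (Q * (6 * mw t)) = 24 * CU * Q * (mw t * gs z) by ring.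
have CJQ : 24 * CU * Q <= CJ.
  have a0 : 0 <= 6 * C1 * CU * (1 + 8 * C1) ^+ 2.
    by apply: mulr_ge0; [apply: mulr_ge0; [clear -gs0 gsl HG Gup Gk0 D0 C10 CU0 c; lra|exact: ltW]|exact: sqr_ge0].
  by rewrite /CJ -/Q addrC; apply: ler_wpDr.
by rewrite -[leRHS]mulrA; apply: ler_wpM2r => //; exact: mulr_ge0.
Qed.

(** The induction runs with [Q ^+ n - 1]: for [t] in [[0, 1]] the product of [1 + a t] and [1 + b t]
    is at most [1 + (a + b + a b) t]. *)
Lemma pow_lin (r Q t : R) n : 0 <= t <= 1 -> 0 <= r -> 1 <= Q -> r <= 1 + (Q - 1) * t ->
  r ^+ n <= 1 + Q ^+ n * t.
Proof.
move=> /andP[t0 t1] r0 Q1 rQ; suff h : r ^+ n <= 1 + (Q ^+ n - 1) * t by lra.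
elim: n => [|n IH]; first by rewrite !expr0; lra.
have Qn : 1 <= Q ^+ n by rewrite exprn_ege1.
rewrite !exprS; apply: le_trans (_ : (1 + (Q - 1) * t) * (1 + (Q ^+ n - 1) * t) <= _).
  by apply: ler_pM => //; exact: exprn_ge0.
have : 0 <= ((Q - 1) * (Q ^+ n - 1)) * (t * (1 - t)).
  by apply: mulr_ge0; apply: mulr_ge0; lra.
lra.
Qed.

Definition CV (A c : R) : R :=
  let P := ((1 + A) ^+ 2) ^+ m.+1 in let B := 1 + 2 * A in
  P + B + P * B +
  6 * (CU * (1 + c^-1) ^+ 2 * (B ^+ 2 * ((1 + 3 * A / c) ^+ 2) ^+ m.+1) * (2 / c ^+ 3)).

(** The error is expressed through the same two quantities as in [J_lap], which is what allows
    [absorb] to compare the drop of [expR u] with the Laplacian. A mere bound [J k p <= C * J k z]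
    would not do: the main part [Gk k z] of [J k z] is not controlled by the Laplacian, only its
    multiple by [sqrt t]. *)
Lemma J_var A c k z p : 1 <= A -> 0 < c <= 1 -> 0 < Y z -> enorm (p - z) <= A * Y z ->
  c * Y z <= Y p ->
  J k p <= J k z + CV A c * (mw (Y z / hh k) * gs z + wt (Y z / hh k) * Gk k z).
Proof.
move=> A1 /andP[c0 c1] z0 pz Yp; have h0 := hh_gt0 (R := R) k.
have p0 : 0 < Y p by apply: lt_le_trans Yp; exact: mulr_gt0.
have Yp2 : Y p <= (1 + 2 * A) * Y z by have := Y_lip p0 z0; lra.
set t := Y z / hh k; have t0 : 0 < t by rewrite divr_gt0.
set tp := Y p / hh k; have tp0 : 0 < tp by rewrite divr_gt0.
have A0 := Gk0 k z; have A0p := Gk0 k p.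
have mwp := mw_ge0 (ltW t0); have wtp := wt_ge0 t; have g0 := gs0 z.
have tpt : tp <= (1 + 2 * A) * t.
  by rewrite /tp /t mulrA ler_pM2r ?invr_gt0.
have ctp : c * t <= tp by rewrite /tp /t mulrA ler_pM2r ?invr_gt0.
set P := ((1 + A) ^+ 2) ^+ m.+1; set B := 1 + 2 * A in tpt Yp2.
have P0 : 0 <= P by rewrite /P; apply: exprn_ge0; exact: sqr_ge0.
have B0 : 1 <= B by rewrite /B; lra.
set CB := 6 * (CU * (1 + c^-1) ^+ 2 * (B ^+ 2 * ((1 + 3 * A / c) ^+ 2) ^+ m.+1) * (2 / c ^+ 3)).
have cu := CU0.
have CB0 : 0 <= CB.
  have Bp : 0 <= B by lra.
  have ci : 0 <= c^-1 by rewrite invr_ge0 ltW.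
  have cA : 0 <= (1 + 3 * A / c) ^+ 2 by exact: sqr_ge0.
  by rewrite /CB; nng.
have CVE : CV A c = P + B + P * B + CB by [].
have CV1 : P + B + P * B <= CV A c by rewrite CVE; lra.
have PB0 : 0 <= P * B by apply: mulr_ge0 => //; exact: le_trans ler01 B0.
have CV2 : CB <= CV A c by rewrite CVE; lra.
case: (leP t 1) => t1.
  have s0 : 0 < Num.sqrt t by rewrite sqrtr_gt0.
  have tt : Num.sqrt t ^+ 2 = t by rewrite sqr_sqrtr // ltW.
  rewrite {1}/J -/tp {1}/J -/t /wt t1 (@psi_small t) ?t0 //.
  set s := Num.sqrt t in s0 tt *.
  have s1 : s <= 1 by clear -gs0 gsl HG Gup Gk0 D0 C10 CU0 t1 s0 tt; nra.
  have sp : Num.sqrt tp <= B * s.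
    have -> : B * s = Num.sqrt (B ^+ 2 * t) by rewrite sqrtrM ?sqr_ge0 // sqrtr_sqr ger0_norm //; lra.
    rewrite ler_wsqrtr // (le_trans tpt) // ler_wpM2r ?(ltW t0) //; nra.
  have Gp : Gk k p <= Gk k z * (1 + P * t).
    apply: le_trans (Gk_slow gs0 HG k z p) _; apply: ler_wpM2l => //.
    have e0 : 0 <= enorm (p - z) / hh k by apply: divr_ge0; [exact: enorm_ge0|exact: ltW].
    have e1 : enorm (p - z) / hh k <= A * t by rewrite /t mulrA ler_pM2r ?invr_gt0.
    apply: pow_lin; [by rewrite ltW|exact: sqr_ge0|by nra|].
    apply: le_trans (_ : (1 + A * t) ^+ 2 <= _); first by apply: lerXn2r; rewrite ?nnegrE; lra.
    have : 0 <= A ^+ 2 * (t * (1 - t)) by apply: mulr_ge0; [exact: sqr_ge0|apply: mulr_ge0; lra].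
    lra.
  have JP : Gk k p * psi tp <= Gk k z * (1 + P * t) * (1 + B * s).
    apply: ler_pM => //; first exact: psi_ge0.
    by apply: le_trans (psi_le1 _) _; lra.
  apply: le_trans JP _.
  have key : (1 + P * t) * (1 + B * s) <= 1 + s + (P + B + P * B) * s.
    have ts : t <= s by rewrite -tt; clear -gs0 gsl HG Gup Gk0 D0 C10 CU0 s1 s0; nra.
    have k1 : P * t <= P * s by rewrite ler_wpM2l.
    have k2 : P * t * (B * s) <= P * (B * s).
      have Bs : 0 <= B * s by apply: mulr_ge0; lra.
      by rewrite ler_wpM2r //; rewrite ler_piMr.
    lra.
  have k3 := ler_wpM2l A0 key.
  have k4 : (P + B + P * B) * (s * Gk k z) <= CV A c * (s * Gk k z).
    by rewrite ler_wpM2r // mulr_ge0 // ltW.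
  have k5 : 0 <= CV A c * (mw t * gs z).
    by apply: mulr_ge0; [exact: le_trans CB0 CV2|exact: mulr_ge0].
  lra.
have J0 := J_ge0 k z0.
have ti : t^-1 <= 6 * mw t by apply: mw_large; exact: ltW.
have ti0 : 0 < t^-1 by rewrite invr_gt0.
have ct : c <= tp by apply: le_trans ctp; rewrite ler_pMr // ltW.
have Gp : Gk k p <= CU * (1 + c^-1) ^+ 2 * gs p.
  apply: le_trans (Gup k p0) _; apply: ler_wpM2r => //; apply: ler_wpM2l; first exact: ltW.
  have h : hh k / Y p = tp^-1 by rewrite /tp invf_div.
  have tpi : 0 < tp^-1 by rewrite invr_gt0.
  have tpc : tp^-1 <= c^-1 by rewrite lef_pV2.
  by rewrite h; apply: lerXn2r; rewrite ?nnegrE ?lerD2l // addr_ge0 // invr_ge0 ltW.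
have gp : gs p <= gs z * (B ^+ 2 * ((1 + 3 * A / c) ^+ 2) ^+ m.+1).
  apply: le_trans (gsl z0 p0) _; apply: ler_wpM2l => //; rewrite /slow.
  have e0 : 0 <= 3 * enorm (z - p) / Y p.
    by apply: divr_ge0; [apply: mulr_ge0 => //; exact: enorm_ge0|exact: ltW].
  have e1 : 3 * enorm (z - p) / Y p <= 3 * A / c.
    rewrite ler_pdivrMr // mulrAC ler_pdivlMr // enormBC.
    have := ler_wpM2r (ltW c0) pz; have : A * (c * Y z) <= A * Y p by rewrite ler_wpM2l //; lra.
    lra.
  apply: ler_pM; [exact: sqr_ge0|by apply: exprn_ge0; exact: sqr_ge0| |].
    apply: lerXn2r; rewrite ?nnegrE; [apply: divr_ge0; exact: ltW|lra|].
    by rewrite ler_pdivrMr.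
  apply: lerXn2r; rewrite ?nnegrE; [exact: sqr_ge0|exact: sqr_ge0|].
  by apply: lerXn2r; rewrite ?nnegrE ?lerD2l // addr_ge0 // (le_trans e0).
have pp : psi tp <= 2 / c ^+ 3 * t^-1.
  apply: le_trans (psi_le2 _) _.
  have ct0 : 0 < c * t by exact: mulr_gt0.
  have -> : 2 / c ^+ 3 * t^-1 = 2 * (c ^+ 3 * t)^-1 by field; rewrite !lt0r_neq0.
  have c3 : 0 < c ^+ 3 by exact: exprn_gt0.
  have ct3 : 0 < c ^+ 3 * t by exact: mulr_gt0.
  have tp3 : 0 < tp ^+ 3 by exact: exprn_gt0.
  have h1 : c ^+ 3 * t <= (c * t) ^+ 3.
    by rewrite exprMn; apply: ler_wpM2l; [exact: ltW|rewrite ler_eXnr // ltW].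
  have h2 : (c * t) ^+ 3 <= tp ^+ 3.
    by apply: lerXn2r => //; rewrite nnegrE ltW.
  have h3 : (tp ^+ 3)^-1 <= (c ^+ 3 * t)^-1 by rewrite lef_pV2 // (le_trans h1).
  by apply: ler_wpM2l.
have JP : Gk k p * psi tp <= CB * (mw t * gs z).
  apply: le_trans (_ : CU * (1 + c^-1) ^+ 2 * (gs z * (B ^+ 2 * ((1 + 3 * A / c) ^+ 2) ^+ m.+1)) *
     (2 / c ^+ 3 * (6 * mw t)) <= _); last first.
    by rewrite /CB le_eqVlt; apply/orP; left; apply/eqP; ring.
  apply: ler_pM => //; [exact: psi_ge0| |].
    apply: le_trans Gp _; apply: ler_wpM2l => //.
    by apply: mulr_ge0; [exact: ltW|exact: sqr_ge0].
  apply: le_trans pp _; apply: ler_wpM2l => //.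
  by apply: divr_ge0 => //; apply: exprn_ge0; exact: ltW.
have k4 : CB * (mw t * gs z) <= CV A c * (mw t * gs z).
  by rewrite ler_wpM2r // mulr_ge0.
have k5 : 0 <= CV A c * (wt t * Gk k z).
  by apply: mulr_ge0; [exact: le_trans CB0 CV2|exact: mulr_ge0].
by rewrite {1}/J -/tp; lra.
Qed.

End Variation.

(** * The minimum principle *)

Ltac pos := repeat first [assumption | exact: ltr01 | exact: ltr0Sn | exact: expR_gt0
  | (rewrite invr_gt0) | apply: exprn_gt0 | apply: mulr_gt0].

Section NearGeometry.
Context {R : realType} {d : nat}.
Local Notation V := 'rV[R]_d.
Local Notation et := (@sepc R d).
Implicit Types z w p : V.

Lemma sepc_le : et <= 1 / 6.
Proof.
rewrite /sepc mul1r lef_pV2 ?posrE ?mulr_gt0 // ?ltr_wpDl //.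
by have : 0 <= d%:R :> R by []; lra.
Qed.

(** When the separation condition of [kap_lap] fails, [w] lies in a hyperbolic ball about [z]; this
    follows by bounding [T z w] below by [|z - w| ^ 2], by [Y w ^ 2] and by [Y z ^ 2 / 5]. *)
Lemma near_facts z w : 0 < Y z -> 0 < Y w -> et * T z w < Y z * Y w ->
  [/\ enorm (w - z) <= Y z / et, et * Y z / 5 <= Y w & Y w <= Y z / et].
Proof.
move=> z0 w0 nr; have e0 := @sepc_gt0 R d; have T0 := T_gt0 z w0.
have h1 := T_ge_sq z w; have h2 := T_geYw z w; have h3 := T_geYz z0 w0.
have k1 : et * Y w ^+ 2 < Y z * Y w by apply: le_lt_trans nr; rewrite ler_pM2l.
have k2 : et * Y w < Y z.
  by rewrite -(ltr_pM2r w0) -mulrA -expr2.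
have k3 : et * Y z ^+ 2 < 5 * (Y z * Y w).
  apply: le_lt_trans (_ : 5 * (et * T z w) < _); last by rewrite ltr_pM2l.
  by have := ler_wpM2l (ltW e0) h3; lra.
have k4 : et * Y z < 5 * Y w.
  by rewrite -(ltr_pM2r z0) -mulrA -expr2; lra.
have wy : Y w <= Y z / et by rewrite ler_pdivlMr // mulrC ltW.
split => //; last by lra.
rewrite enorm_le; last by rewrite divr_ge0 // ltW.
rewrite sqBC expr_div_n ler_pdivlMr ?exprn_gt0 //.
have k5 : et * sq (z - w) <= Y z * Y w.
  by apply: le_trans (ltW nr); rewrite ler_pM2l.
have : et * (et * sq (z - w)) <= Y z * (et * Y w).
  by have := ler_wpM2l (ltW e0) k5; lra.
have : Y z * (et * Y w) <= Y z * Y z by rewrite ler_pM2l // ltW.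
by move=> h h'; rewrite [Y z ^+ 2]expr2; lra.
Qed.

(** Provides the tube required by [harnack_segment]. On the segment [Y] is at least [et * Y z / 5],
    and by [Y_near] the radius [et * Y z / 30] costs [et * Y z / 10]. *)
Lemma near_tube z w (t : R) x : 0 < Y z -> 0 < Y w -> et * T z w < Y z * Y w ->
  0 <= t <= 1 -> enorm (x - (z + t *: (w - z))) <= et * Y z / 30 ->
  enorm (x - z) <= 2 / et * Y z /\ et / 10 * Y z <= Y x.
Proof.
move=> z0 w0 nr t01 xp; have e0 := @sepc_gt0 R d; have e6 := sepc_le.
have [wz wy _] := near_facts z0 w0 nr.
have Y1 := Y_le1 z.
have ey : 0 < et * Y z by rewrite mulr_gt0.
have ey1 : et * Y z <= 1 / 6 by have := ler_pM (ltW e0) (ltW z0) e6 Y1; lra.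
set p := z + t *: (w - z) in xp.
have Yp : et * Y z / 5 <= Y p.
  apply: le_trans (Y_segment z w t01); rewrite le_min wy andbT.
  have : et * Y z <= 1 * Y z by rewrite ler_pM2r //; lra.
  by rewrite mul1r; have := z0; lra.
have p0 : 0 < Y p by apply: lt_le_trans Yp; lra.
split; last first.
  have := @Y_near R d p x (et * Y z / 30) p0; have -> : 0 <= et * Y z / 30 <= 1 by apply/andP; split; lra.
  by move=> /(_ isT xp); lra.
have pz : enorm (p - z) <= Y z / et.
  have -> : p - z = t *: (w - z) by rewrite /p addrC addKr.
  have /andP[tt0 tt1] := t01; rewrite enormZ ger0_norm //.
  by apply: le_trans wz; rewrite ler_piMl // enorm_ge0.
have : et * Y z <= Y z / et.
  rewrite ler_pdivlMr // mulrAC -[leRHS]mul1r ler_pM2r //.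
  by have := ler_pM (ltW e0) (ltW e0) e6 e6; lra.
have := enorm_tri x p z; lra.
Qed.

Lemma kap_le5 z w : 0 < Y z -> 0 < Y w -> kap z w <= 5.
Proof.
move=> z0 w0; have T0 := T_gt0 z w0; rewrite kapE ler_pdivrMr ?exprn_gt0 // exprS mulrA.
apply: ler_pM; [exact: sqr_ge0|by apply: exprn_ge0; exact: sqr_ge0|exact: T_geYz|].
by apply: lerXn2r; rewrite ?nnegrE ?sqr_ge0 ?(ltW T0) // T_geYw.
Qed.

End NearGeometry.

Section NoMinimum.
Context {R : realType} {d : nat}.
Local Notation V := 'rV[R]_d.
Local Notation m := d.+1.
Local Notation et := (@sepc R d).
Local Notation Ap := (2 / et).
Local Notation cp := (et / 10).
Implicit Types z w p : V.

(** The bound from [v_cmp] for the ratio [expR (u z) / expR (u p)] with [p] in the neighbourhood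
    described by [Ap] and [cp]. *)
Definition Kv : R := 288 * expR 1 * ((Ap ^+ 2 + 1) / cp).

Lemma Kv_gt0 : 0 < Kv.
Proof.
have e0 := @sepc_gt0 R d; have ee : 0 < expR 1 :> R := expR_gt0 _.
have A0 : 0 < Ap by rewrite divr_gt0.
rewrite /Kv; apply: mulr_gt0; first by lra.
by apply: divr_gt0; [rewrite ltr_wpDl // sqr_ge0|lra].
Qed.

(* If [expR u] drops by at most [e] on a hyperbolic ball, then [u] plus a small constant is
   positive there and Harnack's inequality bounds its gradient. *)
Lemma near_grad : exists2 C : R, 0 < C &
  forall (u : V -> R) (G : V -> V) (M : R) z e,
  hfun [set z | 0 < Y z] u G -> (forall z, 0 < Y z -> enorm (G z) * Y z <= M) -> M <= 1 ->
  0 < Y z -> 0 <= e ->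
  (forall p, enorm (p - z) <= Ap * Y z -> cp * Y z <= Y p -> expR (u z) - e <= expR (u p)) ->
  forall w, 0 < Y w -> et * T z w < Y z * Y w -> gg u G w <= C * e.
Proof.
have [CH CH0 HH] := @harnack_segment R d.
have e0 := @sepc_gt0 R d; have kv := Kv_gt0.
exists ((1 / et) * (288 * expR 1 * (1 / et)) *
  (CH * (30 / et) * expR (CH * (30 / et ^+ 2))) * Kv).
  by pos.
move=> u G M z e hu hM M1 z0 e0' He w w0 nr.
have [wz wy wy2] := near_facts z0 w0 nr.
set v := fun x => expR (u x).
have vp x : 0 < v x := expR_gt0 _.
(* A drop of [expR u] by [e] lowers [u] by at most [e / v p <= k], because [1 + x <= expR x]. So
   [u + (k - u z)] is nonnegative on the tube and equals [k] at [z]. *)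
pose k := Kv * e / v z.
have k0 : 0 <= k by apply: divr_ge0; [apply: mulr_ge0 => //; exact: ltW|exact: ltW].
have low p : enorm (p - z) <= Ap * Y z -> cp * Y z <= Y p -> 0 <= u p + (k - u z).
  move=> pz Yp.
  have p0 : 0 < Y p by apply: lt_le_trans Yp; pos.
  have c1 := v_cmp hu hM M1 p0 z0; rewrite -/(v z) -/(v p) in c1.
  have Tr : T p z / (Y p * Y z) <= (Ap ^+ 2 + 1) / cp.
    rewrite ler_pdivrMr ?mulr_gt0 //.
    have t1 : T p z <= (Ap ^+ 2 + 1) * Y z ^+ 2.
      have : sq (p - z) <= (Ap * Y z) ^+ 2.
        by rewrite -enorm_le // mulr_ge0 ?divr_ge0 // ltW.
      by rewrite exprMn /T; lra.
    apply: le_trans t1 _.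
    have -> : (Ap ^+ 2 + 1) / cp * (Y p * Y z) = (Ap ^+ 2 + 1) * (Y z * (Y p / cp)).
      by field; rewrite !lt0r_neq0.
    rewrite expr2 ler_wpM2l ?addr_ge0 ?sqr_ge0 // ler_wpM2l ?(ltW z0) //.
    by rewrite ler_pdivlMr ?divr_gt0 // mulrC.
  have vzp : v z <= Kv * v p.
    apply: le_trans c1 _; apply: ler_wpM2r; first exact: ltW.
    by rewrite /Kv; apply: ler_wpM2l; [nng|exact: Tr].
  have h := He p pz Yp; rewrite -/(v z) -/(v p) in h.
  have ex : 1 + (u z - u p) <= v z / v p.
    by rewrite /v -expRN -expRD; exact: expR_ge1Dx.
  have h2 : v z / v p - 1 <= e / v p.
    have -> : v z / v p - 1 = (v z - v p) / v p by field; exact: lt0r_neq0.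
    by rewrite ler_pM2r ?invr_gt0 //; lra.
  have h3 : e / v p <= k.
    rewrite /k ler_pdivrMr // mulrAC ler_pdivlMr // -mulrA [Kv * _]mulrC -mulrA ler_wpM2l //.
    by rewrite [v p * _]mulrC.
  by lra.
have hU := hfunDc (k - u z) hu.
have rho0 : 0 < et * Y z / 30 by rewrite divr_gt0 // mulr_gt0.
have HG := HH [set z | 0 < Y z] (fun x => u x + (k - u z)) G z w (et * Y z / 30) rho0 hU.
have {}HG : enorm (G w) <= CH / (et * Y z / 30) * expR (CH * enorm (w - z) / (et * Y z / 30)) * k.
  have -> : k = u z + (k - u z) by rewrite addrCA subrr addr0.
  apply: HG => t x t01 xp; have [h1 h2] := near_tube z0 w0 nr t01 xp.
  split; last exact: low.
  by rewrite /=; apply: lt_le_trans h2; rewrite mulr_gt0 // divr_gt0.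
have expo : expR (CH * enorm (w - z) / (et * Y z / 30)) <= expR (CH * (30 / et ^+ 2)).
  rewrite ler_expR -mulrA ler_wpM2l ?(ltW CH0) //.
  rewrite ler_pdivrMr //; have -> : 30 / et ^+ 2 * (et * Y z / 30) = Y z / et.
    by field; exact: lt0r_neq0.
  exact: wz.
have {}HG : Y z * enorm (G w) <= CH * (30 / et) * expR (CH * (30 / et ^+ 2)) * k.
  have h := ler_wpM2l (ltW z0) HG; apply: le_trans h _.
  set X1 := expR (CH * enorm _ / _) in expo *; set X2 := expR _ in expo *.
  have -> : Y z * (CH / (et * Y z / 30) * X1 * k) = CH * (30 / et) * k * X1.
    by field; rewrite !lt0r_neq0.
  rewrite [leRHS]mulrAC; apply: ler_wpM2l; last exact: expo.
  by nng.
have vw : v w <= 288 * expR 1 * (1 / et) * v z.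
  have c1 := v_cmp hu hM M1 z0 w0; rewrite -/(v z) -/(v w) in c1.
  apply: le_trans c1 _; apply: ler_wpM2r; first exact: ltW.
  apply: ler_wpM2l; first by nng.
  rewrite ler_pdivrMr ?mulr_gt0 // mulrAC ler_pdivlMr // mul1r mulrC; exact: ltW.
rewrite /gg -/(v w).
apply: le_trans (_ : (1 / et * Y z) * (288 * expR 1 * (1 / et) * v z) * enorm (G w) <= _).
  apply: ler_wpM2r; first exact: enorm_ge0.
  apply: ler_pM; [exact: ltW|exact: ltW|by rewrite mul1r mulrC|exact: vw].
have -> : 1 / et * Y z * (288 * expR 1 * (1 / et) * v z) * enorm (G w) =
  1 / et * (288 * expR 1 * (1 / et)) * v z * (Y z * enorm (G w)) by ring.
have -> : 1 / et * (288 * expR 1 * (1 / et)) * (CH * (30 / et) * expR (CH * (30 / et ^+ 2))) * Kv * e =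
  1 / et * (288 * expR 1 * (1 / et)) * v z * (CH * (30 / et) * expR (CH * (30 / et ^+ 2)) * k).
  by rewrite /k; field; rewrite !lt0r_neq0.
have vz0 := vp z; by apply: ler_wpM2l; [nng|exact: HG].
Qed.

(** Of the [2 B a] available, [B a / 2] pays for [dl * CJ' * a] and at most [B a / 4] for the share
    of [e]; [W] and [s] pay for their own shares. Strictness comes from [s], since [a] and [W] may
    vanish. *)
Lemma absorb (B dl CJ' kp Ce a W s e X : R) : 0 < B -> 0 <= dl -> dl <= B -> dl * CJ' <= B / 2 ->
  0 <= kp -> kp * Ce <= 1 / 8 -> 0 <= a -> 0 <= W -> 0 < s ->
  e <= Ce * (dl * a + dl * W + s + B * a) ->
  X <= kp * e + dl * (CJ' * a - 1 / 4 * W) - 3 / 8 * s - 2 * B * a -> X < 0.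
Proof.
move=> B0 d0 dB dC k0 kC a0 W0 s0 eC XX.
have da : dl * a <= B * a by rewrite ler_wpM2r.
have dca : dl * CJ' * a <= B / 2 * a by rewrite ler_wpM2r.
have Ba : 0 <= B * a by rewrite mulr_ge0 // ltW.
have dW : 0 <= dl * W by rewrite mulr_ge0.
have da0 : 0 <= dl * a by rewrite mulr_ge0.
have ke : kp * e <= 1 / 8 * (dl * a + dl * W + s + B * a).
  apply: le_trans (ler_wpM2l k0 eC) _; rewrite mulrA ler_wpM2r //; lra.
lra.
Qed.

Definition ff (dl B E : R) (u : V -> R) (gs : V -> R) (Gk : nat -> V -> R) n x : R :=
  expR (u x) + dl * (\sum_(k < n) J Gk k x) + E * Num.sqrt (Y x) - B * gs x.

End NoMinimum.

Section MinimumPoint.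
Context {R : realType} {d : nat}.
Local Notation V := 'rV[R]_d.
Local Notation m := d.+1.
Local Notation et := (@sepc R d).
Local Notation Ap := (2 / et).
Local Notation cp := (et / 10).
Implicit Types z w p : V.

Lemma no_min : exists dl B M0 : R,
  [/\ 0 < dl, 0 < B, 0 < M0, M0 <= 1 & B * (864 * expR 1 * M0) <= 1] /\
  forall (u : V -> R) (G : V -> V) (M r0 E : R) gs Gk n z,
  hfun [set z | 0 < Y z] u G -> (forall z, 0 < Y z -> enorm (G z) * Y z <= M) -> M <= M0 ->
  0 < r0 -> (forall z, 0 <= gs z) -> is_majorant (gg u G) r0 gs -> is_infconv gs Gk ->
  0 < E -> 0 < Y z -> (4 + 2 * d%:R) * Y z <= 1 -> r0 <= cp * Y z ->
  ~ (forall x, r0 <= Y x -> ff dl B E u gs Gk n z <= ff dl B E u gs Gk n x).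
Proof.
have [C1 C10 HC1] := @near_grad R d.
have e0 := @sepc_gt0 R d; have e6 := @sepc_le R d.
have cj := @CJ_gt0 R d.
pose C5 : R := 10 * (d%:R + 3) ^+ 2; pose C6 := 5 * (C5 + 2) * C1.
pose CVc := @CV R d Ap cp; pose B1 := 1 + 2 * Ap; pose Ce := CVc + B1 + 1.
have C50 : 0 <= C5 by rewrite /C5; nng.
have C60 : 0 < C6 by rewrite /C6; apply: mulr_gt0 => //; lra.
have Ap1 : 1 <= Ap by rewrite ler_pdivlMr //; lra.
have cp01 : 0 < cp <= 1 by apply/andP; split; lra.
have CV0 : 0 <= CVc.
  have ci : 0 <= cp^-1 by rewrite invr_ge0; case/andP: cp01 => /ltW.
  have A0 : 0 <= Ap by lra.
  have q0 : 0 <= cp by case/andP: cp01 => /ltW.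
  by rewrite /CVc /CV; nng.
have B10 : 1 <= B1 by rewrite /B1; lra.
have Ce0 : 0 < Ce by rewrite /Ce; lra.
(* [B] and [M0] each limit one part of the coefficient of [e] to [1 / 16] after multiplication by
   [Ce]; together they meet the threshold [1 / 8] of [absorb]. *)
pose B := (16 * C6 * Ce)^-1.
have B0 : 0 < B by rewrite /B; pos.
pose M0 := Num.min 1 (Num.min (8 * C1 * Ce)^-1 (B * (864 * expR 1))^-1).
pose dl := Num.min B (B / (2 * @CJ R d)).
have M00 : 0 < M0.
  rewrite /M0 !lt_min ltr01 /=; apply/andP; split; by pos.
exists dl, B, M0; split.
  split; [|exact: B0|exact: M00| |].
  - by rewrite /dl lt_min B0 /=; pos.
  - by rewrite /M0 ge_min lexx.
  - rewrite mulrA mulrC -ler_pdivlMr; last by pos.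
    by rewrite /M0 !ge_min mul1r lexx !orbT.
move=> u G M r0 E gs Gk n z hu hM MM r00 gs0 Hgs HG E0 z0 zs rz Hmin.
have M1 : M <= 1 by apply: le_trans MM _; rewrite /M0 ge_min lexx.
have Mp : 0 <= M by apply: le_trans (hM z z0); apply: mulr_ge0; [exact: enorm_ge0|exact: ltW].
have dpos : 0 <= d%:R :> R by exact: ler0n.
have z4 : Y z <= 1 / 4 by have := mulr_ge0 dpos (ltW z0); move: zs; clear; lra.
have gpos w : 0 < Y w -> 0 <= gg u G w by exact: gg_ge0.
have gsl z1 z2 : 0 < Y z1 -> 0 < Y z2 -> gs z2 <= gs z1 * slow z1 z2.
  exact: (gs_slow r00 gpos Hgs).
have Gup k x : 0 < Y x -> Gk k x <= 4 * 32 ^+ m.+1 * (1 + hh k / Y x) ^+ 2 * gs x.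
  exact: (Gk_up r00 gpos Hgs gs0 HG).
set a := gs z; have a0 : 0 <= a := gs0 z.
pose W := \sum_(k < n) wt (Y z / hh k) * Gk k z.
have W0 : 0 <= W.
  by apply: sumr_ge0 => k _; apply: mulr_ge0; [exact: wt_ge0|exact: (Gk_ge0 gs0 HG)].
pose s := E * Num.sqrt (Y z).
have s0 : 0 < s by rewrite mulr_gt0 // sqrtr_gt0.
have dl0 : 0 < dl by rewrite /dl lt_min B0 /=; pos.
have dlB : dl <= B by rewrite /dl ge_min lexx.
have dlC : dl * @CJ R d <= B / 2.
  apply: le_trans (_ : B / (2 * @CJ R d) * @CJ R d <= _).
    by apply: ler_wpM2r; [exact: ltW|rewrite /dl ge_min lexx orbT].
  by rewrite le_eqVlt; apply/orP; left; apply/eqP; field; exact: lt0r_neq0.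
(* The total gain of the other terms between [z] and a nearby [p]: [J_var] for the first, [B1] for
   the growth of [sqrt Y], and [B * a] because [- B * gs p <= 0]. *)
pose e := dl * CVc * (a + W) + B1 * s + B * a.
have ep : 0 <= e.
  by have dl0' := ltW dl0; have B0' := ltW B0; have s0' := ltW s0; rewrite /e; nng; lra.
have smw : \sum_(k < n) mw (Y z / hh k) <= 1 by exact: sum_mw.
(* minimality bounds the drop of [u] over a whole hyperbolic neighbourhood *)
have He p : enorm (p - z) <= Ap * Y z -> cp * Y z <= Y p -> expR (u z) - e <= expR (u p).
  move=> pz Yp.
  have p0 : 0 < Y p by apply: lt_le_trans Yp; apply: mulr_gt0 => //; case/andP: cp01.
  have := Hmin p (le_trans rz Yp); rewrite /ff.
  have hJ : \sum_(k < n) J Gk k p <= \sum_(k < n) J Gk k z + CVc * (a + W).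
    apply: le_trans (_ : \sum_(k < n) (J Gk k z + CVc * (mw (Y z / hh k) * a + wt (Y z / hh k) * Gk k z)) <= _).
      by apply: ler_sum => k _; exact: (J_var gs0 gsl HG Gup k Ap1 cp01 z0 pz Yp).
    rewrite big_split /= lerD2l -mulr_sumr; apply: ler_wpM2l => //.
    by rewrite big_split /= -/W lerD2r -mulr_suml ler_piMl.
  have hJ' := ler_wpM2l (ltW dl0) hJ.
  have hY : E * Num.sqrt (Y p) <= B1 * s.
    rewrite /s mulrCA; apply: ler_wpM2l; first exact: ltW.
    have -> : B1 * Num.sqrt (Y z) = Num.sqrt (B1 ^+ 2 * Y z).
      by rewrite sqrtrM ?sqr_ge0 // sqrtr_sqr ger0_norm // (le_trans ler01).
    apply: ler_wsqrtr; have := Y_lip p0 z0 => h.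
    have h1 : Y p <= B1 * Y z by rewrite /B1; move: h pz; clear; lra.
    by apply: le_trans h1 _; apply: ler_wpM2r; [exact: ltW|rewrite expr2 ler_peMl // (le_trans ler01)].
  have : 0 <= B * gs p by apply: mulr_ge0 => //; exact: ltW.
  by rewrite /e -/a -/s; move: hJ' hY; clear -s0; lra.
have grad w : 0 < Y w -> et * T z w < Y z * Y w -> gg u G w <= C1 * e.
  exact: (HC1 u G M z e hu hM M1 z0 ep He w).
have [_ ju _] := hu z z0; have jv := jet2_exp ju.
have gz : gg u G z <= C1 * e.
  apply: grad => //; rewrite /T subrr sq0 add0r expr2 -[ltRHS]mul1r ltr_pM2r ?mulr_gt0 //; move: e6; clear; lra.
(* Up to the factor [1 / 2] this is [|G z| * Y z] times [gg u G z]; the first factor brings in the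
   small [M], the second is at most [C1 * e]. *)
have Lv : Y z ^+ 2 * (expR (u z) * 0 + expR (u z) / 2 * sq (G z)) <= 1 / 2 * M * C1 * e.
  have -> : Y z ^+ 2 * (expR (u z) * 0 + expR (u z) / 2 * sq (G z)) =
    1 / 2 * ((enorm (G z) * Y z) * gg u G z).
    by rewrite /gg -sqr_enorm; field.
  have : (enorm (G z) * Y z) * gg u G z <= M * (C1 * e).
    apply: ler_pM => //; [apply: mulr_ge0; [exact: enorm_ge0|exact: ltW]|exact: gpos|exact: hM].
  by clear; lra.
have /choice[f Hf] : forall k : nat, exists p : (V -> R) * V * R,
  [/\ jet2 p.1.1 z p.1.2 p.2, p.1.1 z = J Gk k z, (forall x, 0 < Y x -> J Gk k x <= p.1.1 x) &
   Y z ^+ 2 * p.2 <= @CJ R d * mw (Y z / hh k) * gs z - 1 / 4 * wt (Y z / hh k) * Gk k z].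
  move=> k; have [F [b [L HF]]] := J_lap gs0 HG Gup k z0 z4.
  by exists (F, b, L).
have jJ := @jet2_sum R d 'I_n (index_enum _) (fun k => (f k).1.1) z (fun k => (f k).1.2)
   (fun k => (f k).2) (fun k => let: And4 h _ _ _ := Hf k in h).
have LJ : Y z ^+ 2 * (\sum_(k < n) (f k).2) <= @CJ R d * a - 1 / 4 * W.
  rewrite mulr_sumr.
  apply: le_trans (_ : \sum_(k < n) (@CJ R d * a * mw (Y z / hh k) - 1 / 4 * (wt (Y z / hh k) * Gk k z)) <= _).
    by apply: ler_sum => k _; have [_ _ _ h] := Hf k; rewrite -/a in h; clear -h; lra.
  rewrite sumrB -!mulr_sumr -/W lerD2r ler_piMr //; apply: mulr_ge0 => //; exact: ltW.
have jY := jet2_sqrt z0 (jet2_Y z).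
set r := Num.sqrt (Y z) in jY; have r1 : 0 < r by rewrite sqrtr_gt0.
have rr : Y z = r ^+ 2 by rewrite sqr_sqrtr // ltW.
set LY := (2 * r)^-1 * _ + _ in jY.
have hLY : Y z ^+ 2 * (E * LY) <= - (3 / 8) * s.
  have -> : Y z ^+ 2 * (E * LY) = - (1 / 2) * (s * (1 - Y z)) - 1 / 2 * (d%:R * (s * Y z)).
    have sz : sq z = 1 - r ^+ 2 by rewrite -rr /Y; ring.
    by rewrite /LY sqN sqZ sz /s -/r rr; field; exact: lt0r_neq0.
  have : 0 <= d%:R * (s * Y z) by apply: mulr_ge0 => //; apply: mulr_ge0; exact: ltW.
  have : s * (3 / 4) <= s * (1 - Y z) by rewrite ler_pM2l //; move: z4; clear; lra.
  by clear; lra.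
have [[w wr aw] _] := Hgs z z0; have w0 := lt_le_trans r00 wr; rewrite -/a in aw.
have [bk [Lk [jk k1 k2]]] := kap_lap z0 zs w0.
have gw := gpos w w0.
(* For [w] far from [z] the kernel is strictly subharmonic and yields [- 2 B a]. For [w] near [z]
   one has [a <= 5 C1 e], so both the Laplacian error [C5 a] and the missing [2 a] are charged to
   [e]. *)
have hK : - (B * (gg u G w * (Y z ^+ 2 * Lk))) <= B * C6 * e - 2 * B * a.
  have [far|near] := leP (Y z * Y w) (et * T z w).
    have h := ler_wpM2l gw (k2 far); rewrite mulrCA -aw in h.
    have h' := ler_wpM2l (ltW B0) h.
    have : 0 <= B * C6 * e by apply: mulr_ge0 => //; apply: mulr_ge0; exact: ltW.
    by clear -h'; lra.
  have h := ler_wpM2l gw k1; rewrite mulrCA -aw in h.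
  have ga := grad w w0 near.
  have a5 : a <= C1 * e * 5.
    by rewrite aw; apply: ler_pM => //; [apply/ltW/kap_gt0|exact: kap_le5].
  have h' := ler_wpM2l (ltW B0) h.
  have a6 : B * ((C5 + 2) * a) <= B * ((C5 + 2) * (C1 * e * 5)).
    by apply: ler_wpM2l; [exact: ltW|apply: ler_wpM2l => //; exact: addr_ge0].
  by rewrite /C6; clear -h' a6; rewrite -/C5 in h'; lra.
have jF := jet2B (jet2D (jet2D jv (jet2Z dl jJ)) (jet2Z E jY)) (jet2Z B (jet2Z (gg u G w) jk)).
have pos := jet2_min jF _.
have {}pos := mulr_ge0 (sqr_ge0 (Y z)) (pos _).
have : Y z ^+ 2 * (expR (u z) * 0 + expR (u z) / 2 * sq (G z) + dl * (\sum_(k < n) (f k).2) +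
   E * LY - B * (gg u G w * Lk)) < 0.
  apply: (absorb (B:=B) (dl:=dl) (CJ':=@CJ R d) (kp:=1 / 2 * M * C1 + B * C6) (Ce:=Ce) (a:=a) (W:=W) (s:=s) (e:=e)) => //.
  - exact: ltW.
  - by apply: addr_ge0; nng; apply: ltW.
  - have t1 : B * C6 * Ce = 1 / 16 by rewrite /B; field; rewrite !lt0r_neq0.
    have t2 : 1 / 2 * M * C1 * Ce <= 1 / 16.
      have : M <= (8 * C1 * Ce)^-1 by apply: le_trans MM _; rewrite /M0 !ge_min lexx orbT.
      rewrite -[_^-1]mul1r ler_pdivlMr; last by pos.
      by clear; lra.
    by clear -t1 t2; lra.
  - rewrite /e /Ce.
    have p1 : 0 <= dl * a by apply: mulr_ge0 => //; exact: ltW.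
    have p2 : 0 <= dl * W by apply: mulr_ge0 => //; exact: ltW.
    have p3 : 0 <= B * a by apply: mulr_ge0 => //; exact: ltW.
    have p4 := ltW s0.
    have q1 := mulr_ge0 CV0 p3; have q2 := mulr_ge0 CV0 p4.
    have B1p : 0 <= B1 := le_trans ler01 B10.
    have q3 := mulr_ge0 B1p p1; have q4 := mulr_ge0 B1p p2; have q5 := mulr_ge0 B1p p3.
    by clear -p1 p2 p3 p4 q1 q2 q3 q4 q5; lra.
  - have LJ' := ler_wpM2l (ltW dl0) LJ.
    by clear -Lv LJ' hLY hK; lra.
apply/negP; rewrite -leNgt; apply: pos.
have Yn := cts_gt (@cts_Y R d z) z0.
have rY : r0 < Y z.
  by apply: le_lt_trans rz _; rewrite -[ltRHS]mul1r ltr_pM2r //; move: e6; clear; lra.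
have Yr := cts_gt (@cts_Y R d z) rY.
near=> x.
have x0 : 0 < Y x by near: x.
have xr : r0 <= Y x by apply: ltW; near: x.
have := Hmin x xr; rewrite /ff.
have -> : \sum_(k < n) (f k).1.1 z = \sum_(k < n) J Gk k z.
  by apply: eq_bigr => k _; have [_ ->] := Hf k.
rewrite -aw => h; apply: le_trans h _.
have hs : \sum_(k < n) J Gk k x <= \sum_(k < n) (f k).1.1 x.
  by apply: ler_sum => k _; have [_ _ h _] := Hf k; exact: h.
have [_ /(_ w wr) hg] := Hgs x x0.
have := ler_wpM2l (ltW dl0) hs; have := ler_wpM2l (ltW B0) hg.
by clear; lra.
Unshelve. all: by end_near. Qed.

End MinimumPoint.

(** * Directions with bounded dyadic sums *)

Section PolarPoints.
Context {R : realType} {d : nat}.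
Local Notation V := 'rV[R]_d.
Local Notation m := d.+1.
Local Notation et := (@sepc R d).
Local Notation cp := (et / 10).
Implicit Types z w p : V.

Lemma hh_mono k n : (k <= n)%N -> hh n <= hh k :> R.
Proof.
move=> kn; rewrite /hh -(subnK kn) exprD ler_piMl ?exprn_ge0 ?invr_ge0 //.
by rewrite exprn_ile1 ?invr_ge0 // invf_le1 // ler1n.
Qed.

(** Used at the fixed comparison point, where [Y z1 / hh k >= s] on every scale: the sum of the
    [J Gk k z1] is then bounded independently of [n]. *)
Lemma psi_mw (s t : R) : 0 < s <= 1 -> s <= t -> psi t <= 12 / s * mw t.
Proof.
move=> /andP[s0 s1] st; have t0 : 0 < t by lra.
have s2 : 1 <= s^-1 by rewrite invf_ge1.
have [t1|t1] := leP t 1.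
  have h := @mw_small R t; have {}h := h (introT andP (conj (ltW t0) t1)).
  have q : Num.sqrt t <= 1 by rewrite -[leRHS]sqrtr1 ler_wsqrtr.
  have p := psi_le1 t.
  have ts : 1 <= s^-1 * t by rewrite mulrC ler_pdivlMr // mul1r.
  have : s^-1 * t <= s^-1 * (6 * mw t) by rewrite ler_wpM2l // invr_ge0 ltW.
  lra.
have h := mw_large (ltW t1); have p := psi_le2 t.
have q : 2 / t ^+ 3 <= 2 * t^-1.
  rewrite ler_wpM2l // lef_pV2 ?posrE ?exprn_gt0 // exprS ler_peMr ?(ltW t0) //.
  by rewrite exprn_ege1 // ltW.
have m0 : 0 <= mw t by apply: mw_ge0; exact: ltW.
have := ler_wpM2r m0 s2; lra.
Qed.

Lemma cts_gg (u : V -> R) (G : V -> V) z : hfun [set z | 0 < Y z] u G -> 0 < Y z ->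
  continuous_at z G -> continuous_at z (gg u G).
Proof.
move=> hu z0 cG; have [cu _ _] := hu z z0; have c2 := cts_enorm cG; have c3 := @cts_Y R d z.
by rewrite /gg; cts_tac.
Qed.

(** The direction is that of the minimum point [z]. Its height is below [hh n], so [z] lies within
    [4 * hh k] of every admissible [rho k *: x] and [Gk_low] applies at all scales [k < n]. *)
Lemma polar_points : (0 < d)%N -> exists2 M0 : R, 0 < M0 &
  forall (u : V -> R) (G : V -> V) (M : R),
  hfun [set z | 0 < Y z] u G -> (forall z, 0 < Y z -> continuous_at z G) ->
  (forall z, 0 < Y z -> enorm (G z) * Y z <= M) -> M <= M0 ->
  exists C : R, forall n, exists2 x, enorm x = 1 &
  forall rho : nat -> R,
    (forall k, (k < n)%N -> 0 <= rho k /\ hh k <= Y (rho k *: x) <= 4 * hh k) ->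
    \sum_(k < n) gg u G (rho k *: x) <= C.
Proof.
move=> d0; have [dl [B [M0 [[dl0 B0 M00 M01 BM] Hno]]]] := @no_min R d.
exists M0 => // u G M hu cG hM MM.
have M1 : M <= 1 by apply: le_trans MM M01.
have e0 := @sepc_gt0 R d; have e6 := @sepc_le R d.
have cp0 : 0 < cp by apply: divr_gt0.
pose y1 : R := (4 + 2 * d%:R)^-1.
have dpos : 0 <= d%:R :> R by exact: ler0n.
have y10 : 0 < y1 by rewrite invr_gt0; lra.
have y11 : y1 <= 1 by rewrite invf_le1; move: dpos; clear; lra.
(* The height of the comparison point [z1]; the factor [16] makes [sqrt (Y z1)] equal to [r / 4]. *)
pose s := y1 / 16; have s01 : 0 < s <= 1 by apply/andP; split; rewrite /s; lra.
have [s0 s1] := andP s01.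
pose z1 : V := Num.sqrt (1 - s) *: ei (Ordinal d0).
have Yz1 : Y z1 = s by rewrite /Y sqZ sq_ei mulr1 sqr_sqrtr; move: s1; clear; lra.
have z10 : 0 < Y z1 by rewrite Yz1.
pose v1 := expR (u z1); pose K := 4 * 32 ^+ m.+1 * (1 + s^-1) ^+ 2 * (12 / s).
pose g1 := 864 * expR 1 * M * v1.
pose P := v1 + dl * (K * g1).
pose r := Num.sqrt y1; have r0' : 0 < r by rewrite sqrtr_gt0.
have K0 : 0 <= K.
  have si : 0 <= s^-1 by rewrite invr_ge0 ltW.
  by rewrite /K; nng.
have v10 : 0 < v1 := expR_gt0 _.
have Mp : 0 <= M by apply: le_trans (hM z1 z10); apply: mulr_ge0; [exact: enorm_ge0|exact: ltW].
have g10 : 0 <= g1 by rewrite /g1; have v10' := ltW v10; nng.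
have P0 : 0 < P by apply: ltr_wpDr => //; apply: mulr_ge0; [exact: ltW|exact: mulr_ge0].
(* At height above [y1] the functional is at least [E * r = 2 (P + 1)], which exceeds the bound
   [Q = P + (P + 1) / 2] for its value at [z1]. *)
pose E := 2 * (P + 1) / r.
have E0 : 0 < E by apply: divr_gt0 => //; move: P0; clear; lra.
pose Q := P + E * (r / 4).
exists (16 * 208 ^+ m.+1 * (Q / dl)) => n.
(* The factor [cp] matches the hypothesis of [no_min], so that the minimum has height below
   [s * hh n]; the factor [s] makes [z1] admissible for every [n]. *)
have h0 := @hh_gt0 R; pose r0 := cp * (s * hh n).
have r00 : 0 < r0 by apply: mulr_gt0 => //; apply: mulr_gt0.
have hn1 := @hh_le1 R n.
have sh : s * hh n <= s by rewrite ler_piMr //; exact: ltW.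
have r0s : r0 <= s.
  by apply: le_trans sh; rewrite ler_piMl //; [exact/ltW/mulr_gt0|move: e6; clear; lra].
have r01 : r0 <= 1 by apply: le_trans r0s s1.
have gpos w : 0 < Y w -> 0 <= gg u G w by exact: gg_ge0.
have cgg w : 0 < Y w -> continuous_at w (gg u G) by move=> w0; exact: (cts_gg hu w0 (cG w w0)).
have [gs Hgs gs0] := majorant_exists r00 r01 gpos cgg.
have cgs z := @cts_gs R d _ _ r00 gpos gs Hgs gs0 z.
have [Gk HG] := infconv_exists r00 gpos Hgs gs0.
have gsl z z' : 0 < Y z -> 0 < Y z' -> gs z' <= gs z * slow z z'.
  exact: (gs_slow r00 gpos Hgs).
have gsv z : 0 < Y z -> gs z <= 864 * expR 1 * M * expR (u z).
  move=> z0; have [[w wr ->] _] := Hgs z z0; have w0 := lt_le_trans r00 wr.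
  exact: (gg_kap hu hM M1 z0 w0).
pose F := ff dl B E u gs Gk n.
have Fge z : 0 < Y z -> dl * (\sum_(k < n) J Gk k z) + E * Num.sqrt (Y z) <= F z.
  move=> z0; have h1 := ler_wpM2l (ltW B0) (gsv z z0).
  have vz : 0 < expR (u z) := expR_gt0 _.
  have h2 : B * (864 * expR 1 * M * expR (u z)) <= expR (u z).
    have -> : B * (864 * expR 1 * M * expR (u z)) = (B * (864 * expR 1) * M) * expR (u z) by ring.
    rewrite -[leRHS]mul1r; apply: ler_wpM2r; first exact: ltW.
    apply: le_trans BM; rewrite -!mulrA; apply: ler_wpM2l; first exact: ltW.
    by apply: ler_wpM2l; [exact: ler0n|apply: ler_wpM2l => //; exact: expR_ge0].
  by rewrite /F /ff; move: h1 h2; clear; lra.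
have F1 : F z1 <= Q.
  have hJ : \sum_(k < n) J Gk k z1 <= K * g1.
    apply: le_trans (_ : \sum_(k < n) K * gs z1 * mw (Y z1 / hh k) <= _).
      apply: ler_sum => k _; have hk := h0 k; have hk1 := @hh_le1 R k.
      have t1 : s <= Y z1 / hh k by rewrite Yz1 ler_pdivlMr //; rewrite ler_piMr // ltW.
      have p1 := psi_mw s01 t1; have p0 : 0 <= psi (Y z1 / hh k) by apply: psi_ge0; exact: lt_le_trans t1.
      have G1 := Gk_up r00 gpos Hgs gs0 HG k z10.
      have q1 : (1 + hh k / Y z1) ^+ 2 <= (1 + s^-1) ^+ 2.
        apply: lerXn2r; rewrite ?nnegrE.
        - by apply: addr_ge0 => //; apply: divr_ge0; exact: ltW.
        - by apply: addr_ge0 => //; rewrite invr_ge0 ltW.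
        by rewrite lerD2l Yz1 ler_piMl // invr_ge0 ltW.
      have G2 : Gk k z1 <= 4 * 32 ^+ m.+1 * (1 + s^-1) ^+ 2 * gs z1.
        apply: le_trans G1 _; apply: ler_wpM2r; first exact: gs0.
        by apply: ler_wpM2l => //; nng.
      rewrite /J; apply: le_trans (ler_pM (Gk_ge0 gs0 HG k z1) p0 G2 p1) _.
      by rewrite le_eqVlt; apply/orP; left; apply/eqP; rewrite /K; ring.
    rewrite -mulr_sumr; apply: le_trans (_ : K * gs z1 * 1 <= _).
      by apply: ler_wpM2l; [exact: mulr_ge0|exact: sum_mw].
    by rewrite mulr1; apply: ler_wpM2l => //; exact: gsv.
  have := ler_wpM2l (ltW dl0) hJ; have := mulr_ge0 (ltW B0) (gs0 z1).
  have -> : F z1 = v1 + dl * (\sum_(k < n) J Gk k z1) + E * (r / 4) - B * gs z1.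
    rewrite /F /ff Yz1 /s sqrtrM; last exact: ltW.
    have -> : 16^-1 = 4^-1 ^+ 2 :> R by field.
    by rewrite sqrtr_sqr ger0_norm.
  by rewrite /Q /P; clear; lra.
have Er : E * r = 2 * (P + 1) by rewrite /E; field; exact: lt0r_neq0.
have [|z zr|z zr Hmin] := @EVT_min_on R V F [set z | r0 <= Y z] _ (Y_compact (r := r0)).
- by exists 0; rewrite /= Y0.
- have z0 : 0 < Y z := lt_le_trans r00 zr.
  have [cu _ _] := hu z z0; have c2 := @cts_Y R d z; have c3 := cgs z z0.
  have c4 : continuous_at z (fun x => \sum_(k < n) J Gk k x).
    by apply: cts_sum => k; exact: (cts_J gs0 HG).
  by rewrite /F /ff; cts_tac.
have z0 : 0 < Y z := lt_le_trans r00 zr.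
have Jp : 0 <= \sum_(k < n) J Gk k z by apply: sumr_ge0 => k _; exact: (J_ge0 gs0 HG).
have Fz : F z <= Q by apply: le_trans (Hmin z1 _) F1; rewrite /= Yz1.
have Jz := le_trans (Fge z z0) Fz.
have Yzy : Y z <= y1.
  rewrite leNgt; apply/negP => h.
  have : r <= Num.sqrt (Y z) by apply: ler_wsqrtr; exact: ltW.
  move=> /(ler_wpM2l (ltW E0)); have := mulr_ge0 (ltW dl0) Jp.
  by move: Jz; rewrite /Q; move: Er P0; clear; lra.
have Yz4 : (4 + 2 * d%:R) * Y z <= 1.
  rewrite mulrC -ler_pdivlMr; last by move: dpos; clear; lra.
  by rewrite mul1r.
have Yzh : Y z < hh n.
  have : cp * Y z < r0.
    rewrite ltNge; apply/negP => h.
    exact: (Hno u G M r0 E gs Gk n z hu hM MM r00 gs0 Hgs HG E0 z0 Yz4 h Hmin).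
  rewrite /r0 ltr_pM2l // => /lt_le_trans; apply.
  by rewrite ler_piMl // ltW.
have ez1 : enorm z < 1 by rewrite -Y_gt0.
have ehY := h_leY z0.
have ez0 : 0 < enorm z by move: ehY Yzh hn1; clear; lra.
exists ((enorm z)^-1 *: z).
  by rewrite enormZ ger0_norm ?invr_ge0 ?enorm_ge0 // mulVf // lt0r_neq0.
move=> rho Hrho; set x := _ *: z.
have ex : enorm x = 1 by rewrite enormZ ger0_norm ?invr_ge0 ?enorm_ge0 // mulVf // lt0r_neq0.
have zx : z = enorm z *: x by rewrite scalerA mulfV ?lt0r_neq0 // scale1r.
have JQ : \sum_(k < n) J Gk k z <= Q / dl.
  rewrite ler_pdivlMr // mulrC; apply: le_trans Jz; rewrite lerDl.
  by apply: mulr_ge0; [exact: ltW|exact: sqrtr_ge0].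
apply: le_trans (ler_wpM2l _ JQ); last by nng.
rewrite mulr_sumr; apply: ler_sum => k _.
have kn := ltn_ord k; have [p0 pk] := Hrho k kn; have [pk1 pk2] := andP pk.
have hkn : hh n <= hh k :> R.
  exact: hh_mono (ltnW kn).
have Yp0 : 0 < Y (rho k *: x) by apply: lt_le_trans pk1.
have pr : r0 <= Y (rho k *: x).
  apply: le_trans pk1; apply: le_trans hkn; rewrite /r0 mulrA ler_piMl ?(ltW (h0 n)) //.
  by move: e6 s1 s0 cp0; clear; nra.
apply: le_trans (gs_ge r00 Hgs pr) _.
have ep : enorm (rho k *: x) = rho k by rewrite enormZ ger0_norm // ex mulr1.
have hY2 := h_leY Yp0; have p1 : enorm (rho k *: x) < 1 by rewrite -Y_gt0.
rewrite ep in hY2 p1.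
have zp : enorm (z - rho k *: x) <= 4 * hh k.
  rewrite {1}zx -scalerBl enormZ ex mulr1 ler_norml.
  by move: ehY Yzh hkn hY2 pk2 p1 ez1 (h0 k); clear => *; apply/andP; split; lra.
apply: le_trans (Gk_low r00 gpos Hgs gs0 HG pk zp) _.
apply: ler_wpM2l; first by nng.
rewrite /J ler_peMr ?(Gk_ge0 gs0 HG) // psi_small; first by rewrite lerDl sqrtr_ge0.
by rewrite divr_gt0 //= ler_pdivrMr // mul1r; exact: le_trans (ltW Yzh) hkn.
Qed.

End PolarPoints.

(** * Bloch functions *)

Section HarmonicBall.
Context {R : realType} {d : nat}.
Local Notation V := 'rV[R]_d.
Implicit Types x z q : V.

Lemma is_derive_carath (f w : R -> R) : continuous_at 0 w ->
  (\forall s \near 0, f s = f 0 + s * w s) -> is_derive (0 : R) 1 f (w 0).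
Proof.
move=> cw Hw.
have H : h^-1 *: (f (h *: 1 + 0) - f 0) @[h --> 0^'] --> w 0.
  have c0 : w h @[h --> 0^'] --> w 0 by exact: cvg_within_filter cw.
  apply: cvg_trans c0; apply: near_eq_cvg; near=> h.
  have h0 : h != 0 by near: h; exact: nbhs_dnbhs_neq.
  have -> : f (h *: 1 + 0) = f 0 + h * w h.
    by rewrite addr0 /GRing.scale /= mulr1; near: h; exact: nbhs_dnbhs.
  by rewrite [f 0 + _]addrC addrK /GRing.scale /= mulKf.
by split; [exact: (cvgP _ H)|exact: cvg_lim].
Unshelve. all: by end_near. Qed.

Lemma partial_line (f : V -> R) i x : partial_derivable i f x ->
  is_derive (0 : R) 1 (fun s => f (x + s *: ei i)) (partial_derive i f x).
Proof.
move=> D.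
have H : (fun h : R => h^-1 *: (f (x + (h *: 1 + 0) *: ei i) - f (x + 0 *: ei i))) =
         (fun h : R => h^-1 *: (f (h *: ei i + x) - f x)).
  by apply/funext => h; rewrite addr0 scale0r addr0 /GRing.scale /= mulr1 [x + _]addrC.
split; first by rewrite /derivable /= H.
by rewrite /derive /= H.
Qed.

Lemma partial_line_at (f : V -> R) i x s : partial_derivable i f (x + s *: ei i) ->
  is_derive s 1 (fun t => f (x + t *: ei i)) (partial_derive i f (x + s *: ei i)).
Proof.
move=> /partial_line D; apply: is_derive_shift0.
by move: D; congr (is_derive _ _ _ _); apply/funext => t; rewrite scalerDl addrA.
Qed.

Lemma cts_squeeze0 (tau : R -> R) K : (forall s, `|tau s| <= `|s| * K) -> continuous_at 0 tau.
Proof.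
move=> H.
have t0 : tau 0 = 0 by apply/normr0_eq0/le_anti; rewrite normr_ge0 andbT (le_trans (H 0)) // normr0 mul0r.
have c : continuous_at (0 : R) (fun s : R => `|s| * K).
  have cn : continuous_at (0 : R) (fun s : R => `|s|) by exact: norm_continuous.
  by cts_tac.
rewrite /continuous_at t0; apply/cvgr0Pnorm_lt => e e0.
have := cts_lt c (a := e); rewrite normr0 mul0r => /(_ e0).
by apply: filterS => s; exact: le_lt_trans.
Qed.

Section Partials.
Variable f : V -> R.
Hypothesis fD : forall i x, 0 < Y x -> partial_derivable i f x.
Hypothesis fC : forall i x, 0 < Y x -> continuous_at x (partial_derive i f).

(** Mean value theorem in the [i]-th coordinate. The intermediate parameter [tau s] is merely
    selected, but [|tau s| <= |s * a|] makes it continuous at [0], and with it [phi]. *)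
Lemma partial_step i x q (a : R) : 0 < Y x -> exists phi, [/\ continuous_at 0 phi,
  phi 0 = partial_derive i f x &
  \forall s \near 0, f (x + s *: (a *: ei i + q)) = f (x + s *: q) + s * (a * phi s)].
Proof.
rewrite Y_gt0 => x1.
pose r := (1 - enorm x) / 2; pose K := enorm q + `|a|.
have r0 : 0 < r by rewrite /r; lra.
have K0 : 0 <= K by rewrite addr_ge0 ?enorm_ge0.
have small (s t : R) : `|t| <= `|s * a| -> `|s| * K < r -> 0 < Y (x + s *: q + t *: ei i).
  move=> ts sr; rewrite Y_gt0.
  have h1 := enormD (x + s *: q) (t *: ei i); have h2 := enormD x (s *: q).
  rewrite enormZ enorm_ei mulr1 in h1; rewrite enormZ in h2.
  by rewrite normrM in ts; move: sr; rewrite /K /r; lra.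
have H s : exists t, `|t| <= `|s * a| /\ (`|s| * K < r ->
    f (x + s *: (a *: ei i + q)) - f (x + s *: q) = s * a * partial_derive i f (x + s *: q + t *: ei i)).
  have [sr|sr] := ltP (`|s| * K) r; last by exists 0; rewrite normr0.
  have [|t tb E] := @mvt_line R (fun t => f (x + s *: q + t *: ei i))
    (fun t => partial_derive i f (x + s *: q + t *: ei i)) 0 (s * a).
    by move=> t /between0 tb; apply: partial_line_at; apply: fD; exact: small.
  exists t; split; first exact: between0.
  move=> _; rewrite subr0 scale0r addr0 in E; rewrite mulrC -E.
  by congr (f _ - _); rewrite scalerDr scalerA -addrA [s *: q + _]addrC.
have /choice[tau Htau] := H.
have ct : continuous_at 0 tau.
  by apply: (@cts_squeeze0 tau `|a|) => s; rewrite -normrM; have [] := Htau s.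
have t0 : tau 0 = 0.
  by have [h _] := Htau 0; apply/normr0_eq0/le_anti; rewrite normr_ge0 andbT (le_trans h) // mul0r normr0.
exists (fun s => partial_derive i f (x + s *: q + tau s *: ei i)); split.
- have c : continuous_at (0 : R) (fun s => x + s *: q + tau s *: ei i) by cts_tac.
  by apply: (cts_comp c); rewrite t0 !scale0r !addr0; apply: fC; rewrite Y_gt0.
- by rewrite t0 !scale0r !addr0.
have c : continuous_at (0 : R) (fun s : R => `|s| * K).
  have cn : continuous_at (0 : R) (fun s : R => `|s|) by exact: norm_continuous.
  by cts_tac.
have := cts_lt c (a := r); rewrite normr0 mul0r => /(_ r0).
apply: filterS => s sr; have [_ /(_ sr) E] := Htau s.
by rewrite mulrA -E [RHS]addrC subrK.
Qed.

(** Continuous partial derivatives give all directional derivatives: the direction is built up one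
    coordinate at a time, each step contributing one partial derivative. *)
Lemma partial_derive_dir x e : 0 < Y x ->
  is_derive (0 : R) 1 (fun s => f (x + s *: e)) (dot (gradient f x) e).
Proof.
move=> x0.
have H (l : seq 'I_d) : exists w, [/\ continuous_at 0 w,
    w 0 = \sum_(i <- l) e ord0 i * partial_derive i f x &
    \forall s \near 0, f (x + s *: (\sum_(i <- l) e ord0 i *: ei i)) = f x + s * w s].
  elim: l => [|j l [w [cw w0 Hw]]].
    exists (fun=> 0); split; [exact: ctsC|by rewrite big_nil|].
    by near=> s; rewrite big_nil scaler0 mulr0 !addr0.
  have [phi [cp p0 Hp]] := partial_step j (\sum_(i <- l) e ord0 i *: ei i) (e ord0 j) x0.
  exists (fun s => e ord0 j * phi s + w s); split.
  - by cts_tac.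
  - by rewrite big_cons p0 w0.
  near=> s; rewrite big_cons (near Hp s) // (near Hw s) //; ring.
have [w [cw w0 Hw]] := H (index_enum _).
have <- : w 0 = dot (gradient f x) e.
  by rewrite w0 /dot; apply: eq_bigr => i _; rewrite mxE mulrC.
apply: is_derive_carath => //; apply: filterS Hw => s; rewrite scale0r addr0 => <-.
by congr (f (x + s *: _)); exact: row_sum_delta.
Unshelve. all: by end_near. Qed.

End Partials.

Lemma harmonic_hfun (b : V -> R) : harmonic_on (@unit_ball R d) b ->
  hfun [set z | 0 < Y z] b (gradient b).
Proof.
move=> [C2 L0].
have H (x : V) : 0 < Y x -> unit_ball x by rewrite Y_gt0; exact: id.
have bD i x : 0 < Y x -> partial_derivable i b x by move=> x0; have [_ /(_ i)[]] := C2 x (H x x0).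
have bC i x : 0 < Y x -> continuous_at x (partial_derive i b) by move=> x0; have [_ /(_ i)[]] := C2 x (H x x0).
move=> x x0; have [cb _ H2] := C2 _ (H _ x0).
split=> [//||e]; last exact: partial_derive_dir.
exists (fun i => partial_derive i (partial_derive i b) x / 2).
  move=> i.
  have J : jet (fun s => b (x + s *: ei i)) (b (x + 0 *: ei i)) (gradient b x ord0 i)
     (partial_derive i (partial_derive i b) x / 2).
    apply: (@jet_Peano R _ (fun s => partial_derive i b (x + s *: ei i))).
    - have c : continuous_at (0 : R) (fun s => x + s *: ei i) by cts_tac.
      have : \forall s \near (0 : R), 0 < Y (x + s *: ei i).
        apply: (cts_near (P := fun y => 0 < Y y) c).
        by rewrite scale0r addr0; exact: (cts_gt (@cts_Y R d x) x0).
      by apply: filterS => s h; apply: partial_line_at; exact: bD.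
    - by rewrite scale0r addr0 mxE.
    - by apply: partial_line; have [] := H2 i i.
  by move: J; rewrite scale0r addr0.
by rewrite -mulr_suml -/(laplacian b x) L0 ?mul0r //; exact: H.
Qed.

Lemma gradient_cts (b : V -> R) z : harmonic_on (@unit_ball R d) b -> 0 < Y z ->
  continuous_at z (gradient b).
Proof.
move=> [C2 _]; rewrite Y_gt0 => z1; have [_ H _] := C2 z z1.
apply: (@cts_eq _ _ _ (fun x => \sum_i partial_derive i b x *: ei i)).
  move=> x; rewrite [LHS]row_sum_delta; by apply: eq_bigr => i _; rewrite mxE.
elim: (index_enum _) => [|i l IH].
  by apply: (cts_eq (fun x => big_nil _ _ _ _)); exact: ctsC.
apply: (cts_eq (fun x => big_cons _ _ _ _ _ _)); have [_ c] := H i.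
by apply: ctsD => //; apply: ctsZ => //; exact: ctsC.
Qed.

Lemma bloch_bound (b : V -> R) : bloch b ->
  exists S : R, forall z, 0 < Y z -> enorm (gradient b z) * Y z <= S.
Proof.
move=> [_ fin]; pose A := [set (enorm (gradient b z) * (1 - enorm z))%:E | z in @unit_ball R d].
have ub z : 0 < Y z -> ((enorm (gradient b z) * (1 - enorm z))%:E <= ereal_sup A)%E.
  by rewrite Y_gt0 => z1; apply: ereal_sup_ubound; exists z.
(* The value at the origin keeps the supremum from being [-oo]. *)
have fn : ereal_sup A \is a fin_num.
  rewrite fin_numElt (lt_le_trans (ltNyr _) (ub 0 _)) ?Y0 //=; exact: fin.
exists (2 * fine (ereal_sup A)) => z z0; have := ub z z0.
rewrite -(fineK fn) lee_fin; have := ler_wpM2l (enorm_ge0 (gradient b z)) (Y_le2h z0).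
by rewrite /=; lra.
Qed.

Lemma hfunZ (D : set V) U G (k : R) : hfun D U G -> hfun D (fun x => k * U x) (fun x => k *: G x).
Proof.
move=> H x Dx; have [cU jU dU] := H x Dx; split.
- by cts_tac.
- by apply: (jet2_eqc (jet2Z k jU)); rewrite ?mulr0.
- by move=> e; have De := dU e; rewrite dotZl; apply: is_deriveZ.
Qed.

End HarmonicBall.

(** * Integration along a radius *)

Section RadialIntegral.
Context {R : realType}.

Lemma hhS k : hh k.+1 = hh k / 2 :> R.
Proof. by rewrite /hh exprS mulrC. Qed.

Lemma dyadic_index (r : R) : 0 <= r < 1 -> exists k, 1 - hh k <= r < 1 - hh k.+1.
Proof.
move=> /andP[r0 r1].
have ex : exists n, r < 1 - hh n.
  pose i := Num.Def.archi_bound (1 - r)^-1; exists i.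
  have h := upper_nthrootP (leqnn i); rewrite /hh exprVn.
  have q0 : 0 < 1 - r by lra.
  have p0 : 0 < 2 ^+ i :> R by rewrite exprn_gt0.
  have : (2 ^+ i)^-1 < ((1 - r)^-1)^-1 by rewrite ltf_pV2 ?posrE ?invr_gt0.
  by rewrite invrK; lra.
case: (ex_minnP ex) => [[|k] rk Hk]; first by move: rk; rewrite /hh expr0; lra.
exists k; rewrite rk andbT leNgt; apply/negP => /Hk; by rewrite ltnn.
Qed.

(** The [k]-th dyadic interval has length [hh k.+1], so it contributes at most [g k] to the
    integral. *)
Lemma dyadic_integral (F : R -> R) (g : nat -> R) (C : R) :
  (forall r : R, 0 <= r < 1 -> continuous_at r F) -> (forall r, 0 <= F r) ->
  (forall k (r : R), 1 - hh k <= r <= 1 - hh k.+1 -> F r <= g k / hh k.+1) ->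
  (forall n, \sum_(k < n) g k <= C) ->
  (\int[@lebesgue_measure R]_(r in `[0%R, 1%R[%classic) (F r)%:E < +oo)%E.
Proof.
move=> cF F0 Fg gC; have h0 := @hh_gt0 R; have h1 := @hh_le1 R.
pose I k : set R := `[1 - hh k, 1 - hh k.+1[%classic.
have II : \bigcup_k I k = `[0%R, 1%R[%classic.
  apply/seteqP; split => r /=.
    move=> [k _] /=; rewrite /I /= !in_itv /= => /andP[a b].
    by have ha := h1 k; have hb := h0 k.+1; apply/andP; split; lra.
  rewrite in_itv /= => /dyadic_index[k hk]; by exists k.
have mF (D : set R) : D `<=` `[0%R, 1%R[%classic -> measurable D -> measurable_fun D F.
  move=> DI mD; apply: measurable_realfun.subspace_continuous_measurable_fun => //.
  apply: continuous_in_subspaceT => r /set_mem /DI /=; rewrite in_itv /=; exact: cF.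
have sI k : I k `<=` `[0%R, 1%R[%classic by rewrite -II; exact: bigcup_sup.
have mI k : measurable (I k) by exact: measurable_itv.
have g0 k : 0 <= g k.
  have := Fg k (1 - hh k); rewrite lexx hhS; have hk := h0 k.
  have -> : 1 - hh k <= 1 - hh k / 2 :> R by lra.
  move=> /(_ isT) /(le_trans (F0 _)); by rewrite pmulr_lge0 // invr_gt0 divr_gt0.
rewrite -II ge0_integral_bigcup //; last first.
- apply: ltn_trivIset => i j ij; rewrite -subset0 => r [] /=.
  rewrite /I /= !in_itv /= => /andP[_ a] /andP[b _].
  by have := hh_mono ij (R := R); lra.
- by move=> r _; rewrite lee_fin.
- by apply/measurable_realfun.measurable_EFinP; rewrite II; apply: mF.
apply: le_lt_trans (ltry C); apply: lime_le.
  by apply: is_cvg_nneseries => k _ _; apply: integral_ge0 => r _; rewrite lee_fin.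
near=> n; rewrite big_mkord.
apply: le_trans (_ : (\sum_(k < n) (g k)%:E <= _)%E); last by rewrite sumEFin lee_fin.
apply: lee_sum => k _.
apply: le_trans (_ : (\int[@lebesgue_measure R]_(r in I k) (cst (g k / hh k.+1)%:E r) <= _)%E).
  apply: ge0_le_integral => //.
  - exact: mI.
  - by move=> r _; rewrite lee_fin.
  - by apply/measurable_realfun.measurable_EFinP; apply: mF.
  - by move=> r; rewrite /I /= in_itv /= lee_fin => /andP[a /ltW b]; apply: Fg; rewrite a.
rewrite integral_cst; last exact: mI.
have E : lebesgue_measure (I k) = (hh k.+1)%:E.
  rewrite /I lebesgue_measure_itv /= lte_fin.
  have -> : 1 - hh k < 1 - hh k.+1 :> R by rewrite hhS; have := h0 k; lra.
  by rewrite -EFinB hhS; congr (_%:E); field.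
apply: le_trans (_ : ((g k / hh k.+1)%:E * (hh k.+1)%:E <= _)%E).
  by rewrite le_eqVlt; apply/orP; left; apply/eqP; congr (_ * _)%E; exact: E.
by rewrite -EFinM lee_fin divfK // lt0r_neq0.
Unshelve. all: by end_near. Qed.

End RadialIntegral.

(** * A limiting direction on the sphere *)

Section LimitDirection.
Context {R : realType} {d : nat}.
Local Notation V := 'rV[R]_d.
Implicit Types x z : V.

Lemma Y_ray x (t : R) : enorm x = 1 -> Y (t *: x) = 1 - t ^+ 2.
Proof. by move=> ex; rewrite /Y sqZ -sqr_enorm ex expr1n mulr1. Qed.

(** A cluster point of the directions works: each finite sum is continuous in the direction and, its
    terms being nonnegative, is bounded by [C] at every later direction. Admissibility of [rho] is
    stated by [1 - rho k ^+ 2], the common value of [Y (rho k *: z)] for all unit [z]. *)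
Lemma limit_direction (g : V -> R) (C : R) :
  (forall z, 0 < Y z -> 0 <= g z) -> (forall z, 0 < Y z -> continuous_at z g) ->
  (forall n, exists2 x, enorm x = 1 & forall rho : nat -> R,
    (forall k, (k < n)%N -> 0 <= rho k /\ hh k <= Y (rho k *: x) <= 4 * hh k) ->
    \sum_(k < n) g (rho k *: x) <= C) ->
  exists2 x, enorm x = 1 & forall rho : nat -> R,
    (forall k, 0 <= rho k /\ hh k <= 1 - rho k ^+ 2 <= 4 * hh k) ->
    forall n, \sum_(k < n) g (rho k *: x) <= C.
Proof.
move=> g0 cg H.
have /choice[xs Hxs] : forall n, exists x, enorm x = 1 /\ forall rho : nat -> R,
    (forall k, (k < n)%N -> 0 <= rho k /\ hh k <= Y (rho k *: x) <= 4 * hh k) ->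
    \sum_(k < n) g (rho k *: x) <= C.
  by move=> n; have [x ex Hx] := H n; exists x.
have Yxs n : Y (xs n) = 0.
  by have [ex _] := Hxs n; have := Y_ray 1 ex; rewrite scale1r expr1n subrr.
have cK := @Y_compact R d 0.
have [|x [Kx Cx]] := cK (xs n @[n --> \oo]) _.
  by exists 0 => // n _; rewrite /= Yxs.
have ex : enorm x = 1.
  apply/eqP; rewrite eq_le; apply/andP; split.
    by rewrite enorm_le // expr1n; move: Kx; rewrite /= /Y; lra.
  rewrite leNgt -Y_gt0; apply/negP => x0.
  have Fr : (xs n @[n --> \oo]) (range xs) by exists 0 => // n _; exists n.
  have [z [[n _ <-]]] := Cx _ _ Fr (cts_gt (@cts_Y R d x) x0).
  by rewrite /= Yxs ltxx.
exists x => // rho Hrho n.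
rewrite leNgt; apply/negP => Cn.
have pos k (z : V) : enorm z = 1 -> 0 < Y (rho k *: z).
  move=> ez; rewrite Y_ray //; have [_ /andP[h _]] := Hrho k.
  exact: lt_le_trans (hh_gt0 k) h.
have c : continuous_at x (fun z => \sum_(k < n) g (rho k *: z)).
  apply: cts_sum => k.
  have c1 : continuous_at x (fun z => rho k *: z) by cts_tac.
  by apply: (cts_comp c1); apply: cg; exact: pos.
have Fn : (xs m @[m --> \oo]) [set xs m | m in [set m | (n <= m)%N]].
  by exists n => // m nm; exists m.
have [z [[m nm <-]]] := Cx _ _ Fn (cts_gt c Cn).
apply/negP; rewrite -leNgt; have [em Hm] := Hxs m.
apply: le_trans (Hm rho _); last by move=> k _; rewrite Y_ray.
rewrite -!(big_mkord xpredT (fun k => g (rho k *: xs m))) (big_cat_nat _ nm) //= lerDl.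
by apply: sumr_ge0 => k _; apply: g0; exact: pos.
Qed.

End LimitDirection.

(** * Estimates along one radius *)

Section Ray.
Context {R : realType} {d : nat}.
Local Notation V := 'rV[R]_d.

Lemma dyadic_1B_sqr k (t : R) : 1 - hh k <= t <= 1 - hh k.+1 -> hh k.+1 <= 1 - t ^+ 2 <= 4 * hh k.+1.
Proof.
have h0 := @hh_gt0 R k; have h1 := @hh_le1 R k; rewrite hhS => /andP[a b].
by apply/andP; split; nra.
Qed.

(** [f k] is the maximum of [gg u G] over the [k]-th dyadic interval of the radius. There the
    derivative of [expR u] is at most [f k / hh k.+1] and the length is [hh k.+1], so [expR u] grows
    by at most [f k], and these increments sum to at most [C]. *)
Lemma ray_bound (u : V -> R) (G : V -> V) (C : R) x :
  hfun [set z | 0 < Y z] u G -> (forall z, 0 < Y z -> continuous_at z G) -> enorm x = 1 ->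
  (forall rho : nat -> R, (forall k, 0 <= rho k /\ hh k <= 1 - rho k ^+ 2 <= 4 * hh k) ->
    forall n, \sum_(k < n) gg u G (rho k *: x) <= C) ->
  exists f : nat -> R, [/\ forall n, \sum_(k < n) f k <= C,
    forall k (t : R), 1 - hh k <= t <= 1 - hh k.+1 ->
      expR (u (t *: x)) * enorm (G (t *: x)) <= f k / hh k.+1 &
    forall k (t : R), 1 - hh k <= t <= 1 - hh k.+1 -> expR (u (t *: x)) <= expR (u 0) + C].
Proof.
move=> hu cG ex HC; have h0 := @hh_gt0 R; have h1 := @hh_le1 R.
have Ypos k (t : R) : 1 - hh k <= t <= 1 - hh k.+1 -> hh k.+1 <= Y (t *: x).
  by rewrite Y_ray // => /dyadic_1B_sqr /andP[].
have Ypos0 k (t : R) : 1 - hh k <= t <= 1 - hh k.+1 -> 0 < Y (t *: x).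
  by move=> /Ypos; apply: lt_le_trans.
have cx (t : R) : continuous_at t (fun t => t *: x) by cts_tac.
have H k : exists c : R, 1 - hh k <= c <= 1 - hh k.+1 /\
    forall t, 1 - hh k <= t <= 1 - hh k.+1 -> gg u G (t *: x) <= gg u G (c *: x).
  have [|t /= tk|c /= ck Hc] := @EVT_max_on R R (fun t => gg u G (t *: x)) `[1 - hh k, 1 - hh k.+1]%classic _
     (@segment_compact R _ _).
  - by exists (1 - hh k); rewrite /= in_itv /= lexx hhS; have := h0 k; lra.
  - move: tk; rewrite in_itv /= => /Ypos0 p0; apply: (cts_comp (cx t)).
    exact: (cts_gg hu p0 (cG _ p0)).
  exists c; split; first by move: ck; rewrite in_itv.
  by move=> t tk; apply: Hc; rewrite /= in_itv.
have /choice[rho Hrho] := H.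
pose f k := gg u G (rho k *: x).
have f0 k : 0 <= f k by apply: gg_ge0; apply: Ypos0 (proj1 (Hrho k)).
have fC n : \sum_(k < n) f k <= C.
  (* The points of the [k]-th interval have heights between [hh k.+1] and [4 * hh k.+1], hence the
     shift by one; the vacant index [0] is filled by the origin. *)
  pose rho' k := if k is j.+1 then rho j else 0.
  have adm k : 0 <= rho' k /\ hh k <= 1 - rho' k ^+ 2 <= 4 * hh k.
    case: k => [|k] /=; first by split; rewrite // expr0n /= subr0 /hh expr0 lexx; lra.
    have [r _] := Hrho k; split; last exact: dyadic_1B_sqr.
    by have := h1 k; have /andP[] := r; lra.
  have := HC rho' adm n.+1; rewrite big_ord_recl /=; apply: le_trans.
  by rewrite lerDr; apply: gg_ge0; rewrite scale0r Y0.
have fg k (t : R) : 1 - hh k <= t <= 1 - hh k.+1 ->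
    expR (u (t *: x)) * enorm (G (t *: x)) <= f k / hh k.+1.
  move=> tk; have [_ /(_ t tk) h] := Hrho k.
  rewrite ler_pdivlMr //; apply: le_trans h; rewrite /gg -mulrA mulrC.
  apply: ler_wpM2r; last exact: Ypos tk.
  by apply: mulr_ge0; [exact: expR_ge0|exact: enorm_ge0].
have S0 n : 0 <= \sum_(k < n) f k by apply: sumr_ge0 => k _.
have Hv k (t : R) : 1 - hh k <= t <= 1 - hh k.+1 ->
    expR (u (t *: x)) <= expR (u ((1 - hh k) *: x)) + f k.
  move=> /andP[tk1 tk2].
  have [|s] := @mvt_line R (fun t => expR (u (t *: x)))
     (fun t => expR (u (t *: x)) * dot (G (t *: x)) x) (1 - hh k) t.
    move=> s; rewrite min_l // max_r // => /andP[s1 s2].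
    have s0 : 0 < Y (0 + s *: x) by rewrite add0r; apply: (@Ypos0 k); rewrite s1 (le_trans s2).
    have D := hfun_line hu s0; rewrite add0r in D.
    have {}D : is_derive s 1 (fun t => u (t *: x)) (dot (G (s *: x)) x).
      by move: D; congr (is_derive _ _ _ _); apply/funext => t'; rewrite add0r.
    exact: is_derive1_comp (is_derive_expR _) D.
  rewrite min_l // max_r // => /andP[s1 s2] E.
  have sk : 1 - hh k <= s <= 1 - hh k.+1 by rewrite s1 (le_trans s2).
  have l1 : expR (u (s *: x)) * dot (G (s *: x)) x <= f k / hh k.+1.
    apply: le_trans (fg k s sk); apply: ler_wpM2l; first exact: expR_ge0.
    by have := dot_le (G (s *: x)) x; rewrite ex mulr1.
  have l2 : 0 <= t - (1 - hh k) <= hh k.+1.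
    by move: tk1 tk2; rewrite hhS; lra.
  have [l3 l4] := andP l2.
  have := ler_wpM2r l3 l1; rewrite -E.
  have : f k / hh k.+1 * (t - (1 - hh k)) <= f k.
    rewrite -mulrA ler_piMr // mulrC ler_pdivrMr // mul1r //.
  by lra.
have Va k : expR (u ((1 - hh k) *: x)) <= expR (u 0) + \sum_(j < k) f j.
  elim: k => [|k IH]; first by rewrite big_ord0 /hh expr0 subrr scale0r addr0.
  rewrite big_ord_recr /= addrA; apply: le_trans (Hv k _ _) _; last by rewrite lerD2r.
  by rewrite lexx andbT hhS; have := h0 k; lra.
exists f; split => // k t tk; apply: le_trans (Hv k t tk) _.
have := fC k.+1; rewrite big_ord_recr /= => h; have := Va k; lra.
Qed.

End Ray.

Theorem theorem1 (R : realType) (d : nat) (hd : (2 <= d)%N)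
    (b : 'rV[R]_d -> R) (hb : bloch b) :
  exists x : 'rV[R]_d,
    unit_sphere x /\
    (radial_integral (fun z => (enorm (gradient b z) * expR (b z))%R) x
       < +oo)%E.
Proof.
have [S HS] := bloch_bound hb; have [hh0 _] := hb.
have [M0 M00 HP] := @polar_points R d (ltnW hd).
have SM : 0 <= S / M0.
  have z0 : 0 < Y (0 : 'rV[R]_d) by rewrite Y0.
  apply: divr_ge0; last exact: ltW.
  by apply: le_trans (HS 0 z0); apply: mulr_ge0; [exact: enorm_ge0|exact: ltW].
(* [N] exceeds [S / M0], so that [u = b / N] satisfies the gradient bound with [M0]; the successor
   makes [N] positive. *)
pose N := (Num.Def.archi_bound (S / M0)).+1; pose k : R := N%:R^-1.
have N0 : 0 < N%:R :> R by [].
have k0 : 0 < k by rewrite invr_gt0.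
pose u z := k * b z; pose G z := k *: gradient b z.
have hu : hfun [set z | 0 < Y z] u G by apply: hfunZ; exact: harmonic_hfun.
have cG z : 0 < Y z -> continuous_at z G.
  by move=> z0; have c := gradient_cts hh0 z0; rewrite /G; apply: ctsZ => //; exact: ctsC.
have hM z : 0 < Y z -> enorm (G z) * Y z <= M0.
  move=> z0; rewrite enormZ ger0_norm ?(ltW k0) // -mulrA.
  rewrite /k mulrC ler_pdivrMr //; apply: le_trans (HS z z0) _.
  rewrite mulrC -ler_pdivrMr //; apply: ltW; apply: lt_le_trans (archi_boundP SM) _.
  by rewrite ler_nat.
have [C HC] := HP u G M0 hu cG hM (lexx _).
have cgg z : 0 < Y z -> continuous_at z (gg u G) by move=> z0; exact: (cts_gg hu z0 (cG z z0)).
have [x ex Hx] := limit_direction (fun z => @gg_ge0 R d u G z) cgg HC.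
have [f [fC fg fv]] := ray_bound hu cG ex Hx.
exists x; split => //; rewrite /radial_integral.
pose D := expR (u 0) + C.
apply: (@dyadic_integral R (fun r => enorm (gradient b (r *: x)) * expR (b (r *: x)))
  (fun j => N%:R * D ^+ N.-1 * f j) (N%:R * D ^+ N.-1 * C)).
- move=> r /andP[r0 r1].
  have z0 : 0 < Y (r *: x) by rewrite Y_gt0 enormZ ger0_norm // ex mulr1.
  have cx : continuous_at r (fun r => r *: x) by cts_tac.
  apply: (cts_comp cx (g := fun z => enorm (gradient b z) * expR (b z))).
  have c1 := cts_enorm (gradient_cts hh0 z0); have [c2 _ _] := harmonic_hfun hh0 z0.
  by cts_tac.
- by move=> r; apply: mulr_ge0; [exact: enorm_ge0|exact: expR_ge0].
- move=> j r rj; have l1 := fg j r rj; have l2 := fv j r rj.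
  (* Since [b = N u], one has [|grad b| e^b = N (e^u)^(N - 1) * e^u |grad u|], and [e^u] is bounded
     by [D] along the radius. *)
  have -> : enorm (gradient b (r *: x)) * expR (b (r *: x)) =
    N%:R * expR (u (r *: x)) ^+ N.-1 * (expR (u (r *: x)) * enorm (G (r *: x))).
    have -> : expR (b (r *: x)) = expR (u (r *: x)) ^+ N.
      by rewrite -expRM_natl /u /k mulVKf // lt0r_neq0.
    rewrite /G enormZ ger0_norm ?(ltW k0) // [_ ^+ N]exprS /k /=; field.
    by rewrite lt0r_neq0.
  rewrite -[leRHS]mulrA; apply: ler_pM => //.
  - by apply: mulr_ge0; [exact: expR_ge0|exact: enorm_ge0].
  - by apply: ler_wpM2l; [exact: ler0n|apply: lerXn2r => //; rewrite nnegrE ?expR_ge0 //; exact: le_trans (expR_ge0 _) l2].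
- move=> n; rewrite -mulr_sumr; apply: ler_wpM2l => //.
  have C0 : 0 <= C by have := fC 0%N; rewrite big_ord0.
  by apply: mulr_ge0; [exact: ler0n|apply: exprn_ge0; apply: addr_ge0 => //; exact: expR_ge0].
Qed.
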